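(* Let $A=(A_1,\ldots,A_M)$ with $A_i\in GL_2(\mathbb{R})$ and $\|A_i\|<1$ for $i=1,\ldots,M$. Suppose that $\dim_{\mathsf{AFF}}(A)\in(0,2)$, that the $A_i$ do not have a common invariant one-dimensional subspace of $\mathbb{R}^2$, and that at least one of the $A_i$ is hyperbolic. Let $\mu$ be the Käenmäki measure of $A$. Then for every $\varepsilon>0$ there exist $n\in\mathbb{N}$, a set $\Gamma\subset\{1,\ldots,M\}^n$, and a Bernoulli measure $\nu$ on $\Gamma^{\mathbb{N}}$ such that the following hold: (1) $\dim_{\mathsf{LY}}(\nu,(A_{\mathtt{i}})_{\mathtt{i}\in\Gamma})\ge \dim_{\mathsf{AFF}}(A)-\varepsilon$. Moreover, $\frac1n\lambda_1(\nu)$, $\frac1n\lambda_2(\nu)$ and $\frac1n h(\nu)$ are each within $\varepsilon$ of $\lambda_1(\mu)$, $\lambda_2(\mu)$ and $h(\mu)$ respectively, where the Lyapunov exponents of $\nu$ are taken with respect to the tuple $(A_{\mathtt{i}})_{\mathtt{i}\in\Gamma}$ and the entropy of $\nu$ with respect to the shift on $\Gamma^{\mathbb{N}}$, and the Lyapunov exponents of $\mu$ are taken with respect to $A$. (2) The matrices $\{A_{\mathtt{i}}:\mathtt{i}\in\Gamma\}$ strictly preserve a (common) cone. (3) If $(A_1,\ldots,A_M)$ is strongly irreducible, then so is $(A_{\mathtt{i}})_{\mathtt{i}\in\Gamma}$. Moreover, if $T_i(x)=A_ix+v_i$ (with $v_i\in\mathbb{R}^2$) are such that $(T_1,\ldots,T_M)$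 satisfies the strong open set condition, then $\Gamma$ can be chosen so that additionally $(T_{\mathtt{i}})_{\mathtt{i}\in\Gamma}$ satisfies the strong separation condition.
   Context: Words: for $\mathtt{i}=(i_1,\ldots,i_n)$, $A_{\mathtt{i}}:=A_{i_n}\cdots A_{i_1}$ and $T_{\mathtt{i}}:=T_{i_n}\circ\cdots\circ T_{i_1}$ (so the linear part of $T_{\mathtt{i}}$ is $A_{\mathtt{i}}$). $\|\cdot\|$ is the Euclidean norm / operator norm. A matrix in $GL_2(\mathbb{R})$ is hyperbolic if it has two real eigenvalues of different modulus. A tuple is strongly irreducible if its members do not jointly preserve a finite nonempty union of one-dimensional subspaces. A cone is a convex, positively homogeneous subset of $\mathbb{R}^2\setminus\{0\}$, closed in $\mathbb{R}^2\setminus\{0\}$, with nonempty interior; a set of matrices strictly preserves a cone $\mathcal{C}$ if each of its elements maps $\mathcal{C}$ into the interior of $\mathcal{C}$. Singular values: $\alpha_1(B)\ge\alpha_2(B)$. Singular value function: $\varphi^s(B)=\alpha_1(B)^s$ for $0\le s<1$, $\varphi^s(B)=\alpha_1(B)\alpha_2(B)^{s-1}$ for $1\le s<2$, $\varphi^s(B)=|\det B|^{s/2}$ for $s\ge2$. Pressure: $P(\varphi^s,A)=\lim_{n\to\infty}\frac1n\log\sum_{(i_1,\ldots,i_n)\in\{1,\ldots,M\}^n}\varphi^s(A_{i_1}\cdots A_{i_n})$. When all $\|A_i\|<1$, $\dim_{\mathsf{AFF}}(A)$ is the unique $s\ge0$ with $P(\varphi^s,A)=0$. For a finite alphabet $\Lambda$,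 a tuple $B=(B_a)_{a\in\Lambda}$ in $GL_2(\mathbb{R})$ and a shift-invariant Borel probability measure $\rho$ on $\Lambda^{\mathbb{N}}$, let $B(x,n)=B_{x_n}\cdots B_{x_1}$ and $\lambda_i(\rho)=\lim_{n\to\infty}\frac1n\int\log\alpha_i(B(x,n))\,d\rho(x)$ for $i=1,2$; $h(\rho)$ is the metric entropy of the shift. The Lyapunov dimension $\dim_{\mathsf{LY}}(\rho,B)$ is $\frac{h(\rho)}{-\lambda_1(\rho)}$ if $h(\rho)<-\lambda_1(\rho)$; $1+\frac{h(\rho)+\lambda_1(\rho)}{-\lambda_2(\rho)}$ if $-\lambda_1(\rho)\le h(\rho)<-\lambda_1(\rho)-\lambda_2(\rho)$; and $\frac{2h(\rho)}{-\lambda_1(\rho)-\lambda_2(\rho)}$ if $-\lambda_1(\rho)-\lambda_2(\rho)\le h(\rho)$. A Bernoulli measure on $\Lambda^{\mathbb{N}}$ is a product measure $p^{\mathbb{N}}$, $p$ a probability vector on $\Lambda$. A Käenmäki measure of $A$ is a shift-invariant Borel probability measure on $\{1,\ldots,M\}^{\mathbb{N}}$ attaining the supremum of $h(\rho)+\inf_{n\ge1}\frac1n\int\log\varphi^s(A(x,n))\,d\rho(x)$ over shift-invariant Borel probability measures $\rho$, with $s=\dim_{\mathsf{AFF}}(A)$. It always exists, and it is known to be unique when the $A_i$ have no common invariant line. For contractions $T=(T_1,\ldots,T_M)$ of $\mathbb{R}^2$, the attractor $E$ is the unique nonempty compact set with $E=\bigcup_iT_i(E)$. $T$ satisfies the strong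 separation condition if $T_iE\cap T_jE=\emptyset$ for $i\ne j$. $T$ satisfies the strong open set condition if there is a nonempty bounded open set $U$ with $U\cap E\ne\emptyset$, $T_iU\subset U$ for all $i$ and $T_iU\cap T_jU=\emptyset$ for all $i\ne j$. (For $(T_{\mathtt{i}})_{\mathtt{i}\in\Gamma}$ the attractor is that of this system.) *)

(* Defs.v *)
From HB Require Import structures.
From mathcomp Require Import all_boot all_order all_algebra.
From mathcomp Require Import all_classical all_reals all_analysis.
Set Implicit Arguments.
Unset Strict Implicit.
Unset Printing Implicit Defensive.
Import Order.TTheory GRing.Theory Num.Theory.
Import numFieldNormedType.Exports.
Local Open Scope classical_set_scope.
Local Open Scope ring_scope.

(* The norm that the library puts on 'cV[R]_2 is the sup norm; it is used below
   only through its topology and its bounded sets, which are the Euclidean ones. *)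
Definition enorm (R : realType) (x : 'cV[R]_2) : R :=
  Num.sqrt (\sum_i x i 0 ^+ 2).

Definition opnorm (R : realType) (B : 'M[R]_2) : R :=
  sup [set enorm (B *m x) | x in [set x | enorm x <= 1]].

Definition alpha1 (R : realType) (B : 'M[R]_2) : R :=
  Num.sqrt (sup [set l : R | eigenvalue (B^T *m B) l]).

Definition alpha2 (R : realType) (B : 'M[R]_2) : R :=
  Num.sqrt (inf [set l : R | eigenvalue (B^T *m B) l]).

Definition svf (R : realType) (s : R) (B : 'M[R]_2) : R :=
  if s < 1 then alpha1 B `^ s
  else if s < 2 then alpha1 B * alpha2 B `^ (s - 1)
  else `|\det B| `^ (s / 2).

Definition hyperbolic (R : realType) (B : 'M[R]_2) : Prop :=
  exists a b : R, [/\ eigenvalue B a, eigenvalue B b & `|a| != `|b|].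

Definition has_invariant_line (R : realType) (L : finType) (B : L -> 'M[R]_2) :
    Prop :=
  exists V : {vspace 'cV[R]_2}, \dim V = 1%N /\
    forall a x, x \in V -> B a *m x \in V.

Definition line_union (R : realType) (Vs : seq {vspace 'cV[R]_2}) :
    set 'cV[R]_2 :=
  [set x | exists2 V, V \in Vs & x \in V].

Definition strongly_irreducible (R : realType) (L : finType)
    (B : L -> 'M[R]_2) : Prop :=
  ~ exists Vs : seq {vspace 'cV[R]_2},
      [/\ Vs != [::], (forall V, V \in Vs -> \dim V = 1%N) &
          forall a, mulmx (B a) @` line_union Vs `<=` line_union Vs].

Definition cone (R : realType) (C : set 'cV[R]_2) : Prop :=
  [/\ convex_set C,
      (forall (t : R) x, 0 < t -> C x -> C (t *: x)),
      (exists2 F : set 'cV[R]_2, closed F & C = F `\` [set 0]) &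
      interior C !=set0].

Definition strictly_preserves (R : realType) (L : finType) (B : L -> 'M[R]_2)
    (C : set 'cV[R]_2) : Prop :=
  forall a, mulmx (B a) @` C `<=` interior C.

(* wprod B [:: i_1; ...; i_n] = B_{i_n} ... B_{i_1} *)
Definition wprod (R : realType) (L : finType) (B : L -> 'M[R]_2) (w : seq L) :
    'M[R]_2 :=
  \prod_(a <- rev w) B a.

(* wcomp T [:: i_1; ...; i_n] = T_{i_n} o ... o T_{i_1} *)
Definition wcomp (L X : Type) (T : L -> X -> X) (w : seq L) (x : X) : X :=
  foldl (fun y a => T a y) x w.

Definition pressure (R : realType) (L : finType) (s : R) (A : L -> 'M[R]_2) :
    R :=
  limn (fun n : nat =>
    n%:R^-1 * ln (\sum_(w : n.-tuple L) svf s (\prod_(a <- w) A a))).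

Definition dim_AFF (R : realType) (L : finType) (A : L -> 'M[R]_2) : R :=
  xget 0 [set s : R | 0 <= s /\ pressure s A = 0].

(* The sequences over L with the Borel sigma-algebra of the product topology.
   Measurable types are pointed, so nonemptiness of the alphabet has to be
   witnessed by a letter a0; the sigma-algebra does not depend on it. *)
Definition seqspace (L : finType) (a0 : L) : Type := nat -> L.

Section seqspace_instances.
Variables (L : finType) (a0 : L).

HB.instance Definition _ := gen_eqMixin (seqspace a0).
HB.instance Definition _ := gen_choiceMixin (seqspace a0).
HB.instance Definition _ := isPointed.Build (seqspace a0) (fun=> a0).

Definition seqspace_open : set (set (seqspace a0)) :=
  @open {ptws nat -> discrete_topology L}.

HB.instance Definition _ := @isMeasurable.Build (sigma_display seqspace_open)
  (seqspace a0) <<s seqspace_open >>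
  (@sigma_algebra0 _ setT seqspace_open)
  (@sigma_algebraC (seqspace a0) seqspace_open)
  (@sigma_algebra_bigcup _ setT seqspace_open).

End seqspace_instances.

Definition seq_shift (L : finType) (a0 : L) (x : seqspace a0) : seqspace a0 :=
  fun k => x k.+1.

Definition shift_invariant (R : realType) (L : finType) (a0 : L)
    (rho : probability (seqspace a0) R) : Prop :=
  forall E : set (seqspace a0), measurable E ->
    rho (@seq_shift L a0 @^-1` E) = rho E.

(* Entropy of the join of f^{-i}P, 0 <= i < n, where the finite partition P is
   given by its labelling function. *)
Definition join_entropy (R : realType) (d : measure_display)
    (X : measurableType d) (rho : probability X R) (f : X -> X) (k : nat)
    (P : X -> 'I_k) (n : nat) : R :=
  \sum_(w : n.-tuple 'I_k)
    let m := fine (rho [set x | forall i : 'I_n, P (iter i f x) = tnth w i]) in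
    - (m * ln m).

(* Kolmogorov-Sinai entropy. For the shift on seqspace the supremum is finite,
   being at most the logarithm of the size of the alphabet. *)
Definition metric_entropy (R : realType) (d : measure_display)
    (X : measurableType d) (rho : probability X R) (f : X -> X) : R :=
  sup [set h : R | exists (k : nat) (P : X -> 'I_k),
    (forall i, measurable (P @^-1` [set i])) /\
    h = limn (fun n : nat => n%:R^-1 * join_entropy rho f P n)].

Definition entropy (R : realType) (L : finType) (a0 : L)
    (rho : probability (seqspace a0) R) : R :=
  metric_entropy rho (@seq_shift L a0).

Definition cocycle (R : realType) (L : finType) (a0 : L) (B : L -> 'M[R]_2)
    (x : seqspace a0) (n : nat) : 'M[R]_2 :=
  wprod B (mkseq x n).

Definition lambda1 (R : realType) (L : finType) (a0 : L)
    (rho : probability (seqspace a0) R) (B : L -> 'M[R]_2) : R :=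
  limn (fun n : nat => n%:R^-1 * \int[rho]_x ln (alpha1 (cocycle B x n))).

Definition lambda2 (R : realType) (L : finType) (a0 : L)
    (rho : probability (seqspace a0) R) (B : L -> 'M[R]_2) : R :=
  limn (fun n : nat => n%:R^-1 * \int[rho]_x ln (alpha2 (cocycle B x n))).

Definition dim_LY (R : realType) (L : finType) (a0 : L)
    (rho : probability (seqspace a0) R) (B : L -> 'M[R]_2) : R :=
  let h := entropy rho in
  let l1 := lambda1 rho B in
  let l2 := lambda2 rho B in
  if h < - l1 then h / - l1
  else if h < - l1 - l2 then 1 + (h + l1) / - l2
  else 2 * h / (- l1 - l2).

(* A product measure is determined by its values on cylinders. *)
Definition bernoulli_measure (R : realType) (L : finType) (a0 : L)
    (rho : probability (seqspace a0) R) : Prop :=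
  exists p : L -> R,
    [/\ forall a, 0 <= p a, \sum_a p a = 1 &
        forall (n : nat) (w : n.-tuple L),
          rho [set x : seqspace a0 | forall i : 'I_n, x i = tnth w i] =
          (\prod_(i < n) p (tnth w i))%:E].

Definition kaenmaki_functional (R : realType) (L : finType) (a0 : L)
    (A : L -> 'M[R]_2) (s : R) (rho : probability (seqspace a0) R) : R :=
  entropy rho +
  inf [set n%:R^-1 * \int[rho]_x ln (svf s (cocycle A x n))
       | n in [set n : nat | (0 < n)%N]].

Definition kaenmaki_measure (R : realType) (L : finType) (a0 : L)
    (A : L -> 'M[R]_2) (mu : probability (seqspace a0) R) : Prop :=
  shift_invariant mu /\
  forall rho : probability (seqspace a0) R, shift_invariant rho ->
    kaenmaki_functional A (dim_AFF A) rho <= kaenmaki_functional A (dim_AFF A) mu.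

Definition affine_map (R : realType) (L : finType) (A : L -> 'M[R]_2)
    (v : L -> 'cV[R]_2) (a : L) (x : 'cV[R]_2) : 'cV[R]_2 :=
  A a *m x + v a.

Definition attractor (R : realType) (L : finType)
    (T : L -> 'cV[R]_2 -> 'cV[R]_2) : set 'cV[R]_2 :=
  xget set0 [set E | [/\ E !=set0, compact E & E = \bigcup_a (T a @` E)]].

Definition strong_separation (R : realType) (L : finType)
    (T : L -> 'cV[R]_2 -> 'cV[R]_2) : Prop :=
  forall a b, a != b ->
    T a @` attractor T `&` T b @` attractor T = set0.

Definition strong_open_set_condition (R : realType) (L : finType)
    (T : L -> 'cV[R]_2 -> 'cV[R]_2) : Prop :=
  exists U : set 'cV[R]_2,
    [/\ U !=set0, bounded_set U & open U] /\
    [/\ U `&` attractor T !=set0,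
        forall a, T a @` U `<=` U &
        forall a b, a != b -> T a @` U `&` T b @` U = set0].

Section subsystems.
Variables (R : realType) (L : finType) (n : nat) (Gamma : {set n.-tuple L}).

Definition sub_matrices (A : L -> 'M[R]_2)
    (w : {w : n.-tuple L | w \in Gamma}) : 'M[R]_2 :=
  wprod A (val w).

Definition sub_maps (T : L -> 'cV[R]_2 -> 'cV[R]_2)
    (w : {w : n.-tuple L | w \in Gamma}) : 'cV[R]_2 -> 'cV[R]_2 :=
  wcomp T (val w).

Definition dominated_approximation (a0 : L) (A : L -> 'M[R]_2)
    (mu : probability (seqspace a0) R) (eps : R)
    (w0 : {w : n.-tuple L | w \in Gamma})
    (nu : probability (seqspace w0) R) : Prop :=
  [/\ dim_AFF A - eps <= dim_LY nu (sub_matrices A),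
      [/\ `|n%:R^-1 * lambda1 nu (sub_matrices A) - lambda1 mu A| <= eps,
          `|n%:R^-1 * lambda2 nu (sub_matrices A) - lambda2 mu A| <= eps &
          `|n%:R^-1 * entropy nu - entropy mu| <= eps],
      (exists2 C, cone C & strictly_preserves (sub_matrices A) C) &
      (strongly_irreducible A -> strongly_irreducible (sub_matrices A))].

End subsystems.

(* Main.v *)
Require Import Defs.
From HB Require Import structures.
From mathcomp Require Import all_boot all_order all_algebra.
From mathcomp Require Import all_classical all_reals all_analysis.
From mathcomp Require Import ring lra zify.
Import Order.TTheory GRing.Theory Num.Theory.
Import numFieldNormedType.Exports.
Set Implicit Arguments.
Unset Strict Implicit.
Unset Printing Implicit Defensive.
Local Open Scope classical_set_scope.
Local Open Scope ring_scope.

(** The subsystem is made from blocks. Let [z] be a word with a hyperbolic product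
    and use coordinates in which [A_z] is diagonal, with the dominant eigenvalue
    first. Since the matrices have no common invariant line, a compactness
    argument ([transversality]) gives finitely many connecting words such that, for
    every word [w], suitable connecting words around [w] make the top left entry of
    the product comparable to its norm; a fixed power of [z] added at the end then
    sends a fixed cone around the first axis into its interior, up to a sign
    ([block_good]). Coupling pairs of blocks of equal sign removes the sign. The
    number of inserted letters is bounded, so this changes entropies and logarithms
    of norms of words by bounded amounts only; and norms of concatenated blocks
    multiply up to a bounded factor, since every block stretches the cone. Thus any
    distribution on the words of length [N] becomes one on block words
    ([block_lemma]), and the exponents of the Bernoulli measure with these weights
    are, up to a bounded error, sums over single blocks.

    This construction is used twice. Applied to the weights that the Kaenmaki
    measure [mu] gives to words of length [N], it yields [nu]: when [N] grows, the
    entropy and the exponents per letter converge to those of [mu]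
    ([dominated_approximation_exists]). Applied to the Gibbs weights of the
    singular value function at the affinity dimension, it yields invariant measures
    on the original shift (concatenate independent blocks and average over the
    starting position) at which the variational functional is at least the
    pressure, which is zero, up to an error that vanishes as [N] grows. By
    maximality the functional is nonnegative at [mu]
    ([kaenmaki_functional_ge0]), and the lower bound for the Lyapunov dimension of
    [nu] follows from the closeness of entropy and exponents, the Lyapunov dimension
    being the inverse of a piecewise linear function of the entropy with slopes
    bounded below ([lyapunov_dimension_ge]).

    Two facts reduce all estimates to words of finite length. The
    Kolmogorov-Sinai theorem ([entropyP]) expresses the entropy by the laws of
    words, and in dimension two the singular value function is a product of powers
    of the norm and the determinant, so that exponents are limits of means of a
    subadditive and an additive function of words.

    For strong irreducibility take all block words of the given length, whatever
    their weight. Powers of [z] are among them, so a finite union of lines that they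
    preserve consists of eigenlines of [A_z]; if the tuple is strongly irreducible,
    other block words move these eigenlines away ([pivot_no_lines]).

    For the separation condition let [z] start with a word that maps an absorbing
    disc into the open set [U] of the strong open set condition
    ([separating_word]), and continue it to a hyperbolic word
    ([hyperbolic_extension]). All words of the subsystem start with [z], and what
    remains of them has equal length, so that the images of [U] are disjoint. *)

(** * Entropy of finite distributions *)

Section FiniteEntropy.
Variable R : realType.
Implicit Types T U V : finType.

Definition ent T (m : T -> R) : R := \sum_x - (m x * ln (m x)).

Definition is_distr T (m : T -> R) : Prop :=
  (forall x, 0 <= m x) /\ \sum_x m x = 1.

Definition push T U (f : T -> U) (m : T -> R) (y : U) : R :=
  \sum_(x | f x == y) m x.

Lemma ln_le_sub1 (x : R) : 0 < x -> ln x <= x - 1.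
Proof.
move=> x0; have := @le_ln1Dx R (x - 1); rewrite subrKC => -> //.
by rewrite ltrBrDr addNr.
Qed.

(** Gibbs' inequality: among all sub-probability weights [q], the cross entropy
    of [m] relative to [q] is least for [q = m]. *)
Lemma gibbs T (m q : T -> R) : is_distr m ->
  (forall x, 0 <= q x) -> \sum_x q x <= 1 -> (forall x, 0 < m x -> 0 < q x) ->
  ent m <= \sum_x - (m x * ln (q x)).
Proof.
move=> [m0 m1] q0 q1 mq.
rewrite -subr_ge0 -sumrB.
have : 0 <= \sum_x (m x - q x) by rewrite sumrB m1 subr_ge0.
move/le_trans; apply; apply: ler_sum => x _.
have := m0 x; rewrite le_eqVlt => /predU1P[<-|mx].
  by rewrite !mul0r oppr0 subr0 sub0r oppr_le0.
have qx := mq _ mx.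
have : 0 < q x / m x by rewrite divr_gt0.
move/ln_le_sub1/(ler_wpM2l (m0 x)).
rewrite ln_div ?posrE// !mulrBr mulr1 mulrCA divff ?gt_eqF// mulr1.
lra.
Qed.

Lemma push_sum T U (f : T -> U) (m : T -> R) (g : U -> R) :
  \sum_y push f m y * g y = \sum_x m x * g (f x).
Proof.
rewrite (partition_big f predT)//=; apply: eq_bigr => y _.
by rewrite mulr_suml; apply: eq_bigr => x /eqP ->.
Qed.

Lemma push_distr T U (f : T -> U) (m : T -> R) :
  is_distr m -> is_distr (push f m).
Proof.
move=> [m0 m1]; split; first by move=> y; apply: sumr_ge0.
transitivity (\sum_y push f m y * 1); first by apply: eq_bigr => y _; rewrite mulr1.
by rewrite (push_sum f m (fun=> 1)) -[RHS]m1; apply: eq_bigr => x _; rewrite mulr1.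
Qed.

Lemma push_ge T U (f : T -> U) (m : T -> R) x :
  (forall x, 0 <= m x) -> m x <= push f m (f x).
Proof. by move=> m0; rewrite /push (bigD1 x)//= lerDl sumr_ge0. Qed.

Lemma push_gt0 T U (f : T -> U) (m : T -> R) x :
  (forall x, 0 <= m x) -> 0 < m x -> 0 < push f m (f x).
Proof. by move=> m0 /lt_le_trans; apply; exact: push_ge. Qed.

Lemma push_supp T U (f : T -> U) (m : T -> R) y :
  0 < push f m y -> exists2 x, f x = y & (0 < m x).
Proof.
case: (pselect (exists2 x, f x = y & (0 < m x))) => // H.
rewrite ltNge; case/negP; apply: sumr_le0 => x /eqP fx.
by rewrite leNgt; apply/negP => mx; apply: H; exists x.
Qed.

Lemma ent_push T U (f : T -> U) (m : T -> R) :
  ent (push f m) = \sum_x - (m x * ln (push f m (f x))).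
Proof.
rewrite /ent !sumrN; congr (- _).
exact: (push_sum f m (fun y => ln (push f m y))).
Qed.

Lemma ent_push_le T U (f : T -> U) (m : T -> R) :
  is_distr m -> ent (push f m) <= ent m.
Proof.
move=> [m0 m1]; rewrite ent_push; apply: ler_sum => x _.
have := m0 x; rewrite le_eqVlt => /predU1P[<-|mx]; first by rewrite !mul0r.
by rewrite lerN2 ler_pM2l// ler_ln ?posrE ?push_gt0//; apply: push_ge.
Qed.

(** A map that is at most [k]-to-one forgets at most [ln k] of entropy: apply
    Gibbs' inequality to the weights that share each image mass equally over
    [k] slots. *)
Lemma ent_le_push T U (f : T -> U) (m : T -> R) (k : nat) : is_distr m ->
  (forall y, (#|[pred x | f x == y]| <= k)%N) ->
  ent m <= ent (push f m) + ln k%:R.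
Proof.
move=> [m0 m1] fk.
have [x0 _] : exists x0 : T, True.
  case: (pickP (@predT T)) => [x _|T0]; first by exists x.
  by move: m1; rewrite big_pred0// => /eqP; rewrite eq_sym oner_eq0.
have k0 : (0 < k)%N.
  by apply: leq_trans (fk (f x0)); apply/card_gt0P; exists x0; rewrite inE.
have kR : 0 < k%:R :> R by rewrite ltr0n.
have pD := push_distr f (conj m0 m1).
apply: le_trans (@gibbs T m (fun x => push f m (f x) / k%:R) _ _ _ _) _ => //.
- by move=> x; rewrite divr_ge0// ?(ltW kR)//; case: pD.
- rewrite -mulr_suml ler_pdivrMr// mul1r.
  rewrite (partition_big f predT)//=.
  apply: (@le_trans _ _ (\sum_y push f m y * k%:R)); last first.
    by rewrite -mulr_suml; case: pD => _ ->; rewrite mul1r.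
  apply: ler_sum => y _.
  under eq_bigr => x /eqP -> do [].
  rewrite sumr_const -[leLHS]mulr_natr ler_wpM2l//; first by case: pD.
  by rewrite ler_nat fk.
- by move=> x mx; rewrite divr_gt0// push_gt0.
have -> : ln k%:R = \sum_x m x * ln k%:R by rewrite -mulr_suml m1 mul1r.
rewrite ent_push -big_split/=.
apply: ler_sum => x _.
have := m0 x; rewrite le_eqVlt => /predU1P[<-|mx]; first by rewrite !mul0r oppr0 addr0.
by rewrite ln_div ?posrE ?push_gt0// mulrBr opprB addrC.
Qed.

Lemma ent_ge0 T (m : T -> R) : is_distr m -> 0 <= ent m.
Proof.
move=> [m0 m1]; apply: sumr_ge0 => x _; rewrite -mulrN mulr_ge0// oppr_ge0.
apply: ln_le0; rewrite -m1 (bigD1 x)//= lerDl sumr_ge0//.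
Qed.

Lemma eq_ent T (m m' : T -> R) : m =1 m' -> ent m = ent m'.
Proof. by move=> e; apply: eq_bigr => x _; rewrite e. Qed.

(** Gibbs' inequality against the product of the two marginals. *)
Lemma ent_pair_le T U V (f : T -> U) (g : T -> V) (m : T -> R) :
  is_distr m -> injective (fun x => (f x, g x)) ->
  ent m <= ent (push f m) + ent (push g m).
Proof.
move=> mD fgI; have [m0 m1] := mD.
have [p0 p1] := push_distr f mD; have [q0 q1] := push_distr g mD.
apply: le_trans (@gibbs T m (fun x => push f m (f x) * push g m (g x)) _ _ _ _) _.
- by [].
- by move=> x; rewrite mulr_ge0.
- have <- : \sum_y push f m y.1 * push g m y.2 = 1.
    rewrite -(pair_big predT predT (fun y z => push f m y * push g m z))/=.
    under eq_bigr do rewrite -mulr_sumr q1 mulr1.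
    exact: p1.
  rewrite (partition_big (fun x => (f x, g x)) predT)//=; apply: ler_sum => y _.
  case: (pickP [pred x | (f x, g x) == y]) => [x /eqP xy|e]; last first.
    by rewrite big_pred0// mulr_ge0.
  rewrite (bigD1 x)/=; last by rewrite xy.
  rewrite big1 ?addr0; first by rewrite -xy.
  by move=> z /andP[/eqP zy]; rewrite (fgI z x) ?eqxx// zy xy.
- by move=> x mx; rewrite mulr_gt0// push_gt0.
rewrite !ent_push -big_split/=; apply: ler_sum => x _.
have := m0 x; rewrite le_eqVlt => /predU1P[<-|mx].
  by rewrite !mul0r oppr0 addr0.
by rewrite lnM ?posrE ?push_gt0// mulrDr opprD.
Qed.

Lemma push_inj T U (f : T -> U) (m : T -> R) x :
  injective f -> push f m (f x) = m x.
Proof.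
move=> fI; rewrite /push (bigD1 x)//= big1 ?addr0// => y /andP[/eqP/fI ->].
by rewrite eqxx.
Qed.

Lemma ent_push_bij T U (f : T -> U) (m : T -> R) :
  injective f -> ent (push f m) = ent m.
Proof. by move=> fI; rewrite ent_push; apply: eq_bigr => x _; rewrite push_inj. Qed.

End FiniteEntropy.

(** * Subadditive sequences *)

Section Fekete.
Variable R : realType.

Lemma fekete (a : nat -> R) (K : R) :
  (forall m n, a (m + n)%N <= a m + a n) -> (forall n, - (K * n%:R) <= a n) ->
  exists l : R, ((fun n => n%:R^-1 * a n) @ \oo --> l) /\
    (forall n, (0 < n)%N -> l <= n%:R^-1 * a n).
Proof.
move=> sub lb.
pose S := [set n%:R^-1 * a n | n in [set n : nat | (0 < n)%N]].
have Sinf : has_inf S.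
  split; first by exists (1%:R^-1 * a 1%N); exists 1%N.
  exists (- K) => _ [n /= n0 <-].
  by rewrite ler_pdivlMl ?ltr0n// mulrC mulNr lb.
have lS n : (0 < n)%N -> inf S <= n%:R^-1 * a n.
  by move=> n0; apply: ge_inf; [case: Sinf|exists n].
exists (inf S); split => //.
apply/cvgrPdist_le => e e0.
have e2 : 0 < e / 2 by rewrite divr_gt0.
have [_ [m /= m0 <-] me] := inf_adherent e2 Sinf.
set y := m%:R^-1 * a m in me.
have mR : 0 < m%:R :> R by rewrite ltr0n.
have amul q : a (q * m)%N <= a 0%N + q%:R * a m.
  elim: q => [|q IH]; first by rewrite mul0n mul0r addr0.
  rewrite mulSn; apply: le_trans (sub _ _) _.
  by rewrite -natr1 mulrDl mul1r addrC addrA lerD2r.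
pose B := \sum_(i < m) `|a i|.
pose C := `|a 0%N| + B + m%:R * `|y|.
have C0 : 0 <= C by rewrite !addr_ge0 ?mulr_ge0 ?ler0n// sumr_ge0.
have aC n : a n <= n%:R * y + C.
  rewrite {1}(divn_eq n m); apply: le_trans (sub _ _) _.
  have := amul (n %/ m)%N.
  have : a (n %% m)%N <= B.
    apply: le_trans (ler_norm _) _.
    by rewrite /B (bigD1 (Ordinal (ltn_pmod n m0)))//= lerDl sumr_ge0.
  have -> : (n %/ m)%:R * a m = n%:R * y - (n %% m)%:R * y.
    rewrite -mulrBl {2}(divn_eq n m) natrD addrK natrM -mulrA /y.
    by rewrite mulVKf ?gt_eqF.
  have : - ((n %% m)%:R * y) <= m%:R * `|y|.
    rewrite -mulrN; apply: (@le_trans _ _ ((n %% m)%:R * `|y|)).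
      by rewrite ler_wpM2l ?ler0n// -normrN ler_norm.
    by rewrite ler_wpM2r// ler_nat ltnW// ltn_pmod.
  have := ler_norm (a 0%N).
  rewrite /C; lra.
near=> n.
have n0 : (0 < n)%N by near: n; exact: nbhs_infty_gt.
have nR : 0 < n%:R :> R by rewrite ltr0n.
rewrite distrC ger0_norm ?subr_ge0 ?lS//.
rewrite lerBlDr mulrC ler_pdivrMr//.
apply: le_trans (aC n) _.
have Cn : C <= e / 2 * n%:R.
  rewrite mulrC -ler_pdivrMr//; near: n; exact: nbhs_infty_ger.
have : n%:R * y <= n%:R * (inf S + e / 2) by rewrite ler_wpM2l ?ler0n// ltW.
lra.
Unshelve. all: by end_near. Qed.

End Fekete.

Section Limits.
Variable R : realType.

Lemma cvg_div_nat (C : R) : (fun n => n%:R^-1 * C) @ \oo --> 0.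
Proof.
apply/cvgrPdist_le => e e0; near=> n.
have n0 : 0 < n%:R :> R by rewrite ltr0n; near: n; exact: nbhs_infty_gt.
rewrite sub0r normrN normrM gtr0_norm ?invr_gt0//.
rewrite ler_pdivrMl// -ler_pdivrMr//; near: n; exact: nbhs_infty_ger.
Unshelve. all: by end_near. Qed.

Lemma cvg_le_div (u v : nat -> R) (a b C : R) :
  u @ \oo --> a -> v @ \oo --> b ->
  (forall n, (0 < n)%N -> u n <= v n + n%:R^-1 * C) -> a <= b.
Proof.
move=> ua vb uv.
have vC : (fun n => v n + n%:R^-1 * C) @ \oo --> b.
  by rewrite -[b]addr0; apply: cvgD => //; exact: cvg_div_nat.
apply: (ler_cvg_to ua vC); near=> n; apply: uv.
by near: n; exact: nbhs_infty_gt.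
Unshelve. all: by end_near. Qed.

End Limits.

(** * Laws of finitely valued functions *)

Section Laws.
Variables (R : realType) (d : measure_display) (X : measurableType d).
Variable rho : probability X R.
Implicit Types T U : finType.

Definition mfin T (Y : X -> T) : Prop := forall t, measurable (Y @^-1` [set t]).

Definition law T (Y : X -> T) (t : T) : R := fine (rho (Y @^-1` [set t])).

Lemma prob_fin (E : set X) : measurable E -> rho E \is a fin_num.
Proof.
move=> mE; rewrite ge0_fin_numE//; apply: le_lt_trans (ltry 1).
exact: probability_le1.
Qed.

Lemma mfin_set T (Y : X -> T) (S : set T) : mfin Y -> measurable (Y @^-1` S).
Proof.
move=> mY; have -> : Y @^-1` S = \bigcup_(w in S) (Y @^-1` [set w]).
  by apply/seteqP; split=> [x Sx|x [w Sw /= ->]//]; exists (Y x).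
by apply: fin_bigcup_measurable => [|w _]; [exact: finite_finset | exact: mY].
Qed.

Lemma mfin_comp T U (Y : X -> T) (g : T -> U) : mfin Y -> mfin (g \o Y).
Proof. by move=> mY t; exact: (mfin_set (g @^-1` [set t]) mY). Qed.

Lemma mfin_pair T U (Y : X -> T) (Z : X -> U) :
  mfin Y -> mfin Z -> mfin (fun x => (Y x, Z x)).
Proof.
move=> mY mZ [t u].
have -> : (fun x => (Y x, Z x)) @^-1` [set (t, u)] =
    (Y @^-1` [set t]) `&` (Z @^-1` [set u]).
  by apply/seteqP; split=> [x [<- <-]//|x [/= <- <-]].
exact: measurableI.
Qed.

Lemma mfin_tuple T n (Y : 'I_n -> X -> T) : (forall i, mfin (Y i)) ->
  mfin (fun x => [tuple Y i x | i < n]).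
Proof.
move=> mY w.
have -> : (fun x => [tuple Y i x | i < n]) @^-1` [set w] =
    \bigcap_(i in [set: 'I_n]) (Y i @^-1` [set tnth w i]).
  apply/seteqP; split=> [x /= <- i _ /=|x H /=]; first by rewrite tnth_mktuple.
  by apply: eq_from_tnth => i; rewrite tnth_mktuple; exact: H.
by apply: fin_bigcap_measurable => // i _; exact: mY.
Qed.

Lemma lawE T (Y : X -> T) t : mfin Y -> rho (Y @^-1` [set t]) = (law Y t)%:E.
Proof. by move=> mY; rewrite /law fineK// prob_fin. Qed.

Lemma prob_law T (Y : X -> T) (S : pred T) : mfin Y ->
  rho (Y @^-1` [set` S]) = (\sum_(t | S t) law Y t)%:E.
Proof.
move=> mY.
have -> : Y @^-1` [set` S] = \bigcup_(w in [set` enum S]) (Y @^-1` [set w]).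
  apply/seteqP; split=> [x Sx|x [w /=]].
    by exists (Y x) => //=; rewrite mem_enum.
  by rewrite mem_enum => Sw xw; rewrite xw.
rewrite measure_fin_bigcup//=; last by move=> v w _ _ [x [/= -> ->]].
rewrite -fsbig_seq ?enum_uniq// big_enum_cond/= -sumEFin.
by apply: eq_big => [w|w _]; rewrite ?andbT ?inE// lawE.
Qed.

Lemma law_distr T (Y : X -> T) : mfin Y -> is_distr (law Y).
Proof.
move=> mY; split; first by move=> w; apply: fine_ge0.
apply: EFin_inj; rewrite -prob_law//.
have -> : Y @^-1` [set` predT] = setT by apply/seteqP; split.
exact: probability_setT.
Qed.

Lemma law_comp T U (Y : X -> T) (g : T -> U) : mfin Y ->
  law (g \o Y) =1 push g (law Y).
Proof.
move=> mY u; apply: EFin_inj; rewrite -prob_law// /law fineK; last first.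
  exact: prob_fin (mfin_comp g mY u).
by congr (rho _); apply/seteqP; split=> x /eqP.
Qed.

Lemma integral_law T (Y : X -> T) (f : T -> R) : mfin Y ->
  \int[rho]_x f (Y x) = \sum_t law Y t * f t.
Proof.
move=> mY; have fE x : (f (Y x))%:E =
    (\sum_w (f w)%:E * (\1_(Y @^-1` [set w]) x)%:E)%E.
  rewrite (bigD1 (Y x))//= big1 ?adde0.
    by rewrite indicE mem_set// mule1.
  move=> w wx; rewrite indicE memNset ?mule0//= => e.
  by rewrite e eqxx in wx.
rewrite /Rintegral; under eq_integral do rewrite fE.
have iI w : rho.-integrable setT (fun x => (\1_(Y @^-1` [set w]) x)%:E).
  by apply: integrable_indic.
rewrite integral_sum//; last by move=> w; exact: integrableZl.
have -> : (\sum_w \int[rho]_x ((f w)%:E * (\1_(Y @^-1` [set w]) x)%:E))%E =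
    (\sum_w (law Y w * f w)%:E)%E.
  apply: eq_bigr => w _; rewrite integralZl// integral_indic// setIT.
  by rewrite EFinM muleC; congr (_ * _)%E; exact: lawE.
by rewrite sumEFin.
Qed.

End Laws.

(** * Measures on sequence spaces *)

Section Sequences.
Variables (L : finType) (a0 : L).
Local Notation X := (seqspace a0).

Definition pref (n : nat) (x : X) : n.-tuple L := [tuple x i | i < n].

Lemma prefP n (x : X) (w : n.-tuple L) :
  pref n x = w <-> forall i : 'I_n, x i = tnth w i.
Proof.
split=> [<- i|H]; first by rewrite tnth_mktuple.
by apply: eq_from_tnth => i; rewrite tnth_mktuple.
Qed.

Lemma pref_eq n (x y : X) : (forall i, (i < n)%N -> x i = y i) <->
  pref n x = pref n y.
Proof.
split=> [H|H i ni]; first by apply: eq_from_tnth => i; rewrite !tnth_mktuple H.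
by have /prefP/(_ (Ordinal ni)) := H; rewrite tnth_mktuple.
Qed.

Lemma val_pref n (x : X) : val (pref n x) = mkseq x n.
Proof.
by rewrite /mkseq -val_enum_ord -map_comp.
Qed.

Lemma measurable_coord i a : measurable [set x : X | x i = a].
Proof.
apply: sub_sigma_algebra.
have pc := (@continuousP {ptws nat -> discrete_topology L} (discrete_topology L)
  (fun x => x i)).1 (@proj_continuous _ (fun=> discrete_topology L) i).
exact: (pc [set a] (discrete_open _)).
Qed.

Lemma measurable_pref n (S : set (n.-tuple L)) : measurable (pref n @^-1` S).
Proof.
have -> : pref n @^-1` S = \bigcup_(w in S) (pref n @^-1` [set w]).
  by apply/seteqP; split=> [x Sx|x [w Sw /= ->]//]; exists (pref n x).
apply: fin_bigcup_measurable => [|w _]; first exact: finite_finset.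
have -> : pref n @^-1` [set w] =
    \bigcap_(i in [set: 'I_n]) [set x : X | x i = tnth w i].
  by apply/seteqP; split=> [x /prefP H i _|x H]; [exact: H | apply/prefP => i; exact: H].
by apply: fin_bigcap_measurable => // i _; exact: measurable_coord.
Qed.

Lemma open_cylinders (U : set X) : seqspace_open U ->
  U = \bigcup_n (pref n @^-1` [set w | pref n @^-1` [set w] `<=` U]).
Proof.
move=> oU; apply/seteqP; split=> [x Ux|x [n _]]; last exact.
pose F : set_system {ptws nat -> discrete_topology L} :=
  [set B : set X | exists n, pref n @^-1` [set pref n x] `<=` B].
have FF : Filter F.
  split; first by exists 0%N.
    move=> P Q [n nP] [m mQ]; exists (maxn n m) => y /pref_eq yx.
    split; [apply: nP | apply: mQ]; apply/pref_eq => i ni; apply: yx.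
      by rewrite leq_max ni.
    by rewrite leq_max ni orbT.
  by move=> P Q PQ [n nP]; exists n; apply: subset_trans PQ.
have /pointwise_cvgP : forall t : nat,
    (fun g : {ptws nat -> discrete_topology L} => g t) @ F --> (x t : discrete_topology L).
  move=> t B /nbhs_singleton Bx; exists t.+1 => y /= /pref_eq yx.
  by rewrite yx.
have : nbhs (x : {ptws nat -> discrete_topology L}) U by exact: open_nbhs_nbhs.
by move=> nU /(_ _ nU)[n nF]; exists n.
Qed.

Lemma measurable_to_seq d (T : measurableType d) (f : T -> X) :
  (forall i a, measurable [set t | f t i = a]) -> measurable_fun setT f.
Proof.
move=> mf; apply: (@measurability _ _ T X setT f (@seqspace_open L a0)) => //.
move=> _ [U oU <-]; rewrite setTI (open_cylinders oU) preimage_bigcup.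
apply: bigcup_measurable => n _.
set S := [set w : n.-tuple L | pref n @^-1` [set w] `<=` U].
have -> : f @^-1` (pref n @^-1` S) = \bigcup_(w in S) (f @^-1` (pref n @^-1` [set w])).
  by apply/seteqP; split=> [x Sx|x [w Sw /= xw]]; [exists (pref n (f x))|rewrite xw].
apply: fin_bigcup_measurable => [|w _]; first exact: finite_finset.
have -> : f @^-1` (pref n @^-1` [set w]) =
    \bigcap_(i in [set: 'I_n]) [set x | f x i = tnth w i].
  by apply/seteqP; split=> [x /prefP H i _|x H]; [exact: H | apply/prefP => i; exact: H].
by apply: fin_bigcap_measurable => // i _; exact: mf.
Qed.

Lemma measurable_shift : measurable_fun setT (@seq_shift L a0).
Proof. by apply: measurable_to_seq => i a; exact: measurable_coord. Qed.

Lemma mfin_pref n : mfin (pref n).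
Proof. by move=> w; exact: measurable_pref. Qed.

Definition cylset (E : set X) : Prop :=
  exists n, forall x y, pref n x = pref n y -> E x -> E y.

Lemma pref_le m n (x y : X) : (m <= n)%N -> pref n x = pref n y ->
  pref m x = pref m y.
Proof.
by move=> mn /pref_eq xy; apply/pref_eq => i im; apply: xy; exact: leq_trans mn.
Qed.

Lemma cylset_measurable E : cylset E -> measurable E.
Proof.
move=> [n nE]; have -> : E = pref n @^-1` (pref n @` E).
  by apply/seteqP; split=> [x Ex|x [y Ey /nE]]; [exists x|exact].
exact: measurable_pref.
Qed.

Lemma cylset_pref n (S : set (n.-tuple L)) : cylset (pref n @^-1` S).
Proof. by exists n => x y /= ->. Qed.

Lemma cylsetC E : cylset E -> cylset (~` E).
Proof. by move=> [n nE]; exists n => x y xy nEx Ey; apply/nEx/(nE y). Qed.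

Lemma cylsetI : setI_closed cylset.
Proof.
move=> E F [n nE] [m mF]; exists (maxn n m) => x y xy [Ex Fx].
split; first by apply: (nE x) => //; apply: pref_le xy; exact: leq_maxl.
by apply: (mF x) => //; apply: pref_le xy; exact: leq_maxr.
Qed.

Lemma cylsetU E F : cylset E -> cylset F -> cylset (E `|` F).
Proof. by move=> cE cF; rewrite -(setCK (E `|` F)) setCU; do ?[apply: cylsetC|apply: cylsetI]. Qed.

Lemma open_sigma_cylset : @seqspace_open L a0 `<=` <<s cylset >>.
Proof.
move=> U oU; rewrite (open_cylinders oU); apply: sigma_algebra_bigcup => n.
by apply: sub_sigma_algebra; exact: cylset_pref.
Qed.

Lemma measurable_cylset : (@measurable _ X) = <<s cylset >>.
Proof.
apply/seteqP; split.
  apply: smallest_sub; first exact: smallest_sigma_algebra.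
  exact: open_sigma_cylset.
apply: smallest_sub; last by move=> E; exact: cylset_measurable.
exact: sigma_algebra_measurable.
Qed.

Variable R : realType.
Implicit Types rho : probability X R.

Lemma prob_unique rho1 rho2 :
  (forall n w, rho1 (pref n @^-1` [set w]) = rho2 (pref n @^-1` [set w])) ->
  forall E, measurable E -> rho1 E = rho2 E.
Proof.
move=> H; apply: (@measure_unique _ _ X cylset (fun=> setT)).
- exact: measurable_cylset.
- exact: cylsetI.
- by move=> _; exists 0%N.
- by rewrite bigcup_const.
- move=> E [n nE]; have -> : E = pref n @^-1` [set` [pred w | `[< exists2 x, E x & pref n x = w >]]].
    apply/seteqP; split=> [x Ex|x /asboolP[y Ey /nE]]; last exact.
    by apply/asboolP; exists x.
  set S := [pred w | _].
  transitivity (\sum_(w | S w) law rho1 (pref n) w)%:E.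
    by apply: prob_law; exact: mfin_pref.
  transitivity (\sum_(w | S w) law rho2 (pref n) w)%:E.
    by congr (_%:E); apply: eq_bigr => w _; rewrite /law H.
  by apply/esym/prob_law; exact: mfin_pref.
- by move=> _; apply: (@le_lt_trans _ _ 1%E); [exact: probability_le1|exact: ltry].
Qed.

End Sequences.

(** * Approximation by cylinders and the Kolmogorov-Sinai theorem *)

Section Approximation.
Variables (L : finType) (a0 : L) (R : realType).
Local Notation X := (seqspace a0).
Variable rho : probability X R.

Definition symdiff (E F : set X) : set X := (E `\` F) `|` (F `\` E).

Definition approximable (E : set X) : Prop := measurable E /\
  forall e : R, 0 < e -> exists2 C, cylset C & (rho (symdiff E C) < e%:E)%E.

Lemma measurable_symdiff E F : measurable E -> measurable F ->
  measurable (symdiff E F).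
Proof. by move=> mE mF; apply: measurableU; exact: measurableD. Qed.

Lemma prob_setU_lt (E F : set X) (a b : R) : measurable E -> measurable F ->
  (rho E < a%:E)%E -> (rho F < b%:E)%E -> (rho (E `|` F) < (a + b)%:E)%E.
Proof.
move=> mE mF Ea Fb; apply: (@le_lt_trans _ _ (rho E + rho F)%E); first exact: measureU2.
by rewrite EFinD lteD.
Qed.

Lemma prob_sub_lt (E F : set X) (x : \bar R) : measurable E -> measurable F ->
  E `<=` F -> (rho F < x)%E -> (rho E < x)%E.
Proof. by move=> mE mF EF; apply: le_lt_trans; apply: le_measure; rewrite ?inE. Qed.

Lemma union_bound (I : Type) (s : seq I) (F : I -> set X) :
  (forall i, measurable (F i)) ->
  (rho (\big[setU/set0]_(i <- s) F i) <= \sum_(i <- s) rho (F i))%E.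
Proof.
move=> mF; elim: s => [|i s IH]; first by rewrite !big_nil measure0.
rewrite !big_cons.
apply: (@le_trans _ _ (rho (F i) + rho (\big[setU/set0]_(j <- s) F j))%E).
  by apply: measureU2 => //; exact: bigsetU_measurable.
by apply: leeD.
Qed.

Lemma approximableU E F : approximable E -> approximable F ->
  approximable (E `|` F).
Proof.
move=> [mE aE] [mF aF]; split=> [|e e0]; first exact: measurableU.
have e2 : 0 < e / 2 by rewrite divr_gt0.
have [C cC EC] := aE _ e2; have [C' cC' FC'] := aF _ e2.
have mC := cylset_measurable cC; have mC' := cylset_measurable cC'.
exists (C `|` C'); first exact: cylsetU.
apply: (@prob_sub_lt _ (symdiff E C `|` symdiff F C')).
- by apply: measurable_symdiff; exact: measurableU.
- by apply: measurableU; exact: measurable_symdiff.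
- move=> x; rewrite /symdiff/= => -[[[Ex|Fx] /not_orP[nC nC']]|[[Cx|C'x] /not_orP[nE nF]]].
  + by left; left.
  + by right; left.
  + by left; right.
  + by right; right.
rewrite [e]splitr; apply: prob_setU_lt => //; exact: measurable_symdiff.
Qed.

Lemma cylset_approximable E : cylset E -> approximable E.
Proof.
move=> cE; split=> [|e e0]; first exact: cylset_measurable.
exists E => //; have -> : symdiff E E = set0 by rewrite /symdiff setDv setU0.
by rewrite measure0.
Qed.

Lemma approximable_bigcup (F : nat -> set X) : (forall i, approximable (F i)) ->
  approximable (\bigcup_i F i).
Proof.
move=> aF.
have mF i : measurable (F i) by case: (aF i).
have mU : measurable (\bigcup_i F i) by exact: bigcup_measurable.
split=> // e e0.
have e2 : 0 < e / 2 by rewrite divr_gt0.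
pose S n := \big[setU/set0]_(i < n) F i.
have aS n : approximable (S n).
  elim: n => [|n IH]; rewrite /S.
    rewrite big_ord0; apply: cylset_approximable; exists 0%N => x y _ [].
  by rewrite big_ord_recr/=; exact: approximableU.
have mS n : measurable (S n) by case: (aS n).
pose G n := \bigcup_i F i `\` S n.
have mG n : measurable (G n) by exact: measurableD.
have G0 : \bigcap_n G n = set0.
  apply/seteqP; split=> // x Gx.
  have [[i _ Fx] _] := Gx 0%N I.
  have [_ ] := Gx i.+1 I; apply.
  by rewrite /S big_ord_recr/=; right.
have : (rho \o G) n @[n --> \oo] --> rho (\bigcap_n G n).
  apply: nonincreasing_cvg_mu => //.
  - by apply: le_lt_trans (ltry 1); exact: probability_le1.
  - exact: bigcap_measurable.
  - apply/nonincreasing_seqP => n; apply/subsetPset => x [Fx nS]; split=> // Sx.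
    by apply: nS; rewrite /S big_ord_recr/=; left.
rewrite G0 measure0 => /fine_cvgP[_ /cvgrPdist_lt/(_ _ e2) [n _ /(_ n (leqnn n))]].
rewrite sub0r normrN /= ger0_norm ?fine_ge0// => Gn.
have {}Gn : (rho (G n) < (e / 2)%:E)%E.
  by rewrite -[rho (G n)]fineK ?lte_fin//; exact: prob_fin.
have [_ /(_ _ e2)[C cC SC]] := aS n.
have mC := cylset_measurable cC.
exists C => //.
apply: (@prob_sub_lt _ (G n `|` symdiff (S n) C)).
- exact: measurable_symdiff.
- by apply: measurableU => //; exact: measurable_symdiff.
- move=> x [[Fx nC]|[Cx nF]].
    by have [Sx|nS] := pselect (S n x); [right; left|left].
  right; right; split=> // Sx; apply: nF.
  by move: Sx; rewrite /S -bigcup_mkord => -[i _ Fx]; exists i.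
by rewrite [e]splitr; apply: prob_setU_lt => //; exact: measurable_symdiff.
Qed.

Lemma measurable_approximable E : measurable E -> approximable E.
Proof.
rewrite measurable_cylset; move: E; apply: smallest_sub; last first.
  by move=> E; exact: cylset_approximable.
split.
- by apply: cylset_approximable; exists 0%N.
- move=> E [mE aE]; rewrite setTD; split=> [|e e0]; first exact: measurableC.
  have [C cC EC] := aE _ e0; exists (~` C); first exact: cylsetC.
  suff -> : symdiff (~` E) (~` C) = symdiff E C by [].
  apply/seteqP; split=> x [] [].
  - by move=> nE /contrapT Cx; right.
  - by move=> nC /contrapT Cx; left.
  - by move=> Ex nC; right; split=> // nE; exact: nE.
  - by move=> Cx nE; left; split=> // nC; exact: nC.
- exact: approximable_bigcup.
Qed.

(** Approximate every cell by a set that depends on finitely many coordinates: a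
    point outside the error sets lies in exactly one approximant, which names
    its cell. *)
Lemma partition_approx (k : nat) (P : X -> 'I_k) (e : R) : mfin P -> 0 < e ->
  exists n (g : n.-tuple L -> 'I_k),
    fine (rho [set x | P x != g (pref n x)]) <= e.
Proof.
move=> mP e0.
have k0 : (0 < k)%N by apply: leq_ltn_trans (ltn_ord (P point)).
have ek : 0 < e / k%:R by rewrite divr_gt0// ltr0n.
have /choice[C CP] : forall i : 'I_k, exists C, cylset C /\
    (rho (symdiff (P @^-1` [set i]) C) < (e / k%:R)%:E)%E.
  by move=> i; have [_ /(_ _ ek)[C ? ?]] := measurable_approximable (mP i); exists C.
have /choice[N NP] : forall i : 'I_k, exists n,
    forall x y, pref n x = pref n y -> C i x -> C i y.
  by move=> i; have [[n nP] _] := CP i; exists n.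
pose n := \max_(i < k) N i.
have NC i x y : pref n x = pref n y -> C i x -> C i y.
  by move=> xy; apply: NP; apply: pref_le xy; exact: leq_bigmax.
pose h (x : X) : 'I_k := odflt (P point) [pick i | `[< C i x >]].
have hE x y : pref n x = pref n y -> h x = h y.
  move=> xy; rewrite /h; congr (odflt _ _); apply: eq_pick => i.
  by apply/asboolP/asboolP; apply: NC.
pose ext (w : n.-tuple L) : X := fun i => nth a0 w i.
have prefK (x : X) : pref n (ext (pref n x)) = pref n x.
  by apply/pref_eq => i ni; rewrite /ext val_pref nth_mkseq.
exists n, (fun w => h (ext w)).
have mD i : measurable (symdiff (P @^-1` [set i]) (C i)).
  by apply: measurable_symdiff => //; apply: cylset_measurable; case: (CP i).
have mH : mfin h.
  move=> i; apply: cylset_measurable; exists n => x y /hE.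
  by rewrite /= => ->.
have Dsub : [set x | P x != h (ext (pref n x))] `<=`
    \big[setU/set0]_(i <- enum 'I_k) symdiff (P @^-1` [set i]) (C i).
  rewrite -bigcup_seq => x /=; rewrite (hE _ _ (prefK x)) => /eqP Phx.
  apply: contrapT => nD.
  have CPx i : C i x <-> P x = i.
    split=> [Ci|Pi]; apply: contrapT => H; apply: nD; exists i; rewrite /= ?mem_enum//; [right|left];
      by split.
  apply: Phx; rewrite /h; case: pickP => [i /asboolP/CPx//|/(_ (P x))/asboolP].
  by case; apply/CPx.
have mB : measurable (\big[setU/set0]_(i <- enum 'I_k) symdiff (P @^-1` [set i]) (C i)).
  exact: bigsetU_measurable.
have mE : measurable [set x | P x != h (ext (pref n x))].
  have -> : [set x | P x != h (ext (pref n x))] =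
      (fun x => (P x, h x)) @^-1` [set` [pred p | p.1 != p.2]].
    by apply/seteqP; split=> x /=; rewrite (hE _ _ (prefK x)).
  by apply: mfin_set; exact: mfin_pair.
rewrite -lee_fin fineK; last exact: prob_fin.
apply: (@le_trans _ _ (rho (\big[setU/set0]_(i <- enum 'I_k) symdiff (P @^-1` [set i]) (C i)))).
  by apply: le_measure; rewrite ?inE.
apply: le_trans (union_bound _ mD) _; rewrite big_enum/=.
apply: (@le_trans _ _ (\sum_(i < k) (e / k%:R)%:E)%E).
  by apply: lee_sum => i _; apply: ltW; case: (CP i).
by rewrite sumEFin sumr_const card_ord lee_fin -[leLHS]mulr_natr divfK// gt_eqF// ltr0n.
Qed.

End Approximation.

Section ProductSums.
Variable R : realType.

Lemma sum_tuple_prod (T : finType) n (F : 'I_n -> T -> R) :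
  \sum_(u : n.-tuple T) \prod_(i < n) F i (tnth u i) =
  \prod_(i < n) \sum_a F i a.
Proof.
rewrite bigA_distr_bigA/=.
pose h (f : {ffun 'I_n -> T}) : n.-tuple T := [tuple f i | i < n].
rewrite (reindex h)/=.
  by apply: eq_bigr => f _; apply: eq_bigr => i _; rewrite tnth_mktuple.
exists (fun u => [ffun i => tnth u i]) => u _.
  by apply/ffunP => i; rewrite ffunE tnth_mktuple.
by apply: eq_from_tnth => i; rewrite tnth_mktuple ffunE.
Qed.

Lemma ln_prod_gt0 (I : finType) (F : I -> R) : (forall i, 0 < F i) ->
  ln (\prod_i F i) = \sum_i ln (F i).
Proof.
move=> F0.
suff [_ ->] : 0 < \prod_i F i /\ ln (\prod_i F i) = \sum_i ln (F i) by [].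
apply: (big_ind2 (fun x y => 0 < x /\ ln x = y)) => [|x y z t [x0 <-] [z0 <-]|//].
  by rewrite ln1.
by rewrite mulr_gt0// lnM.
Qed.

End ProductSums.

Section KolmogorovSinai.
Variables (L : finType) (a0 : L) (R : realType).
Local Notation X := (seqspace a0).
Local Notation sh := (@seq_shift L a0).
Variable rho : probability X R.
Hypothesis rho_inv : shift_invariant rho.
Implicit Types T U : finType.

Definition proc T (Y : X -> T) n (x : X) : n.-tuple T :=
  [tuple Y (iter i sh x) | i < n].

Lemma measurable_iter_shift i E : measurable E -> measurable (iter i sh @^-1` E).
Proof.
elim: i E => [//|i IH] E mE.
have := @measurable_shift L a0 measurableT E mE; rewrite setTI => /IH.
by [].
Qed.

Lemma iter_shift_inv i E : measurable E -> rho (iter i sh @^-1` E) = rho E.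
Proof.
elim: i E => [//|i IH] E mE.
have := @measurable_shift L a0 measurableT E mE; rewrite setTI => mE'.
by rewrite -[RHS]rho_inv// -[RHS]IH.
Qed.

Lemma iter_shiftE i (x : X) j : iter i sh x j = x (i + j)%N.
Proof. by elim: i j => [//|i IH] j /=; rewrite /seq_shift IH addnS. Qed.

Lemma mfin_iter T (Y : X -> T) i : mfin Y -> mfin (Y \o iter i sh).
Proof. by move=> mY t; exact: (measurable_iter_shift i (mY t)). Qed.

Lemma law_iter T (Y : X -> T) i : mfin Y -> law rho (Y \o iter i sh) =1 law rho Y.
Proof. by move=> mY t; rewrite /law -(iter_shift_inv i (mY t)). Qed.

Lemma mfin_proc T (Y : X -> T) n : mfin Y -> mfin (proc Y n).
Proof. by move=> mY; apply: mfin_tuple => i; exact: mfin_iter. Qed.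

Lemma ent_proc_sub T (Y : X -> T) m n : mfin Y ->
  ent (law rho (proc Y (m + n))) <=
  ent (law rho (proc Y m)) + ent (law rho (proc Y n)).
Proof.
move=> mY.
pose f (w : (m + n).-tuple T) : m.-tuple T := [tuple tnth w (lshift n i) | i < m].
pose g (w : (m + n).-tuple T) : n.-tuple T := [tuple tnth w (rshift m i) | i < n].
have mP : mfin (proc Y (m + n)) by exact: mfin_proc.
apply: le_trans (@ent_pair_le R _ _ _ f g _ (law_distr rho mP) _) _.
  move=> v w fg; have fvw : f v = f w := congr1 fst fg.
  have gvw : g v = g w := congr1 snd fg; apply: eq_from_tnth => i.
  case: (split_ordP i) => j ->.
    by have := congr1 (fun t => tnth t j) fvw; rewrite !tnth_mktuple.
  by have := congr1 (fun t => tnth t j) gvw; rewrite !tnth_mktuple.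
rewrite -(eq_ent (law_comp rho f mP)) -(eq_ent (law_comp rho g mP)).
have -> : f \o proc Y (m + n) = proc Y m.
  apply/funext => x; apply: eq_from_tnth => i; rewrite !tnth_mktuple/=.
  by [].
have -> : g \o proc Y (m + n) = proc Y n \o iter m sh.
  apply/funext => x; apply: eq_from_tnth => i; rewrite !tnth_mktuple/=.
  by rewrite addnC iterD.
by rewrite (eq_ent (law_iter m (mfin_proc (n := n) mY))).
Qed.

Lemma proc_entropy_cvg T (Y : X -> T) : mfin Y -> exists l : R,
  ((fun n => n%:R^-1 * ent (law rho (proc Y n))) @ \oo --> l) /\
  (forall n, (0 < n)%N -> l <= n%:R^-1 * ent (law rho (proc Y n))).
Proof.
move=> mY; apply: (@fekete R _ 0).
  by move=> m n; exact: ent_proc_sub.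
move=> n; rewrite mul0r oppr0; apply: ent_ge0; apply: law_distr.
exact: mfin_proc.
Qed.

Lemma join_entropyE k (P : X -> 'I_k) n :
  join_entropy rho sh P n = ent (law rho (proc P n)).
Proof.
apply: eq_bigr => w _; rewrite /law.
suff -> : [set x | forall i : 'I_n, P (iter i sh x) = tnth w i] =
  proc P n @^-1` [set w] by [].
apply/seteqP; split=> x /=.
  by move=> H; apply: eq_from_tnth => i; rewrite tnth_mktuple.
by move=> <- i; rewrite tnth_mktuple.
Qed.

Let letter (x : X) : L := x 0%N.

Lemma mfin_letter : mfin letter.
Proof. by move=> a; exact: measurable_coord. Qed.

Lemma proc_letter n : proc letter n = pref n.
Proof.
apply/funext => x; apply: eq_from_tnth => i.
by rewrite !tnth_mktuple /letter iter_shiftE addn0.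
Qed.

(** Conditionally on the letters, each label of an approximately letter-determined
    partition is guessed with error [d]; comparing the joint law with independent
    guesses through Gibbs' inequality bounds the entropy of the partition. *)
Lemma partition_entropy_le k (P : X -> 'I_k) (d : R) : mfin P -> 0 < d <= 2^-1 ->
  exists n0, forall n, ent (law rho (proc P n)) <=
    ent (law rho (pref (n + n0))) + n%:R * (3 * d).
Proof.
move=> mP /andP[d0 d12].
have d1 : d < 1 by lra.
have dln : d - ln (1 - d) <= 3 * d.
  have e0 : 0 < (1 - d)^-1 by rewrite invr_gt0; lra.
  have := ln_le_sub1 e0; rewrite lnV ?posrE; last lra.
  have : (1 - d)^-1 <= 1 + 2 * d.
    by rewrite -[_^-1]mul1r ler_pdivrMr; nra.
  lra.
have k0 : (0 < k)%N by apply: leq_ltn_trans (ltn_ord (P point)).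
have kR : 0 < k%:R :> R by rewrite ltr0n.
pose D := `|ln (d / k%:R)|.
have D0 : 0 <= D by exact: normr_ge0.
have e0 : 0 < d / (1 + D) by rewrite divr_gt0// ltr_wpDr.
have [n0 [g gP]] := partition_approx rho mP e0.
exists n0 => n; set N := (n + n0)%N.
pose Z (x : X) := (proc P n x, pref N x).
have mpref m : mfin (@pref L a0 m) by exact: mfin_pref.
have mZ : mfin Z by apply: mfin_pair => //; exact: mfin_proc.
pose win (i : 'I_n) (w : N.-tuple L) : n0.-tuple L :=
  [tuple nth a0 w (i + j) | j < n0].
have winE (i : 'I_n) (x : X) : pref n0 (iter i sh x) = win i (pref N x).
  apply: eq_from_tnth => j; rewrite !tnth_mktuple iter_shiftE.
  rewrite val_pref nth_mkseq// /N.
  by have := ltn_ord i; have := ltn_ord j; lia.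
pose kap (p : 'I_k * 'I_k) : R := if p.1 == p.2 then 1 - d else d / k%:R.
have kap0 p : 0 < kap p.
  by rewrite /kap; case: ifP => _; [rewrite subr_gt0 | rewrite divr_gt0].
have kap1 v : \sum_u kap (u, v) <= 1.
  rewrite (bigD1 v)//= {1}/kap/= eqxx.
  rewrite (eq_bigr (fun=> d / k%:R)); last by move=> i /negPf iv; rewrite /kap/= iv.
  rewrite sumr_const.
  have : (d / k%:R) *+ #|[pred i | i != v]| <= (d / k%:R) *+ k.
    rewrite -[leLHS]mulr_natr -[leRHS]mulr_natr ler_wpM2l//; first by apply: divr_ge0; apply: ltW.
    by rewrite ler_nat -[leqRHS]card_ord max_card.
  by rewrite -[leRHS]mulr_natr divfK ?gt_eqF//; lra.
pose phi i (z : n.-tuple 'I_k * N.-tuple L) := (tnth z.1 i, g (win i z.2)).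
pose q z := law rho (pref N) z.2 * \prod_(i < n) kap (phi i z).
have lN0 w : 0 <= law rho (@pref L a0 N) w by apply: fine_ge0.
have lZN z : 0 < law rho Z z -> 0 < law rho (@pref L a0 N) z.2.
  move=> lz; have -> : @pref L a0 N = snd \o Z by [].
  by rewrite law_comp//; apply: push_gt0 => // t; apply: fine_ge0.
apply: (@le_trans _ _ (ent (law rho Z))).
  have -> : proc P n = fst \o Z by [].
  by rewrite (eq_ent (law_comp rho fst mZ)); apply: ent_push_le; exact: law_distr.
apply: le_trans (@gibbs R _ _ q (law_distr rho mZ) _ _ _) _.
- by move=> z; rewrite mulr_ge0//; apply: prodr_ge0 => i _; exact: ltW.
- rewrite -(pair_big predT predT (fun u w => q (u, w)))/= exchange_big/=.
  have [_ <-] := law_distr rho (mpref N).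
  apply: ler_sum => w _; rewrite /q/= -mulr_sumr ler_piMr//.
  rewrite (sum_tuple_prod (fun i a => kap (a, g (win i w)))).
  apply: prodr_ile1 => i _; rewrite kap1 andbT; apply: sumr_ge0 => u _.
  exact: ltW.
- by move=> z /lZN lz; rewrite mulr_gt0//; apply: prodr_gt0.
have -> : \sum_z - (law rho Z z * ln (q z)) =
    \sum_z - (law rho Z z * ln (law rho (pref N) z.2)) +
    \sum_(i < n) \sum_z law rho Z z * - ln (kap (phi i z)).
  rewrite exchange_big -big_split/=; apply: eq_bigr => z _.
  have : 0 <= law rho Z z by apply: fine_ge0.
  rewrite le_eqVlt => /predU1P[<-|lz].
    by rewrite !mul0r oppr0 add0r big1// => i _; rewrite mul0r.
  rewrite /q lnM ?posrE ?lZN ?prodr_gt0// ln_prod_gt0//.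
  by rewrite mulrDr opprD -mulr_sumr sumrN mulrN.
apply: lerD.
  have -> : ent (law rho (@pref L a0 N)) = ent (push snd (law rho Z)).
    exact: (eq_ent (law_comp rho snd mZ)).
  rewrite ent_push le_eqVlt; apply/orP; left; apply/eqP; apply: eq_bigr => z _.
  by rewrite -(law_comp rho snd mZ).
pose Y2 (x : X) := (P x, g (pref n0 x)).
have mY2 : mfin Y2 by apply: mfin_pair => //; exact: (mfin_comp g (mpref n0)).
apply: (@le_trans _ _ (\sum_(i < n) 3 * d)); last first.
  by rewrite sumr_const card_ord -[leLHS]mulr_natl.
apply: ler_sum => i _; apply: le_trans dln.
rewrite -(push_sum (phi i) (law rho Z) (fun p => - ln (kap p))).
have phiZ : phi i \o Z = Y2 \o iter i sh.
  by apply/funext => x; rewrite /phi /Z /Y2/= -winE tnth_mktuple.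
rewrite (eq_bigr (fun p => law rho Y2 p * - ln (kap p))); last first.
  by move=> p _; rewrite -(law_comp rho (phi i) mZ) phiZ law_iter.
have [l0 l1] := law_distr rho mY2.
have err : \sum_(p | p.1 != p.2) law rho Y2 p <= d / (1 + D).
  have := prob_law rho (fun p : 'I_k * 'I_k => p.1 != p.2) mY2.
  have -> : Y2 @^-1` [set` (fun p : 'I_k * 'I_k => p.1 != p.2)] =
     [set x | P x != g (pref n0 x)] by [].
  by move=> E; move: gP; rewrite E.
rewrite (bigID (fun p => p.1 != p.2))/=.
apply: (@le_trans _ _ (\sum_(p | p.1 != p.2) law rho Y2 p * D +
    \sum_(p | ~~ (p.1 != p.2)) law rho Y2 p * - ln (1 - d))).
  apply: lerD; apply: ler_sum => p.
    move=> /negPf pp; rewrite ler_wpM2l// /kap pp /D -normrN; exact: ler_norm.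
  by rewrite negbK => pp; rewrite /kap pp.
rewrite -!mulr_suml; apply: lerD.
  apply: le_trans (ler_wpM2r D0 err) _.
  rewrite mulrAC ler_pdivrMr ?ltr_wpDr// ler_wpM2l ?(ltW d0)//.
  by rewrite lerDr.
rewrite -[leRHS]mul1r ler_wpM2r//.
  by rewrite oppr_ge0 ln_le0// gerBl ltW.
by rewrite -l1 [leRHS](bigID (fun p => p.1 != p.2))/= lerDr sumr_ge0.
Qed.

Lemma sup_eqP (S : set R) x : S x -> ubound S x -> sup S = x.
Proof.
move=> Sx ux; apply/eqP; rewrite eq_le; apply/andP; split.
  by apply: ge_sup => //; exists x.
by apply: ub_le_sup => //; exists x.
Qed.

(** The partition by the first letter generates: its entropy is a supremum over
    all finite partitions because [partition_entropy_le] bounds the entropy of any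
    other one by that of the letters. *)
Lemma entropyP :
  ((fun n => n%:R^-1 * ent (law rho (@pref L a0 n))) @ \oo --> entropy rho) /\
  (forall n, (0 < n)%N -> entropy rho <= n%:R^-1 * ent (law rho (@pref L a0 n))).
Proof.
have [l []] := proc_entropy_cvg mfin_letter.
under eq_fun do rewrite proc_letter.
move=> lcvg lle.
suff -> : entropy rho = l.
  by split => // n n0; rewrite -proc_letter lle.
apply: sup_eqP.
  exists #|L|, (enum_rank \o letter); split.
    by move=> i; exact: (mfin_comp (@enum_rank L) mfin_letter).
  apply/esym/cvg_lim => //.
  rewrite (_ : (fun n => _) = (fun n => n%:R^-1 * ent (law rho (@pref L a0 n))))//.
  apply/funext => n; rewrite join_entropyE; congr (_ * _).
  have -> : proc (enum_rank \o letter) n = map_tuple enum_rank \o proc letter n.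
    apply/funext => x; apply: eq_from_tnth => i.
    by rewrite [LHS]tnth_mktuple /comp tnth_map tnth_mktuple.
  rewrite (eq_ent (law_comp rho _ (mfin_proc (n := n) mfin_letter))) proc_letter.
  apply: ent_push_bij => v w /(congr1 val)/= vw; apply: val_inj => /=.
  by apply: inj_map vw; exact: enum_rank_inj.
move=> _ [k [P [mP ->]]].
have [h [hcvg _]] := proc_entropy_cvg mP.
under [X in limn X]eq_fun do rewrite join_entropyE.
rewrite (cvg_lim _ hcvg)//.
apply/ler_addgt0Pr => e e0.
pose d := Num.min (e / 3) 2^-1.
have d01 : 0 < d <= 2^-1 by rewrite lt_min ge_min lexx orbT andbT; lra.
have [n0 Hn] := partition_entropy_le mP d01.
have lD : (fun n => n%:R^-1 * ent (law rho (@pref L a0 n)) + e) @ \oo --> l + e.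
  by apply: cvgD => //; exact: cvg_cst.
apply: (cvg_le_div (C := ent (law rho (@pref L a0 n0))) hcvg lD) => n npos.
have nR : 0 < n%:R :> R by rewrite ltr0n.
have de : 3 * d <= e.
  have : d <= e / 3 by rewrite ge_min lexx.
  lra.
have := ent_proc_sub n n0 mfin_letter; rewrite !proc_letter => sub.
rewrite ler_pdivrMl// !mulrDr !mulVKf ?gt_eqF//.
apply: le_trans (Hn n) _.
have : n%:R * (3 * d) <= n%:R * e by rewrite ler_wpM2l// ltW.
lra.
Qed.

End KolmogorovSinai.

(** * Bernoulli measures *)

Section ProductLaw.
Variables (R : realType) (L : finType) (p : L -> R).
Hypothesis pD : is_distr p.

Definition prodlaw n (w : n.-tuple L) : R := \prod_(i < n) p (tnth w i).

Lemma prodlaw_distr n : is_distr (@prodlaw n).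
Proof.
have [p0 p1] := pD; split; first by move=> w; apply: prodr_ge0.
by rewrite (sum_tuple_prod (fun i a => p a)) big1.
Qed.

Lemma prodlaw_coord n (i : 'I_n) (g : L -> R) :
  \sum_w @prodlaw n w * g (tnth w i) = \sum_a p a * g a.
Proof.
have [p0 p1] := pD.
pose F (j : 'I_n) a := p a * (if j == i then g a else 1).
rewrite (eq_bigr (fun w : n.-tuple L => \prod_(j < n) F j (tnth w j))).
  rewrite sum_tuple_prod (bigD1 i)//= [X in _ * X]big1 ?mulr1 => [|j /negPf ji].
    by apply: eq_bigr => a _; rewrite /F eqxx.
  by rewrite -[RHS]p1; apply: eq_bigr => a _; rewrite /F ji mulr1.
move=> w _; rewrite /F big_split/=; congr (_ * _).
by rewrite (bigD1 i)//= eqxx big1 ?mulr1// => j /negPf ->.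
Qed.

Lemma prodlaw_ent n : ent (@prodlaw n) = n%:R * ent p.
Proof.
have [p0 p1] := pD.
transitivity (\sum_(w : n.-tuple L) \sum_(i < n) prodlaw w * - ln (p (tnth w i))).
  rewrite /ent; apply: eq_bigr => w _.
  have [/forallP wp|/forallPn[i]] := boolP [forall i, p (tnth w i) != 0].
    rewrite {2}/prodlaw ln_prod_gt0; last by move=> i; rewrite lt_neqAle eq_sym wp p0.
    by rewrite -mulr_sumr sumrN mulrN.
  rewrite negbK => /eqP wi.
  have -> : prodlaw w = 0 by rewrite /prodlaw (bigD1 i)//= wi mul0r.
  by rewrite mul0r oppr0 big1// => j _; rewrite mul0r.
rewrite exchange_big/=.
under eq_bigr => i _.
  rewrite (prodlaw_coord i (fun a => - ln (p a))); over.
rewrite sumr_const card_ord mulr_natl; congr (_ *+ _).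
by apply: eq_bigr => a _; rewrite mulrN.
Qed.

Definition ttail n (w : n.+1.-tuple L) : n.-tuple L :=
  [tuple tnth w (lift ord0 i) | i < n].

Lemma push_ttail n : push (@ttail n) (@prodlaw n.+1) =1 @prodlaw n.
Proof.
have [p0 p1] := pD; move=> v.
pose F (j : 'I_n.+1) a : R :=
  p a * (if unlift ord0 j is Some i then (a == tnth v i)%:R else 1).
transitivity (\sum_(w : n.+1.-tuple L) \prod_(j < n.+1) F j (tnth w j)).
  rewrite /push [LHS]big_mkcond; apply: eq_bigr => w _.
  rewrite /F big_split/= -[X in if _ then X else _]/(\prod_(j < n.+1) p (tnth w j)).
  rewrite [X in _ = _ * X]big_ord_recl unlift_none mul1r.
  case: eqP => [wv|wv].
    rewrite [X in _ * X]big1 ?mulr1// => i _; rewrite liftK -wv tnth_mktuple.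
    by rewrite eqxx.
  have [[i /negPf wi]|ne] := pselect (exists i, tnth w (lift ord0 i) != tnth v i).
    by rewrite [X in _ * X](bigD1 i)//= liftK wi mul0r mulr0.
  exfalso; apply: wv; apply: eq_from_tnth => i; rewrite tnth_mktuple.
  by apply: contrapT => /eqP wi; apply: ne; exists i.
rewrite sum_tuple_prod big_ord_recl /F unlift_none.
under [X in X * _]eq_bigr do rewrite mulr1.
rewrite p1 mul1r; apply: eq_bigr => i _; rewrite liftK (bigD1 (tnth v i))//=.
by rewrite eqxx mulr1 big1 ?addr0// => a /negPf ->; rewrite mulr0.
Qed.

End ProductLaw.

Section DigitExpansion.
Variables (R : realType) (L : finType) (a0 : L) (p : L -> R).
Hypothesis pD : is_distr p.
Local Notation X := (seqspace a0).

Let c (i : nat) : R := \sum_(j < i) p (nth a0 (enum L) j).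
Let F (a : L) : R := c (index a (enum L)).

Let cS i : c i.+1 = c i + p (nth a0 (enum L) i).
Proof. by rewrite /c big_ord_recr. Qed.

Let c_mono i j : (i <= j)%N -> c i <= c j.
Proof.
have [p0 p1] := pD.
elim: j => [|j IH]; first by rewrite leqn0 => /eqP ->.
rewrite leq_eqVlt => /predU1P[->//|/IH ij]; apply: le_trans ij _.
by rewrite cS lerDl.
Qed.

Let cT : c #|L| = 1.
Proof.
have [p0 p1] := pD; rewrite -p1 -big_enum cardE /c.
by rewrite (big_nth a0) big_mkord.
Qed.

Let Fp a : F a + p a = c (index a (enum L)).+1.
Proof. by rewrite cS nth_index// mem_enum. Qed.

Let F_bounds a : 0 <= F a /\ F a + p a <= 1.
Proof.
split; first by have := c_mono (leq0n (index a (enum L))); rewrite {1}/c big_ord0.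
by rewrite Fp -cT; apply: c_mono; rewrite cardE index_mem mem_enum.
Qed.

Let digit_ex y : 0 <= y < 1 -> exists a, F a <= y < F a + p a.
Proof.
move=> /andP[y0 y1].
have ex : exists i, y < c i.+1.
  have : y < c #|L| by rewrite cT.
  by case: #|L| => [|i]; [rewrite /c big_ord0 ltNge y0|exists i].
case: (ex_minnP ex) => i yi imin.
have iL : (i < #|L|)%N.
  rewrite ltnNge; apply/negP => Li.
  have : c #|L| <= c i by exact: c_mono.
  case: i yi imin Li => [|i] yi imin Li.
    by rewrite cT {1}/c big_ord0 ler10.
  by rewrite cT => /(lt_le_trans y1)/imin; rewrite ltnn.
exists (nth a0 (enum L) i).
have ie : index (nth a0 (enum L) i) (enum L) = i.
  by rewrite index_uniq ?enum_uniq// -cardE.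
rewrite Fp /F ie yi andbT.
case: i {iL ie} yi imin => [|i] yi imin; first by rewrite /c big_ord0.
by rewrite leNgt; apply/negP => /imin; rewrite ltnn.
Qed.

Let digit_uniq y a b : F a <= y < F a + p a -> F b <= y < F b + p b -> a = b.
Proof.
wlog ab : a b / (index a (enum L) <= index b (enum L))%N.
  move=> H ya yb; case: (leqP (index a (enum L)) (index b (enum L))) => ab.
    exact: H.
  by apply/esym/H => //; exact: ltnW.
move=> /andP[ya1 ya2] /andP[yb1 yb2].
suff e : index a (enum L) = index b (enum L).
  by rewrite -(nth_index a0 (mem_enum L a)) e nth_index// mem_enum.
apply/eqP; rewrite eqn_leq ab/= leqNgt; apply/negP => lt.
by have := c_mono lt; rewrite -Fp leNgt (le_lt_trans yb1 ya2).
Qed.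

Let D (y : R) : L := odflt a0 [pick a | F a <= y < F a + p a].
Let S (y : R) : R := (y - F (D y)) / p (D y).

Let DP y a : 0 <= y < 1 -> D y = a <-> F a <= y < F a + p a.
Proof.
move=> y01; rewrite /D; case: pickP => [b yb|no]/=.
  by split=> [<-//|]; exact: digit_uniq.
by have [b] := digit_ex y01; rewrite no.
Qed.

Let S01 y : 0 <= y < 1 -> 0 <= S y < 1.
Proof.
move=> y01; have /andP[y1 y2] := (DP (D y) y01).1 erefl.
have p0 : 0 < p (D y) by lra.
by rewrite /S divr_ge0 ?subr_ge0 ?(ltW p0)//= ltr_pdivrMr//; lra.
Qed.

Let digits (y : R) : X :=
  fun k => if 0 <= y < 1 then D (iter k S y) else a0.

Fixpoint left_end (w : seq L) : R :=
  if w is a :: w' then F a + p a * left_end w' else 0.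
Let len (w : seq L) : R := \prod_(a <- w) p a.

Let len_ge0 w : 0 <= len w.
Proof. by have [p0 p1] := pD; apply: prodr_ge0. Qed.

Let interval_bounds w : 0 <= left_end w /\ left_end w + len w <= 1.
Proof.
have [p0 p1] := pD.
elim: w => [|a w [IH1 IH2]] /=; first by rewrite /len big_nil add0r.
have [F0 F1] := F_bounds a; split; first by rewrite addr_ge0// mulr_ge0.
rewrite /len big_cons -/(len w) -addrA -mulrDr; apply: le_trans F1.
by rewrite lerD2l ler_piMr.
Qed.

Let digitsP w y : 0 <= y < 1 ->
  mkseq (digits y) (size w) = w <-> left_end w <= y < left_end w + len w.
Proof.
have [p0 p1] := pD.
elim: w y => [|a w IH] y y01.
  by rewrite /len big_nil /= add0r; split.
have dS : mkseq (digits y) (size (a :: w)) = D y :: mkseq (digits (S y)) (size w).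
  rewrite /mkseq /= -add1n iotaDl -map_comp /digits y01 S01//; congr (_ :: _).
  by apply: eq_map => k /=; rewrite -iterSr.
rewrite dS /= /len big_cons -/(len w).
have [l0 l1] := interval_bounds w.
have lw := len_ge0 w.
split.
  move=> [Da /(IH _ (S01 y01))]; have := (DP a y01).1 Da => /andP[ya1 ya2].
  have pa : 0 < p a by lra.
  rewrite /S Da ler_pdivlMr// ltr_pdivrMr// => /andP[].
  by move=> ? ?; apply/andP; split; lra.
move=> /andP[y1 y2].
have pl : 0 < p a * len w by lra.
have pa : 0 < p a by rewrite lt_neqAle p0 andbT eq_sym; apply/eqP => pa; rewrite pa mul0r ltxx in pl.
have Da : D y = a.
  apply/DP => //; apply/andP; split; first by nra.
  have : p a * (left_end w + len w) <= p a by rewrite ler_piMr.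
  lra.
rewrite Da; congr (_ :: _); apply/IH; first exact: S01.
rewrite /S Da ler_pdivlMr// ltr_pdivrMr//.
by apply/andP; split; lra.
Qed.

Let cylI n (w : n.-tuple L) : [set y : R | 0 <= y < 1 /\ pref n (digits y) = w] =
  `[left_end w, left_end w + len w[%classic.
Proof.
have [l0 l1] := interval_bounds w.
apply/seteqP; split=> y /=; rewrite in_itv/=.
  move=> [y01 yw]; apply/(digitsP w y01).
  by rewrite size_tuple -val_pref yw.
move=> yw; have y01 : 0 <= y < 1 by case/andP: yw => ? ?; apply/andP; split; lra.
split=> //; apply: val_inj; rewrite val_pref.
by have := (digitsP w y01).2 yw; rewrite size_tuple.
Qed.

Let mdigits : measurable_fun setT (digits : measurableTypeR R -> X).
Proof.
apply: measurable_to_seq => i a.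
have -> : [set y | digits y i = a] =
    (\bigcup_(w in [set w : i.+1.-tuple L | tnth w ord_max = a])
       [set y : R | 0 <= y < 1 /\ pref i.+1 (digits y) = w]) `|`
    ([set y | ~ (0 <= y < 1)] `&` [set y : R | a0 = a]).
  apply/seteqP; split=> y /=.
    have [y01|y01] := pselect (is_true (0 <= y < 1)).
      by move=> ya; left; exists (pref i.+1 (digits y)) => //=; rewrite tnth_mktuple.
    by rewrite /digits (negPf (introN idP y01)) => ->; right.
  move=> [[w /= <- [y01 <-]]|[y01 <-]]; first by rewrite tnth_mktuple.
  by rewrite /digits (negPf (introN idP y01)).
apply: measurableU.
  apply: fin_bigcup_measurable => [|w _]; first exact: finite_finset.
  by rewrite cylI; exact: measurable_itv.
apply: measurableI; last first.
  have [->|ne] := pselect (a0 = a).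
    by rewrite (_ : [set _ | _] = setT)//; apply/seteqP; split.
  by rewrite (_ : [set _ | _] = set0)//; apply/seteqP; split.
have -> : [set y : R | ~ (0 <= y < 1)] = ~` `[0, 1[%classic.
  by apply/seteqP; split=> y /=; rewrite in_itv.
by apply: measurableC; exact: measurable_itv.
Qed.

(** Lebesgue measure on the unit interval, read through the digits of the
    expansion whose first-level intervals have lengths [p a]. *)
Lemma bernoulli_exists : exists nu : probability X R,
  forall n, law nu (pref n) =1 prodlaw p (n := n).
Proof.
pose f : {mfun measurableTypeR R >-> X} :=
  HB.pack (digits : measurableTypeR R -> X) (isMeasurableFun.Build _ _ _ _ _ mdigits).
exists (distribution (uniform_prob (@ltr01 R)) f) => n w.
rewrite /law /= /distribution /pushforward/=.
set E := _ @^-1` _.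
have mE : measurable (E : set (measurableTypeR R)).
  by have := mdigits measurableT (@mfin_pref L a0 n w); rewrite setTI; exact.
have mEf : measurable_fun [set: measurableTypeR R] (\1_E : measurableTypeR R -> R).
  exact: measurable_realfun.measurable_indic.
have -> : uniform_prob (@ltr01 R) E = (\int[uniform_prob (@ltr01 R)]_x (\1_E x)%:E)%E.
  by rewrite integral_indic// setIT.
rewrite integral_uniform//; last by apply/measurable_realfun.measurable_EFinP.
rewrite subr0 invr1 mul1e -integral_itv_bndo_bndc; last first.
  by apply/measurable_realfun.measurable_EFinP; apply: measurable_funS mEf; [exact: measurableT|].
rewrite integral_indic//.
have [l0 l1] := interval_bounds w.
have -> : E `&` `[0, 1[%classic = `[left_end w, left_end w + len w[%classic.
  rewrite -cylI; apply/seteqP; split=> y; rewrite /E/= in_itv/=.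
    by move=> [].
  by move=> [].
have -> : prodlaw p w = len w by rewrite /prodlaw /len big_tuple.
rewrite [X in fine X](_ : _ = (len w)%:E)//.
apply: etrans (lebesgue_measure_itv _) _; rewrite /= lte_fin ltrDl.
case: ltP => [_|]; first by rewrite -EFinB addrAC subrr add0r.
by move=> w0; congr _%:E; apply/eqP; rewrite eq_le w0 len_ge0.
Qed.


End DigitExpansion.

Section Bernoulli.
Variables (R : realType) (L : finType) (a0 : L) (p : L -> R).
Hypothesis pD : is_distr p.
Variable nu : probability (seqspace a0) R.
Hypothesis nuP : forall n, law nu (pref n) =1 prodlaw p (n := n).

Lemma bernoulli_measureP : bernoulli_measure nu.
Proof.
have [p0 p1] := pD; exists p; split => // n w.
have -> : [set x : seqspace a0 | forall i : 'I_n, x i = tnth w i] = pref n @^-1` [set w].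
  by apply/seteqP; split=> x /prefP.
by rewrite lawE ?nuP//; exact: mfin_pref.
Qed.

Lemma bernoulli_invariant : shift_invariant nu.
Proof.
pose f : {mfun seqspace a0 >-> seqspace a0} :=
  HB.pack (@seq_shift L a0) (isMeasurableFun.Build _ _ _ _ _ (@measurable_shift L a0)).
move=> E mE; apply: (prob_unique (rho1 := distribution nu f)) => // n w.
have tp : @ttail L n \o pref n.+1 = pref n \o @seq_shift L a0.
  by apply/funext => x; apply: eq_from_tnth => i; rewrite !tnth_mktuple.
change (nu ((pref n \o @seq_shift L a0) @^-1` [set w]) = nu (pref n @^-1` [set w])).
rewrite -tp.
rewrite !lawE; [|exact: mfin_pref|by apply: mfin_comp; exact: mfin_pref].
rewrite law_comp ?nuP; last exact: mfin_pref.
congr _%:E; rewrite -[RHS](push_ttail pD).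
by apply: eq_bigr => v _; exact: nuP.
Qed.

Lemma bernoulli_entropy : entropy nu = ent p.
Proof.
have [ecvg _] := entropyP bernoulli_invariant.
apply: (cvg_unique _ ecvg) => //.
apply/cvgrPdist_le => e e0; near=> n.
have n0 : 0 < n%:R :> R by rewrite ltr0n; near: n; exact: nbhs_infty_gt.
rewrite (eq_ent (@nuP n)) prodlaw_ent// mulKf ?gt_eqF//.
by rewrite subrr normr0 ltW.
Unshelve. all: by end_near. Qed.

End Bernoulli.

(** * Singular values of plane matrices *)

Section PlaneMatrices.
Variable R : realType.
Implicit Types B C : 'M[R]_2.

Lemma sum_ord2 (V : nmodType) (F : 'I_2 -> V) : \sum_i F i = F 0 + F 1.
Proof.
rewrite big_ord_recl big_ord1; congr (_ + F _); exact: val_inj.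
Qed.

Lemma ord2P (i : 'I_2) : i = 0 \/ i = 1.
Proof. by case: i => -[|[|//]] lt; [left|right]; apply: val_inj. Qed.

Lemma mulmx2 m n (B : 'M[R]_(m, 2)) (C : 'M[R]_(2, n)) i j :
  (B *m C) i j = B i 0 * C 0 j + B i 1 * C 1 j.
Proof. by rewrite mxE sum_ord2. Qed.

Lemma det2 B : \det B = B 0 0 * B 1 1 - B 0 1 * B 1 0.
Proof.
rewrite (expand_det_row _ 0) sum_ord2 /cofactor !det_mx11 !mxE/=.
rewrite expr0 mul1r expr1 mulN1r mulrN.
by congr (_ * B _ _ - _ * B _ _); apply: val_inj.
Qed.

Lemma eq_mx2 B C : B 0 0 = C 0 0 -> B 0 1 = C 0 1 -> B 1 0 = C 1 0 ->
  B 1 1 = C 1 1 -> B = C.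
Proof.
by move=> *; apply/matrixP => i j; case: (ord2P i) => ->; case: (ord2P j) => ->.
Qed.

Lemma eq_cv2 (x y : 'cV[R]_2) : x 0 0 = y 0 0 -> x 1 0 = y 1 0 -> x = y.
Proof.
by move=> *; apply/matrixP => i j; rewrite (ord1 j); case: (ord2P i) => ->.
Qed.

Definition frob2 B : R := B 0 0 ^+ 2 + B 0 1 ^+ 2 + B 1 0 ^+ 2 + B 1 1 ^+ 2.

Definition nsq (x : 'cV[R]_2) : R := x 0 0 ^+ 2 + x 1 0 ^+ 2.

Lemma nsq_ge0 x : 0 <= nsq x.
Proof. by rewrite addr_ge0 ?sqr_ge0. Qed.

Lemma nsq_eq0 x : nsq x = 0 -> x = 0.
Proof.
move=> /eqP; rewrite paddr_eq0 ?sqr_ge0// !sqrf_eq0 => /andP[/eqP x0 /eqP x1].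
by apply: eq_cv2; rewrite mxE.
Qed.

Lemma nsq_gt0 x : x != 0 -> 0 < nsq x.
Proof.
move=> x0; rewrite lt_neqAle nsq_ge0 andbT eq_sym.
by apply: contra_neq x0; exact: nsq_eq0.
Qed.

Lemma nsqZ a x : nsq (a *: x) = a ^+ 2 * nsq x.
Proof. by rewrite /nsq !mxE; ring. Qed.

Lemma enormE x : enorm x = Num.sqrt (nsq x).
Proof. by rewrite /enorm sum_ord2. Qed.

Lemma frob2_ge0 B : 0 <= frob2 B.
Proof. by rewrite !addr_ge0 ?sqr_ge0. Qed.

Lemma frob2_detP B : - frob2 B <= 2 * \det B <= frob2 B.
Proof.
rewrite det2 /frob2; set a := B 0 0; set b := B 0 1; set c := B 1 0; set d := B 1 1.
have := sqr_ge0 (a - d); have := sqr_ge0 (b + c).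
have := sqr_ge0 (a + d); have := sqr_ge0 (b - c).
by move=> *; apply/andP; split; lra.
Qed.

Definition disc2 B : R := Num.sqrt (frob2 B ^+ 2 - 4 * (\det B) ^+ 2).
Definition top2 B : R := (frob2 B + disc2 B) / 2.
Definition bot2 B : R := (frob2 B - disc2 B) / 2.

Lemma disc2_sqr B : disc2 B ^+ 2 = frob2 B ^+ 2 - 4 * (\det B) ^+ 2.
Proof.
rewrite sqr_sqrtr//; have /andP[l u] := frob2_detP B.
rewrite (_ : _ - _ = (frob2 B - 2 * \det B) * (frob2 B + 2 * \det B)); last by ring.
by rewrite mulr_ge0//; lra.
Qed.

Lemma disc2_ge0 B : 0 <= disc2 B. Proof. exact: sqrtr_ge0. Qed.

Lemma disc2_le B : disc2 B <= frob2 B.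
Proof.
rewrite -(@ler_sqr R) ?nnegrE ?disc2_ge0 ?frob2_ge0// disc2_sqr.
by have := sqr_ge0 (\det B); lra.
Qed.

(** The eigenvalues of [B^T B] are the roots of [l^2 - |B|_F^2 l + det^2]. *)
Lemma eigenvalue_gram B l : eigenvalue (B^T *m B) l = (l \in [:: bot2 B; top2 B]).
Proof.
rewrite /eigenvalue /eigenspace kermx_eq0 row_free_unit unitmxE unitfE negbK.
rewrite det2 !mxE !sum_ord2 !mxE/= mulr1n mulr0n !inE.
have -> : (B 0 0 * B 0 0 + B 1 0 * B 1 0 - l) * (B 0 1 * B 0 1 + B 1 1 * B 1 1 - l) -
   (B 0 0 * B 0 1 + B 1 0 * B 1 1 - 0) * (B 0 1 * B 0 0 + B 1 1 * B 1 0 - 0) =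
   (l - bot2 B) * (l - top2 B).
  have -> : (l - bot2 B) * (l - top2 B) =
     l ^+ 2 - frob2 B * l + (frob2 B ^+ 2 - disc2 B ^+ 2) / 4.
    by rewrite /bot2 /top2; field.
  by rewrite disc2_sqr det2 /frob2; field.
by rewrite mulf_eq0 !subr_eq0.
Qed.

Lemma bot2_ge0 B : 0 <= bot2 B.
Proof. by have := disc2_le B; rewrite /bot2; lra. Qed.

Lemma bot2_le B : bot2 B <= top2 B.
Proof. by have := disc2_ge0 B; rewrite /bot2 /top2; lra. Qed.

Lemma alpha1E B : alpha1 B = Num.sqrt (top2 B).
Proof.
rewrite /alpha1; congr Num.sqrt; apply: sup_eqP => /=.
  by rewrite eigenvalue_gram !inE eqxx orbT.
move=> l /=; rewrite eigenvalue_gram !inE => /orP[] /eqP -> //.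
exact: bot2_le.
Qed.

Lemma alpha2E B : alpha2 B = Num.sqrt (bot2 B).
Proof.
rewrite /alpha2; congr Num.sqrt; apply/eqP; rewrite eq_le; apply/andP; split.
  apply: ge_inf; last by rewrite /= eigenvalue_gram !inE eqxx.
  exists (bot2 B) => l /=; rewrite eigenvalue_gram !inE => /orP[] /eqP -> //.
  exact: bot2_le.
apply: lb_le_inf; first by exists (bot2 B); rewrite /= eigenvalue_gram !inE eqxx.
move=> l /=; rewrite eigenvalue_gram !inE => /orP[] /eqP -> //.
exact: bot2_le.
Qed.

Lemma alpha1_ge0 B : 0 <= alpha1 B. Proof. exact: sqrtr_ge0. Qed.
Lemma alpha2_ge0 B : 0 <= alpha2 B. Proof. exact: sqrtr_ge0. Qed.

Lemma alpha1_sqr B : alpha1 B ^+ 2 = top2 B.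
Proof.
by rewrite alpha1E sqr_sqrtr//; apply: le_trans (bot2_ge0 B) (bot2_le B).
Qed.

Lemma alpha21_le B : alpha2 B <= alpha1 B.
Proof. by rewrite alpha1E alpha2E ler_wsqrtr// bot2_le. Qed.

Lemma alpha_det B : alpha1 B * alpha2 B = `|\det B|.
Proof.
rewrite alpha1E alpha2E -sqrtrM; last exact: le_trans (bot2_ge0 B) (bot2_le B).
rewrite -sqrtr_sqr; congr Num.sqrt.
have -> : top2 B * bot2 B = (frob2 B ^+ 2 - disc2 B ^+ 2) / 4.
  by rewrite /bot2 /top2; field.
by rewrite disc2_sqr; field.
Qed.

Lemma alpha1_frob B : alpha1 B ^+ 2 <= frob2 B <= 2 * alpha1 B ^+ 2.
Proof.
rewrite alpha1_sqr; have := disc2_le B; have := disc2_ge0 B.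
by rewrite /top2 => *; apply/andP; split; lra.
Qed.

Lemma nsq_mul B x : nsq (B *m x) =
  (B 0 0 ^+ 2 + B 1 0 ^+ 2) * x 0 0 ^+ 2 +
  2 * (B 0 0 * B 0 1 + B 1 0 * B 1 1) * (x 0 0 * x 1 0) +
  (B 0 1 ^+ 2 + B 1 1 ^+ 2) * x 1 0 ^+ 2.
Proof. by rewrite /nsq !mulmx2; ring. Qed.

Lemma top2_eq B : (top2 B - (B 0 0 ^+ 2 + B 1 0 ^+ 2)) *
  (top2 B - (B 0 1 ^+ 2 + B 1 1 ^+ 2)) = (B 0 0 * B 0 1 + B 1 0 * B 1 1) ^+ 2.
Proof.
have e : top2 B ^+ 2 - frob2 B * top2 B + (\det B) ^+ 2 = 0.
  have -> : top2 B ^+ 2 - frob2 B * top2 B = - (frob2 B ^+ 2 - disc2 B ^+ 2) / 4.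
    by rewrite /top2; field.
  by rewrite disc2_sqr; field.
apply/eqP; rewrite -subr_eq0 -[X in _ == X]e det2 /frob2; apply/eqP; ring.
Qed.

Lemma top2_ge B : B 0 0 ^+ 2 + B 1 0 ^+ 2 <= top2 B /\
  B 0 1 ^+ 2 + B 1 1 ^+ 2 <= top2 B.
Proof.
have sum : top2 B - (B 0 0 ^+ 2 + B 1 0 ^+ 2) + (top2 B - (B 0 1 ^+ 2 + B 1 1 ^+ 2)) = disc2 B.
  by rewrite /top2 /frob2; field.
have := disc2_ge0 B; rewrite -sum.
have : 0 <= (top2 B - (B 0 0 ^+ 2 + B 1 0 ^+ 2)) * (top2 B - (B 0 1 ^+ 2 + B 1 1 ^+ 2)).
  by rewrite top2_eq sqr_ge0.
set u := top2 B - _; set v := top2 B - _ => uv0 uv1.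
suff : 0 <= u /\ 0 <= v by rewrite !subr_ge0.
split; rewrite leNgt; apply/negP => neg; nra.
Qed.

Lemma nsq_mul_le B x : nsq (B *m x) <= alpha1 B ^+ 2 * nsq x.
Proof.
rewrite alpha1_sqr nsq_mul /nsq.
have := top2_eq B; have [] := top2_ge B.
set a := B 0 0 ^+ 2 + _; set e := B 0 1 ^+ 2 + _; set b := B 0 0 * _ + _.
set t := top2 B; set y := x 0 0; set z := x 1 0 => ta te tt.
rewrite -subr_ge0.
have -> : t * (y ^+ 2 + z ^+ 2) - (a * y ^+ 2 + 2 * b * (y * z) + e * z ^+ 2) =
  (t - a) * y ^+ 2 - 2 * b * (y * z) + (t - e) * z ^+ 2 by ring.
move: ta; rewrite le_eqVlt => /predU1P[ta|ta].
  have b0 : b = 0 by move: tt; rewrite ta subrr mul0r => /esym/eqP; rewrite sqrf_eq0 => /eqP.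
  by rewrite b0 ta subrr !(mul0r, mulr0) subrr add0r mulr_ge0 ?sqr_ge0 ?subr_ge0.
have p0 : 0 < t - a by rewrite subr_gt0.
rewrite -(pmulr_rge0 _ p0).
have -> : (t - a) * ((t - a) * y ^+ 2 - 2 * b * (y * z) + (t - e) * z ^+ 2) =
  ((t - a) * y - b * z) ^+ 2.
  have -> : ((t - a) * y - b * z) ^+ 2 = (t - a) ^+ 2 * y ^+ 2 - 2 * (t - a) * b * y * z + b ^+ 2 * z ^+ 2 by ring.
  by rewrite -tt; ring.
exact: sqr_ge0.
Qed.

Lemma alpha1_attained B : exists2 x, nsq x = 1 & nsq (B *m x) = alpha1 B ^+ 2.
Proof.
suff [x x0 xB] : exists2 x, x != 0 & nsq (B *m x) = alpha1 B ^+ 2 * nsq x.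
  have n0 := nsq_gt0 x0.
  have s0 : (Num.sqrt (nsq x))^-1 ^+ 2 = (nsq x)^-1.
    by rewrite exprVn sqr_sqrtr// ltW.
  exists ((Num.sqrt (nsq x))^-1 *: x); first by rewrite nsqZ s0 mulVf// gt_eqF.
  by rewrite -scalemxAr nsqZ s0 xB mulrC mulfK// gt_eqF.
have := top2_eq B; rewrite alpha1_sqr.
set b := B 0 0 * _ + _; set t := top2 B => tt.
pose x := \col_(i < 2) (if i == 0 then b else t - (B 0 0 ^+ 2 + B 1 0 ^+ 2)).
have [x0|xn0] := eqVneq x 0; last first.
  exists x => //; rewrite nsq_mul /nsq !mxE/=.
  rewrite -/b; apply/eqP; rewrite -subr_eq0; apply/eqP.
  set a := B 0 0 ^+ 2 + _; set e := B 0 1 ^+ 2 + _.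
  transitivity ((t - a) * (b ^+ 2 - (t - a) * (t - e))); first by ring.
  by rewrite tt subrr mulr0.
have b0 : b = 0 by have /colP/(_ 0) := x0; rewrite !mxE.
have ta : t = B 0 0 ^+ 2 + B 1 0 ^+ 2.
  by have /colP/(_ 1) := x0; rewrite !mxE/= => /eqP; rewrite subr_eq0 => /eqP.
pose e := \col_(i < 2) (if i == 0 then 1 else 0 : R).
exists e; first by apply/eqP => /colP/(_ 0); rewrite !mxE/= => /eqP; rewrite oner_eq0.
by rewrite nsq_mul /nsq !mxE/= -/b b0 ta; ring.
Qed.

Lemma alpha1_mul B C : alpha1 (B *m C) <= alpha1 B * alpha1 C.
Proof.
have [x x1 e] := alpha1_attained (B *m C).
rewrite -ler_sqr ?nnegrE ?mulr_ge0 ?alpha1_ge0// -e exprMn -mulmxA.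
apply: le_trans (nsq_mul_le _ _) _; rewrite ler_wpM2l ?sqr_ge0//.
by apply: le_trans (nsq_mul_le _ _) _; rewrite x1 mulr1.
Qed.

Lemma alpha1_opnorm B : alpha1 B <= opnorm B.
Proof.
have [x x1 e] := alpha1_attained B.
apply: ub_le_sup; last first.
  exists x; rewrite /= !enormE ?x1 ?sqrtr1//.
  by rewrite e sqrtr_sqr ger0_norm ?alpha1_ge0.
exists (alpha1 B) => _ [y /= y1 <-].
rewrite enormE -[leRHS](ger0_norm (alpha1_ge0 B)) -sqrtr_sqr ler_wsqrtr//.
apply: le_trans (nsq_mul_le _ _) _; rewrite ler_piMr ?sqr_ge0//.
move: y1; rewrite enormE -[X in _ <= X]sqrtr1 ler_sqrt//.
Qed.


End PlaneMatrices.

(** * Lyapunov exponents of invariant measures *)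

Section Words.
Variables (R : realType) (L : finType) (A : L -> 'M[R]_2).

Lemma wprod_nil : wprod A [::] = 1%:M.
Proof. by rewrite /wprod big_nil. Qed.

Lemma wprod_cat v w : wprod A (v ++ w) = wprod A w *m wprod A v.
Proof. by rewrite /wprod rev_cat big_cat. Qed.

Lemma wprod_seq1 a : wprod A [:: a] = A a.
Proof. by rewrite /wprod big_seq1. Qed.

Lemma wprod_cons a w : wprod A (a :: w) = wprod A w *m A a.
Proof. by rewrite -cat1s wprod_cat wprod_seq1. Qed.

Hypothesis Au : forall a, A a \in unitmx.

Lemma wprod_unit w : wprod A w \in unitmx.
Proof.
elim: w => [|a w IH]; first by rewrite wprod_nil unitmx1.
by rewrite wprod_cons unitmx_mul IH Au.
Qed.

End Words.

Section LogSingular.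
Variable R : realType.
Implicit Types B C : 'M[R]_2.

Lemma unit_det_gt0 B : B \in unitmx -> 0 < `|\det B|.
Proof. by rewrite unitmxE unitfE normr_gt0. Qed.

Lemma alpha1_gt0 B : B \in unitmx -> 0 < alpha1 B.
Proof.
move=> /unit_det_gt0 d0; rewrite lt_neqAle alpha1_ge0 andbT eq_sym.
by apply: contraTN d0 => /eqP a0; rewrite -alpha_det a0 mul0r ltxx.
Qed.

Lemma alpha2_gt0 B : B \in unitmx -> 0 < alpha2 B.
Proof.
move=> /unit_det_gt0 d0; rewrite lt_neqAle alpha2_ge0 andbT eq_sym.
by apply: contraTN d0 => /eqP a0; rewrite -alpha_det a0 mulr0 ltxx.
Qed.

Definition lna B : R := ln (alpha1 B).
Definition lnd B : R := ln `|\det B|.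

Lemma lna_mul B C : B \in unitmx -> C \in unitmx ->
  lna (B *m C) <= lna B + lna C.
Proof.
move=> uB uC; have a1 := alpha1_gt0 uB; have a2 := alpha1_gt0 uC.
have a3 : 0 < alpha1 (B *m C) by apply: alpha1_gt0; rewrite unitmx_mul uB.
have a4 : 0 < alpha1 B * alpha1 C by exact: mulr_gt0 a1 a2.
rewrite /lna -(lnM a1 a2) (ler_ln a3 a4); exact: alpha1_mul.
Qed.

Lemma lnd_mul B C : B \in unitmx -> C \in unitmx ->
  lnd (B *m C) = lnd B + lnd C.
Proof.
by move=> uB uC; rewrite /lnd det_mulmx normrM lnM ?posrE ?unit_det_gt0.
Qed.

Lemma lnd_le B : B \in unitmx -> lnd B <= 2 * lna B.
Proof.
move=> uB; have a1 := alpha1_gt0 uB.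
have -> : 2 * lna B = ln (alpha1 B * alpha1 B).
  by rewrite lnM ?posrE// /lna; ring.
rewrite ler_ln ?posrE ?unit_det_gt0 ?mulr_gt0//.
by rewrite -alpha_det ler_wpM2l ?alpha1_ge0 ?alpha21_le.
Qed.

Lemma ln_alpha2 B : B \in unitmx -> ln (alpha2 B) = lnd B - lna B.
Proof.
move=> uB; rewrite /lnd -alpha_det lnM ?posrE ?alpha1_gt0 ?alpha2_gt0// /lna.
by rewrite addrAC subrr add0r.
Qed.

(** For [0 < s < 2] the singular value function is
    [alpha1 ^ t * |det| ^ u], where [t = min(s, 2 - s)]. *)
Definition svt (s : R) : R := if s < 1 then s else 2 - s.
Definition svu (s : R) : R := if s < 1 then 0 else s - 1.

Definition lnphi s B : R := svt s * lna B + svu s * lnd B.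

Lemma svfE s B : 0 < s < 2 -> B \in unitmx -> svf s B = expR (lnphi s B).
Proof.
move=> /andP[s0 s2] uB; rewrite /svf /lnphi /svt /svu.
have a1 := alpha1_gt0 uB; have a2 := alpha2_gt0 uB.
case: ifP => s1; first by rewrite mul0r addr0 /powR gt_eqF.
rewrite s2 /powR gt_eqF// ln_alpha2//.
have -> : (2 - s) * lna B + (s - 1) * lnd B = lna B + (s - 1) * (lnd B - lna B) by ring.
by rewrite expRD lnK.
Qed.

Lemma svt_gt0 s : 0 < s < 2 -> 0 < svt s.
Proof. by move=> /andP[s0 s2]; rewrite /svt; case: ifP => _; lra. Qed.

Lemma svu_ge0 s : 0 <= svu s.
Proof. by rewrite /svu; case: ltP => ?; lra. Qed.

Lemma lnphi_mul s B C : 0 < s < 2 -> B \in unitmx -> C \in unitmx ->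
  lnphi s (B *m C) <= lnphi s B + lnphi s C.
Proof.
move=> s02 uB uC; rewrite /lnphi lnd_mul//.
have t0 := ltW (svt_gt0 s02); have h := lna_mul uB uC; move: t0 h.
move: (lna (B *m C)) (lna B) (lna C) (lnd B) (lnd C) (svt s) (svu s).
by move=> x y z d e t u t0 /(ler_wpM2l t0); lra.
Qed.

End LogSingular.

Section Exponents.
Variables (R : realType) (L : finType) (a0 : L).
Variable rho : probability (seqspace a0) R.
Hypothesis rho_inv : shift_invariant rho.

Definition Ex n (f : seq L -> R) : R := \sum_w law rho (@pref L a0 n) w * f w.

Lemma Ex_le n f g : (forall w, f w <= g w) -> Ex n f <= Ex n g.
Proof. by move=> fg; apply: ler_sum => w _; rewrite ler_wpM2l// fine_ge0. Qed.

Lemma eq_Ex n f g : (forall w, f w = g w) -> Ex n f = Ex n g.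
Proof. by move=> fg; apply: eq_bigr => w _; rewrite fg. Qed.

Lemma ExD n f g : Ex n (fun w => f w + g w) = Ex n f + Ex n g.
Proof. by rewrite /Ex -big_split/=; apply: eq_bigr => w _; rewrite mulrDr. Qed.

Lemma ExZ n c f : Ex n (fun w => c * f w) = c * Ex n f.
Proof. by rewrite /Ex mulr_sumr; apply: eq_bigr => w _; rewrite mulrCA. Qed.

Lemma Ex_cst n c : Ex n (fun=> c) = c.
Proof.
by rewrite /Ex -mulr_suml; have [_ ->] := law_distr rho (@mfin_pref L a0 n); rewrite mul1r.
Qed.

Lemma Ex_split m n (f g : seq L -> R) :
  \sum_w law rho (@pref L a0 (m + n)) w * (f (take m w) + g (drop m w)) =
  Ex m f + Ex n g.
Proof.
pose F (w : (m + n).-tuple L) : m.-tuple L := [tuple tnth w (lshift n i) | i < m].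
pose G (w : (m + n).-tuple L) : n.-tuple L := [tuple tnth w (rshift m i) | i < n].
have mP : mfin (@pref L a0 (m + n)) by exact: mfin_pref.
have FP : F \o pref (m + n) = @pref L a0 m.
  by apply/funext => x; apply: eq_from_tnth => i; rewrite !tnth_mktuple.
have GP : G \o pref (m + n) = @pref L a0 n \o iter m (@seq_shift L a0).
  by apply/funext => x; apply: eq_from_tnth => i; rewrite !tnth_mktuple iter_shiftE.
have FT (w : (m + n).-tuple L) : take m w = F w.
  have st : size (take m w) = m by rewrite size_takel// size_tuple leq_addr.
  apply: (@eq_from_nth _ a0); first by rewrite st size_tuple.
  rewrite st => i im; rewrite nth_take//.
  have := tnth_mktuple (fun i => tnth w (lshift n i)) (Ordinal im).
  by rewrite !(tnth_nth a0) => <-.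
have GT (w : (m + n).-tuple L) : drop m w = G w.
  apply: (@eq_from_nth _ a0); first by rewrite size_drop !size_tuple addKn.
  rewrite size_drop size_tuple addKn => i im; rewrite nth_drop.
  have := tnth_mktuple (fun i => tnth w (rshift m i)) (Ordinal im).
  by rewrite !(tnth_nth a0) => <-.
transitivity (\sum_w law rho (@pref L a0 (m + n)) w * f (F w) +
   \sum_w law rho (@pref L a0 (m + n)) w * g (G w)).
  by rewrite -big_split/=; apply: eq_bigr => w _; rewrite FT GT mulrDr.
rewrite -(push_sum F _ (fun w => f w)) -(push_sum G _ (fun w => g w)).
congr (_ + _); apply: eq_bigr => w _; congr (_ * _).
  by rewrite -law_comp// FP.
by rewrite -law_comp// GP law_iter//; exact: mfin_pref.
Qed.

Lemma Ex_sub f m n : (forall v w, f (v ++ w) <= f v + f w) ->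
  Ex (m + n) f <= Ex m f + Ex n f.
Proof.
move=> fs; rewrite -Ex_split; apply: ler_sum => w _.
by rewrite ler_wpM2l ?fine_ge0// -{1}(cat_take_drop m w) fs.
Qed.

Lemma Ex_add f n : (forall v w, f (v ++ w) = f v + f w) -> Ex n f = n%:R * Ex 1 f.
Proof.
move=> fs; have f0 : f [::] = 0.
  by have /eqP := fs [::] [::]; rewrite -subr_eq0 cats0 opprD addNKr oppr_eq0 => /eqP.
elim: n => [|n IH].
  rewrite mul0r; transitivity (Ex 0 (fun=> 0)); last exact: Ex_cst.
  by apply: eq_bigr => w _; rewrite tuple0 f0.
rewrite -addn1 natrD mulrDl mul1r -IH -Ex_split.
by apply: eq_bigr => w _; rewrite -fs cat_take_drop.
Qed.

Lemma integral_cocycle (A : L -> 'M[R]_2) (h : 'M[R]_2 -> R) n :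
  \int[rho]_x h (cocycle A x n) = Ex n (fun w => h (wprod A w)).
Proof.
have E := integral_law rho (fun w : n.-tuple L => h (wprod A w)) (@mfin_pref L a0 n).
by apply: etrans E; congr Rintegral; apply/funext => x; rewrite val_pref.
Qed.

Variable A : L -> 'M[R]_2.
Hypothesis Au : forall a, A a \in unitmx.

Lemma lnd_cat v w : lnd (wprod A (v ++ w)) = lnd (wprod A v) + lnd (wprod A w).
Proof. by rewrite wprod_cat lnd_mul ?wprod_unit// addrC. Qed.

Lemma lna_cat v w : lna (wprod A (v ++ w)) <= lna (wprod A v) + lna (wprod A w).
Proof. by rewrite wprod_cat addrC lna_mul ?wprod_unit. Qed.

Definition lnd_mean : R := Ex 1 (fun w => lnd (wprod A w)).

Lemma Ex_lnd n : Ex n (fun w => lnd (wprod A w)) = n%:R * lnd_mean.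
Proof. exact: (Ex_add _ lnd_cat). Qed.

(** Submultiplicativity of the norm and invariance make the means subadditive. *)
Lemma lambda1P :
  ((fun n => n%:R^-1 * Ex n (fun w => lna (wprod A w))) @ \oo --> lambda1 rho A) /\
  (forall n, (0 < n)%N -> lambda1 rho A <= n%:R^-1 * Ex n (fun w => lna (wprod A w))).
Proof.
have [l [lc lb]] : exists l : R,
  ((fun n => n%:R^-1 * Ex n (fun w => lna (wprod A w))) @ \oo --> l) /\
  (forall n, (0 < n)%N -> l <= n%:R^-1 * Ex n (fun w => lna (wprod A w))).
  apply: (fekete (K := `|lnd_mean / 2|)).
    by move=> m n; apply: Ex_sub; exact: lna_cat.
  move=> n; apply: (@le_trans _ _ (Ex n (fun w => 2^-1 * lnd (wprod A w)))).
    rewrite ExZ Ex_lnd.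
    have -> : 2^-1 * (n%:R * lnd_mean) = - (- (lnd_mean / 2) * n%:R) by field.
    rewrite lerN2; apply: ler_wpM2r; first exact: ler0n.
    by rewrite -normrN; exact: ler_norm.
  by apply: Ex_le => w; have := lnd_le (wprod_unit Au w); lra.
suff -> : lambda1 rho A = l by [].
apply: cvg_lim => //; rewrite (_ : (fun n => _) = (fun n => n%:R^-1 * Ex n (fun w => lna (wprod A w))))//.
by apply/funext => n; congr (_ * _); exact: (integral_cocycle A (@lna R) n).
Qed.

(** The logarithm of the determinant is additive along words, so it has a mean
    per letter; this mean is the sum of the two exponents. *)
Lemma lambda2E : lambda2 rho A = lnd_mean - lambda1 rho A.
Proof.
have [lc _] := lambda1P.
apply: cvg_lim => //.
have : (fun n => lnd_mean - n%:R^-1 * Ex n (fun w => lna (wprod A w))) @ \oo -->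
    lnd_mean - lambda1 rho A.
  by apply: cvgB => //; exact: cvg_cst.
apply: cvg_trans; apply: near_eq_cvg; near=> n.
have n0 : n%:R != 0 :> R by rewrite pnatr_eq0 -lt0n; near: n; exact: nbhs_infty_gt.
rewrite [X in _ = _ * X](integral_cocycle A (fun B => ln (alpha2 B)) n).
rewrite (eq_Ex n (f := fun w => ln (alpha2 (wprod A w))) (g := fun w => lnd (wprod A w) + -1 * lna (wprod A w))); last first.
  by move=> w; rewrite mulN1r; exact: ln_alpha2 (wprod_unit Au w).
by rewrite ExD ExZ Ex_lnd mulrDr mulKf// mulN1r mulrN.
Unshelve. all: by end_near. Qed.

Lemma lambda1_lna_bound (K : R) : (forall a, lna (A a) <= K) -> lambda1 rho A <= K.
Proof.
move=> aK; have [_ /(_ 1%N isT)] := lambda1P; rewrite invr1 mul1r => /le_trans; apply.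
rewrite -[K](Ex_cst 1); apply: ler_sum => w _; rewrite ler_wpM2l ?fine_ge0//.
by case: w => -[|a [|b w]]// sw; rewrite wprod_seq1.
Qed.

Lemma lambda21_le : lambda2 rho A <= lambda1 rho A.
Proof.
rewrite lambda2E lerBlDr.
have [lc _] := lambda1P.
have lc2 : (fun n => n%:R^-1 * Ex n (fun w => lna (wprod A w)) +
    n%:R^-1 * Ex n (fun w => lna (wprod A w))) @ \oo --> lambda1 rho A + lambda1 rho A.
  exact: cvgD.
apply: (cvg_le_div (C := 0) (cvg_cst lnd_mean) lc2) => n n0.
rewrite mulr0 addr0 -mulrDr ler_pdivlMl ?ltr0n// -Ex_lnd -ExD.
by apply: Ex_le => w; have := lnd_le (wprod_unit Au w); rewrite mulr_natl mulr2n.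
Qed.

End Exponents.

(** * Transversality *)

Section Transversality.
Variable R : realType.

Definition crs (x y : 'cV[R]_2) : R := x 0 0 * y 1 0 - x 1 0 * y 0 0.
Definition dot (x y : 'cV[R]_2) : R := x 0 0 * y 0 0 + x 1 0 * y 1 0.
Definition cv2 (a b : R) : 'cV[R]_2 := \col_i (if i == 0 then a else b).

Lemma cv2E0 a b : cv2 a b 0 0 = a. Proof. by rewrite mxE. Qed.
Lemma cv2E1 a b : cv2 a b 1 0 = b. Proof. by rewrite mxE. Qed.

Lemma cv2_eta (x : 'cV[R]_2) : x = cv2 (x 0 0) (x 1 0).
Proof. by apply: eq_cv2; rewrite !mxE. Qed.

Lemma nsq_mul_frob (N : 'M[R]_2) x : nsq (N *m x) <= frob2 N * nsq x.
Proof.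
have := nsq_mul_le N x; have /andP[a _] := alpha1_frob N.
by move/le_trans; apply; rewrite ler_wpM2r ?nsq_ge0.
Qed.

Lemma poly_min_pos (p : {poly R}) : (forall a, 0 < p.[a]) ->
  exists2 m, 0 < m & forall a, `|a| <= 1 -> m <= p.[a].
Proof.
move=> p0.
have n11 : -1 <= 1 :> R by lra.
have cp : {within `[-1, 1], continuous (horner p)}.
  by apply: continuous_subspaceT; exact: continuous_horner.
have [c _ cmin] := EVT_min n11 cp.
exists p.[c] => // a a1; apply: cmin; rewrite in_itv/= -ler_norml//.
Qed.

Variables (K : finType) (Nk : K -> 'M[R]_2).

Let g (x : 'cV[R]_2) : R := \sum_k crs x (Nk k *m x) ^+ 2.

(** [g] is a quartic form without nontrivial zeros;
    by homogeneity it is enough to bound [g] below on the sides [(1, a)] and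
    [(a, 1)] of a square, where it is a polynomial in [a]. *)
Lemma crs_sum_lower : (forall x, x != 0 -> exists k, crs x (Nk k *m x) != 0) ->
  exists2 c, 0 < c & forall x, c * nsq x ^+ 2 <= g x.
Proof.
move=> irr.
have g0 x : x != 0 -> 0 < g x.
  move=> /irr[k xk]; rewrite /g (bigD1 k)//= ltr_pwDl//.
    by rewrite lt_neqAle sqr_ge0 andbT eq_sym sqrf_eq0.
  by apply: sumr_ge0 => i _; exact: sqr_ge0.
pose p1 := \sum_k ((Nk k 1 0)%:P + (Nk k 1 1 - Nk k 0 0)%:P * 'X - (Nk k 0 1)%:P * 'X ^+ 2) ^+ 2.
pose p2 := \sum_k ((Nk k 1 0)%:P * 'X ^+ 2 + (Nk k 1 1 - Nk k 0 0)%:P * 'X - (Nk k 0 1)%:P) ^+ 2.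
have p1E a : p1.[a] = g (cv2 1 a).
  rewrite /p1 horner_sum; apply: eq_bigr => k _.
  by rewrite /crs !mulmx2 !cv2E0 !cv2E1 !hornerE/=; ring.
have p2E a : p2.[a] = g (cv2 a 1).
  rewrite /p2 horner_sum; apply: eq_bigr => k _.
  by rewrite /crs !mulmx2 !cv2E0 !cv2E1 !hornerE/=; ring.
have [|m1 m10 H1] := @poly_min_pos p1.
  move=> a; rewrite p1E g0//; apply/eqP => /colP/(_ 0) /eqP.
  by rewrite !mxE/= oner_eq0.
have [|m2 m20 H2] := @poly_min_pos p2.
  move=> a; rewrite p2E g0//; apply/eqP => /colP/(_ 1) /eqP.
  by rewrite !mxE/= oner_eq0.
have gZ t x : g (t *: x) = t ^+ 4 * g x.
  rewrite /g mulr_sumr; apply: eq_bigr => k _.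
  by rewrite /crs -scalemxAr !mxE; ring.
exists (Num.min m1 m2 / 4); first by rewrite divr_gt0// lt_min m10.
move=> x.
have mm : 0 < Num.min m1 m2 by rewrite lt_min m10.
have [x0|x0] := eqVneq x 0.
  by rewrite x0 /nsq !mxE !expr0n/= addr0 expr0n/= mulr0; apply: sumr_ge0 => k _; exact: sqr_ge0.
have sq4 (a : R) : `|a| <= 1 -> (1 + a ^+ 2) ^+ 2 <= 4.
  move=> a1; have a2 : a ^+ 2 <= 1 by rewrite -real_normK ?num_real// expr_le1.
  by have := sqr_ge0 a; nra.
case: (leP `|x 1 0| `|x 0 0|) => xx.
  have x00 : x 0 0 != 0.
    apply: contra_neq x0 => x00; rewrite x00 normr0 normr_le0 in xx.
    by apply: eq_cv2; rewrite mxE//; exact/eqP.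
  have a1 : `|x 1 0 / x 0 0| <= 1 by rewrite normf_div ler_pdivrMr ?normr_gt0// mul1r.
  have -> : x = x 0 0 *: cv2 1 (x 1 0 / x 0 0).
    by apply: eq_cv2; rewrite !mxE/= ?mulr1// mulrC divfK.
  rewrite gZ nsqZ exprMn -exprM mulrCA ler_wpM2l ?exprn_even_ge0//.
  have := H1 _ a1; rewrite p1E; apply: le_trans.
  rewrite /nsq cv2E0 cv2E1 expr1n.
  have : Num.min m1 m2 <= m1 by rewrite ge_min lexx.
  by have := sq4 _ a1; nra.
have x10 : x 1 0 != 0 by rewrite -normr_gt0; apply: le_lt_trans xx.
have a1 : `|x 0 0 / x 1 0| <= 1 by rewrite normf_div ler_pdivrMr ?normr_gt0// mul1r ltW.
have -> : x = x 1 0 *: cv2 (x 0 0 / x 1 0) 1.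
  by apply: eq_cv2; rewrite !mxE/= ?mulr1// mulrC divfK.
rewrite gZ nsqZ exprMn -exprM mulrCA ler_wpM2l ?exprn_even_ge0//.
have := H2 _ a1; rewrite p2E; apply: le_trans.
rewrite /nsq cv2E0 cv2E1 expr1n [_ + 1]addrC.
have : Num.min m1 m2 <= m2 by rewrite ge_min lexx orbT.
by have := sq4 _ a1; nra.
Qed.

Definition omx (o : option K) : 'M[R]_2 := if o is Some k then Nk k else 1%:M.

(** In the plane, a vector [x] and an image [N x] transverse to it span
    everything, so a vector [y] cannot be nearly orthogonal to both. *)
Lemma transversality : (forall x, x != 0 -> exists k, crs x (Nk k *m x) != 0) ->
  exists2 c, 0 < c & forall x y, exists o,
    c * (nsq x * nsq y) <= dot y (omx o *m x) ^+ 2.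
Proof.
move=> irr; have [c0 c00 gc] := crs_sum_lower irr.
pose M := 1 + \sum_k frob2 (Nk k).
have M1 : 1 <= M by rewrite lerDl sumr_ge0// => k _; exact: frob2_ge0.
have NM k x : nsq (Nk k *m x) <= M * nsq x.
  apply: le_trans (nsq_mul_frob _ _) _; rewrite ler_wpM2r ?nsq_ge0//.
  rewrite /M (bigD1 k)//= addrCA lerDl addr_ge0// sumr_ge0// => i _.
  exact: frob2_ge0.
pose k0 : R := #|K|%:R + 1.
have k00 : 0 < k0 by rewrite ltr_wpDl ?ler0n.
exists (c0 / k0 / (4 * M)); first by rewrite !divr_gt0// mulr_gt0//; lra.
move=> x y.
have [x0|x0] := eqVneq x 0.
  by exists None; rewrite x0 {1}/nsq !mxE expr0n/= addr0 mul0r mulr0 sqr_ge0.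
have nx := nsq_gt0 x0.
have [k kx] : exists k, c0 / k0 * nsq x ^+ 2 <= crs x (Nk k *m x) ^+ 2.
  apply: contrapT => no.
  have := gc x; apply/negP; rewrite -ltNge.
  apply: (@le_lt_trans _ _ (\sum_(k : K) c0 / k0 * nsq x ^+ 2)).
    apply: ler_sum => k _; rewrite leNgt; apply/negP => h; apply: no.
    by exists k; exact: ltW.
  rewrite sumr_const -[ltLHS]mulr_natr.
  have -> : c0 / k0 * nsq x ^+ 2 * #|K|%:R = (c0 * nsq x ^+ 2) * (#|K|%:R / k0) by ring.
  rewrite gtr_pMr; last by rewrite mulr_gt0// exprn_gt0.
  by rewrite ltr_pdivrMr// mul1r /k0 ltrDl.
set v := Nk k *m x in kx.
have id : nsq y * crs x v ^+ 2 =
    nsq (dot y x *: v - dot y v *: x).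
  by rewrite /nsq /crs /dot !mxE; ring.
have ub : nsq (dot y x *: v - dot y v *: x) <=
    2 * (dot y x ^+ 2 * nsq v + dot y v ^+ 2 * nsq x).
  rewrite -!nsqZ; set p := _ *: v; set q := _ *: x.
  rewrite /nsq [(p - q) 0 0]mxE [(p - q) 1 0]mxE [(- q) 0 0]mxE [(- q) 1 0]mxE.
  move: (p 0 0) (p 1 0) (q 0 0) (q 1 0) => a b c d.
  by have := sqr_ge0 (a + c); have := sqr_ge0 (b + d); lra.
have vM := NM k x; rewrite -/v in vM.
pose m := Num.max (dot y x ^+ 2) (dot y v ^+ 2).
have mx : dot y x ^+ 2 <= m by rewrite le_max lexx.
have mv : dot y v ^+ 2 <= m by rewrite le_max lexx orbT.
have key : c0 / k0 * nsq x * nsq y <= 4 * M * m.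
  have : nsq y * (c0 / k0 * nsq x ^+ 2) <= 4 * M * m * nsq x.
    apply: le_trans (ler_wpM2l (nsq_ge0 y) kx) _; rewrite id.
    apply: le_trans ub _.
    have m0 : 0 <= m := le_trans (sqr_ge0 _) mx.
    have h1 : dot y x ^+ 2 * nsq v <= m * (M * nsq x) by apply: ler_pM; rewrite ?sqr_ge0 ?nsq_ge0.
    have h2 : dot y v ^+ 2 * nsq x <= m * nsq x by rewrite ler_wpM2r// ltW.
    have h3 : m * nsq x <= m * (M * nsq x).
      by rewrite ler_wpM2l// ler_peMl// ltW.
    lra.
  have -> : nsq y * (c0 / k0 * nsq x ^+ 2) = c0 / k0 * nsq x * nsq y * nsq x by ring.
  by rewrite ler_pM2r.
have {}key : c0 / k0 / (4 * M) * (nsq x * nsq y) <= m.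
  have M40 : 0 < 4 * M by lra.
  by rewrite mulrAC ler_pdivrMr// [leRHS]mulrC mulrA.
move: key; rewrite /m le_max => /orP[] h; [exists None|exists (Some k)] => //.
by rewrite /omx mul1mx.
Qed.

End Transversality.

(** * Cones and cone-preserving products *)

Section Cones.
Variables (R : realType) (W : 'M[R]_2) (be : R).
Hypotheses (Wu : W \in unitmx) (be0 : 0 < be).

Lemma cv_lin (s t : R) (u v : 'cV[R]_2) i :
  (s *: u + t *: v) i 0 = s * u i 0 + t * v i 0.
Proof. by rewrite !mxE. Qed.

Lemma cv_scale (s : R) (u : 'cV[R]_2) i : (s *: u) i 0 = s * u i 0.
Proof. by rewrite mxE. Qed.

(** In the coordinates used below the first axis is the dominant eigenline of a
    hyperbolic product; these are a cone around it and its interior. *)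
Definition pcone (x : 'cV[R]_2) : Prop := 0 < x 0 0 /\ `|x 1 0| <= be * x 0 0.
Definition pcone_int (x : 'cV[R]_2) : Prop := 0 < x 0 0 /\ `|x 1 0| < be * x 0 0.

Definition coneW : set 'cV[R]_2 := [set x | pcone (W *m x)].

Lemma coordW_continuous i : continuous (fun x : 'cV[R]_2 => (W *m x) i 0).
Proof.
move=> x; rewrite (_ : (fun x => _) = fun x : 'cV[R]_2 => W i 0 * x 0 0 + W i 1 * x 1 0).
  have h j : (fun x : 'cV[R]_2 => W i j * x j 0) @ nbhs x --> W i j * x j 0.
    by apply: cvgMl_tmp; exact: (@coord_continuous R 2 1 j 0 x).
  exact: (cvgD (h 0) (h 1)).
by apply/funext => y; rewrite mulmx2.
Qed.

Lemma aperture_continuous :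
  continuous (fun x : 'cV[R]_2 => be * (W *m x) 0 0 - `|(W *m x) 1 0|).
Proof.
move=> x.
have h0 : (fun x : 'cV[R]_2 => be * (W *m x) 0 0) @ nbhs x --> be * (W *m x) 0 0.
  by apply: cvgMl_tmp; exact: (@coordW_continuous 0 x).
have h1 : (fun x : 'cV[R]_2 => `|(W *m x) 1 0|) @ nbhs x --> `|(W *m x) 1 0|.
  by apply: cvg_norm; exact: (@coordW_continuous 1 x).
exact: (cvgB h0 h1).
Qed.

Lemma coneW_int_open : open [set x | pcone_int (W *m x)].
Proof.
pose c i := fun x : 'cV[R]_2 => (W *m x) i 0.
have cc i : continuous (c i) by exact: coordW_continuous.
rewrite (_ : [set x | _] = (c 0 @^-1` [set t | 0 < t]) `&`
    ((fun x => be * c 0 x - `|c 1 x|) @^-1` [set t | 0 < t])).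
  apply: openI; apply: open_comp; try exact: open_gt.
    by move=> x _; exact: cc.
  by move=> x _; exact: aperture_continuous.
by apply/seteqP; split=> x /=; rewrite /pcone_int /c subr_gt0.
Qed.

Lemma coneW_interior x : pcone_int (W *m x) -> interior coneW x.
Proof.
move=> xW.
have := open_subsetE coneW coneW_int_open.
have sub : [set x | pcone_int (W *m x)] `<=` coneW.
  by move=> y [y0 y1]; split=> //; exact: ltW.
by rewrite propeqE => -[/(_ sub) + _]; apply.
Qed.

Lemma coneW_cone : cone coneW.
Proof.
split.
- move=> x y p; rewrite !inE => -[x0 x1] [y0 y1].
  change (pcone (W *m (p%:num *: (x : 'cV[R]_2) +
    unstable.onem p%:num *: (y : 'cV[R]_2)))).
  move: x y x0 x1 y0 y1 => /= x y x0 x1 y0 y1.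
  rewrite /pcone mulmxDr -!scalemxAr !cv_lin.
  move: x0 x1 y0 y1; move: ((W *m x) 0 0) ((W *m x) 1 0) ((W *m y) 0 0) ((W *m y) 1 0).
  move=> a b c d a0 b0 c0 d0.
  have p0 : 0 <= p%:num by [].
  have q0 : 0 <= unstable.onem p%:num by rewrite subr_ge0.
  have pq : p%:num + unstable.onem p%:num = 1 by rewrite /unstable.onem; ring.
  move: p0 q0 pq; move: (p%:num) (unstable.onem p%:num) => s t s0 t0 st.
  split.
    move: s0; rewrite le_eqVlt => /predU1P[s0|s0].
      have t1 : t = 1 by lra.
      rewrite -s0 t1 mul0r add0r mul1r.
      exact: c0.
    by rewrite ltr_pwDl ?mulr_gt0// mulr_ge0// ltW.
  apply: le_trans (ler_normD _ _) _; rewrite !normrM (ger0_norm s0) (ger0_norm t0).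
  by rewrite mulrDr; apply: lerD; rewrite mulrCA ler_wpM2l.
- move=> t x t0 [x0 x1]; rewrite /coneW/= /pcone -scalemxAr !cv_scale; split.
    by rewrite mulr_gt0.
  by rewrite normrM gtr0_norm// mulrCA ler_wpM2l// ltW.
- exists [set x | `|(W *m x) 1 0| <= be * (W *m x) 0 0].
    pose f (x : 'cV[R]_2) := be * (W *m x) 0 0 - `|(W *m x) 1 0|.
    rewrite (_ : [set x | _] = f @^-1` [set t | 0 <= t]).
      apply: closed_comp; last exact: closed_ge.
      by move=> x _; exact: aperture_continuous.
    by apply/seteqP; split=> x /=; rewrite /f subr_ge0.
  apply/seteqP; split=> x /=.
    move=> [x0 x1]; split=> // x00; move: x0; rewrite x00 mulmx0 mxE ltxx//.
  move=> [x1 x0]; split=> //.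
  have x00 : 0 <= (W *m x) 0 0 by rewrite -(pmulr_rge0 _ be0); apply: le_trans x1.
  rewrite lt_neqAle x00 andbT; apply/eqP => e; apply: x0.
  rewrite -[x]mul1mx -(mulVmx Wu) -mulmxA.
  have w1 : (W *m x) 1 0 = 0 by apply/eqP; rewrite -normr_le0; move: x1; rewrite -e mulr0.
  rewrite (_ : W *m x = 0) ?mulmx0//.
  by apply: eq_cv2; rewrite [RHS]mxE ?w1 -?e.
- exists (invmx W *m cv2 1 0); apply: coneW_interior.
  by rewrite mulKVmx// /pcone_int cv2E0 cv2E1 normr0 mulr1.
Qed.

(** [good Q] says that [Q] sends the cone, up to sign, into its interior, with
    the first coordinate controlled by the entry [Q 0 0]. *)
Definition good (Q : 'M[R]_2) : Prop :=
  [/\ Q 0 0 != 0, 2 * be * `|Q 0 1| <= `|Q 0 0| &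
      2 * (`|Q 1 0| + be * `|Q 1 1|) < be * `|Q 0 0|].

Lemma good_pos Q x : good Q -> 0 < Q 0 0 -> pcone x ->
  pcone_int (Q *m x) /\ Q 0 0 * x 0 0 <= 2 * (Q *m x) 0 0.
Proof.
move=> [_ q01 q1] q0 [x0 x1]; rewrite !(gtr0_norm q0) in q01 q1.
have h1 : `|Q 0 1 * x 1 0| * 2 <= Q 0 0 * x 0 0.
  rewrite normrM; apply: (@le_trans _ _ (2 * be * `|Q 0 1| * x 0 0)).
    have := ler_wpM2l (normr_ge0 (Q 0 1)) x1.
    by move: (`|Q 0 1|) (`|x 1 0|) (x 0 0) => a b c; lra.
  by rewrite ler_wpM2r// ltW.
have lb : Q 0 0 * x 0 0 <= 2 * (Q *m x) 0 0.
  rewrite mulmx2; move: h1; have := ler_norm (- (Q 0 1 * x 1 0)); rewrite normrN.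
  by move: (Q 0 1 * x 1 0) (Q 0 0 * x 0 0) => a b; lra.
have y0 : 0 < (Q *m x) 0 0.
  have : 0 < Q 0 0 * x 0 0 by exact: mulr_gt0.
  by move: lb; move: (Q 0 0 * x 0 0) ((Q *m x) 0 0) => a b; lra.
split=> //; split=> //.
have h2 : 2 * `|(Q *m x) 1 0| < be * (Q 0 0 * x 0 0).
  rewrite mulmx2; apply: (@le_lt_trans _ _ (2 * (`|Q 1 0| + be * `|Q 1 1|) * x 0 0)); last first.
    by rewrite mulrA ltr_pM2r.
  have := ler_normD (Q 1 0 * x 0 0) (Q 1 1 * x 1 0); rewrite !normrM (gtr0_norm x0).
  have := ler_wpM2l (normr_ge0 (Q 1 1)) x1.
  move: (`|Q 1 0 * x 0 0 + Q 1 1 * x 1 0|) => a.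
  move: (`|Q 1 0|) (`|Q 1 1|) (`|x 1 0|) (x 0 0) => b c d e.
  lra.
have := ler_wpM2l (ltW be0) lb.
move: h2; move: (`|(Q *m x) 1 0|) ((Q *m x) 0 0) (Q 0 0 * x 0 0) => a b c; lra.
Qed.

Lemma goodN Q : good Q -> good (- Q).
Proof. by move=> [q0 q1 q2]; split; rewrite !mxE ?oppr_eq0// !normrN. Qed.

Lemma good_pair Q Q' x : good Q -> good Q' -> 0 < Q 0 0 * Q' 0 0 -> pcone x ->
  pcone_int (Q' *m (Q *m x)) /\
  Q 0 0 * Q' 0 0 * x 0 0 <= 4 * (Q' *m (Q *m x)) 0 0.
Proof.
wlog q0 : Q Q' / 0 < Q 0 0.
  move=> H gQ gQ' qq px.
  have [q0|q0|q0] := ltrgt0P (Q 0 0); first exact: H.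
    have nq (P : 'M[R]_2) i j : (- P) i j = - P i j by rewrite mxE.
    have h : 0 < (- Q) 0 0 by rewrite nq oppr_gt0.
    have qq' : 0 < (- Q) 0 0 * (- Q') 0 0 by rewrite !nq mulrNN.
    have := H (- Q) (- Q') h (goodN gQ) (goodN gQ') qq' px.
    by rewrite !mulNmx mulmxN opprK !nq mulrNN.
  by move: gQ => [/eqP]; rewrite q0.
move=> gQ gQ' qq px; have q'0 : 0 < Q' 0 0 by rewrite pmulr_rgt0 in qq.
have [[y0 y1] yl] := good_pos gQ q0 px.
have py : pcone (Q *m x) by split=> //; exact: ltW.
have [zi zl] := good_pos gQ' q'0 py; split=> //.
have := ler_wpM2l (ltW q'0) yl; move: zl.
move: (Q 0 0) (Q' 0 0) (x 0 0) ((Q *m x) 0 0) ((Q' *m (Q *m x)) 0 0) => a b c d e.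
lra.
Qed.

(** The off-diagonal entries of [Q *m Q] are those of [Q] times its trace: this
    keeps them nonzero under squaring. *)
Lemma good_trace Q : good Q -> Q 0 0 + Q 1 1 != 0.
Proof.
move=> [q0 _ q1]; apply/eqP => /eqP; rewrite addr_eq0 => /eqP e.
have n10 := normr_ge0 (Q 1 0).
have : 2 * (be * `|Q 1 1|) < be * `|Q 0 0|.
  by apply: le_lt_trans q1; rewrite ler_pM2l// lerDr.
rewrite e normrN; have : 0 <= be * `|Q 1 1| by rewrite mulr_ge0// ltW.
by move: (be * _) => t; lra.
Qed.

End Cones.

(** * Connecting words *)

Section Blocks.
Variables (R : realType) (L : finType) (A : L -> 'M[R]_2) (W : 'M[R]_2).
Variables (z : seq L) (la mu : R).
Hypotheses (Au : forall a, A a \in unitmx) (Wu : W \in unitmx).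

(** Products in the coordinates given by [W], which later diagonalise [A_z]. *)
Definition Nw (w : seq L) : 'M[R]_2 := W *m wprod A w *m invmx W.

Lemma Nw_cat v w : Nw (v ++ w) = Nw w *m Nw v.
Proof. by rewrite /Nw wprod_cat !mulmxA mulmxKV. Qed.

Lemma Nw_nil : Nw [::] = 1%:M.
Proof. by rewrite /Nw wprod_nil mulmx1 mulmxV. Qed.

Lemma Nw_apply w (x : 'cV[R]_2) : W *m (wprod A w *m x) = Nw w *m (W *m x).
Proof. by rewrite /Nw !mulmxA mulmxKV. Qed.

Lemma Nw_unit w : Nw w \in unitmx.
Proof. by rewrite !unitmx_mul unitmx_inv Wu wprod_unit. Qed.

Definition diag2 (a b : R) : 'M[R]_2 :=
  \matrix_(i, j) (if i == j then (if i == 0 then a else b) else 0).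

Lemma diag2E00 a b : diag2 a b 0 0 = a. Proof. by rewrite mxE. Qed.
Lemma diag2E01 a b : diag2 a b 0 1 = 0. Proof. by rewrite mxE. Qed.
Lemma diag2E10 a b : diag2 a b 1 0 = 0. Proof. by rewrite mxE. Qed.
Lemma diag2E11 a b : diag2 a b 1 1 = b. Proof. by rewrite mxE. Qed.
Definition diag2E := (diag2E00, diag2E01, diag2E10, diag2E11).

Lemma diag2M a b c d : diag2 a b *m diag2 c d = diag2 (a * c) (b * d).
Proof.
by apply: eq_mx2; rewrite mulmx2 !diag2E; ring.
Qed.

Lemma mul_diag2l a b (M : 'M[R]_2) :
  [/\ (diag2 a b *m M) 0 0 = a * M 0 0, (diag2 a b *m M) 0 1 = a * M 0 1,
      (diag2 a b *m M) 1 0 = b * M 1 0 & (diag2 a b *m M) 1 1 = b * M 1 1].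
Proof. by split; rewrite mulmx2 !diag2E; ring. Qed.

Lemma mul_diag2r a b (M : 'M[R]_2) :
  [/\ (M *m diag2 a b) 0 0 = M 0 0 * a, (M *m diag2 a b) 0 1 = M 0 1 * b,
      (M *m diag2 a b) 1 0 = M 1 0 * a & (M *m diag2 a b) 1 1 = M 1 1 * b].
Proof. by split; rewrite mulmx2 !diag2E; ring. Qed.

Hypothesis Nz : Nw z = diag2 la mu.
Hypotheses (mu0 : 0 < `|mu|) (mula : `|mu| < `|la|).

Lemma la_gt0 : 0 < `|la|. Proof. exact: lt_trans mula. Qed.

Definition zpow (j : nat) : seq L := flatten (nseq j z).

Lemma size_zpow j : size (zpow j) = (j * size z)%N.
Proof. by elim: j => //= j IH; rewrite size_cat IH mulSn. Qed.

Lemma zpowD i j : zpow (i + j) = zpow i ++ zpow j.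
Proof. by rewrite /zpow nseqD flatten_cat. Qed.

Lemma Nw_zpow j : Nw (zpow j) = diag2 (la ^+ j) (mu ^+ j).
Proof.
elim: j => [|j IH]; last by rewrite /zpow /= Nw_cat IH Nz diag2M !exprSr.
by rewrite Nw_nil; apply: eq_mx2; rewrite diag2E mxE.
Qed.

Lemma ratio_pow_small (e : R) : 0 < e ->
  exists k, forall j, (k <= j)%N -> `|mu| ^+ j < e * `|la| ^+ j.
Proof.
move=> e0; have l0 := la_gt0.
have r1 : `|(`|mu| / `|la|)| < 1.
  by rewrite ger0_norm ?divr_ge0// ltr_pdivrMr// mul1r.
have := cvg_expr r1 => /cvgrPdist_lt/(_ _ e0)[k _ kP].
exists k => j /kP; rewrite sub0r normrN ger0_norm ?exprn_ge0 ?divr_ge0//.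
by rewrite /= expr_div_n ltr_pdivrMr// exprn_gt0.
Qed.

Definition cword (o : option ((size z).-tuple L)) : seq L :=
  if o is Some v then v else [::].

Definition onone T (o : option T) : nat := if o is Some _ then 0%N else 1%N.

Lemma onone_le T (o : option T) : (onone o <= 1)%N. Proof. by case: o. Qed.

(** The block around [w]; the power of [z] is padded so that its length does
    not depend on which connecting words are used. *)
Definition Qw k w o o' : seq L :=
  z ++ cword o ++ w ++ cword o' ++ zpow (k + onone o + onone o').

Lemma size_Qw k w o o' : size (Qw k w o o') = (size w + size z * (k + 3))%N.
Proof.
rewrite !size_cat size_zpow.
have cs o'' : (size (cword o'') + onone o'' * size z = size z)%N.
  by case: o'' => [v|]; rewrite /= ?size_tuple ?mul0n ?addn0 ?mul1n.
move: (cs o) (cs o').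
move: (size (cword o)) (size (cword o')) (onone o) (onone o') (size w) => a b e f n.
by move: (size z) => l; clear; nia.
Qed.

Hypothesis irr : forall x : 'cV[R]_2, x != 0 ->
  exists v : (size z).-tuple L, crs x (Nw v *m x) != 0.

Lemma frob2_mul (B C : 'M[R]_2) : frob2 (B *m C) <= frob2 B * frob2 C.
Proof.
have e (M : 'M[R]_2) : frob2 M = nsq (M *m cv2 1 0) + nsq (M *m cv2 0 1).
  by rewrite /frob2 /nsq !mulmx2 !cv2E0 !cv2E1; ring.
rewrite (e (B *m C)) (e C) mulrDr -!mulmxA.
by apply: lerD; apply: nsq_mul_frob.
Qed.

Lemma frob2_gt0 (B : 'M[R]_2) : B \in unitmx -> 0 < frob2 B.
Proof.
move=> /unit_det_gt0 d0; have /andP[l u] := frob2_detP B.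
rewrite lt_neqAle frob2_ge0 andbT eq_sym; apply/eqP => f0.
rewrite f0 oppr0 in l u.
have : \det B = 0 by lra.
by move=> dB; rewrite dB normr0 ltxx in d0.
Qed.

Lemma entry_le_frob (B : 'M[R]_2) i j : B i j ^+ 2 <= frob2 B.
Proof.
rewrite /frob2; have := sqr_ge0 (B 0 0); have := sqr_ge0 (B 0 1).
have := sqr_ge0 (B 1 0); have := sqr_ge0 (B 1 1).
by case: (ord2P i) => ->; case: (ord2P j) => ->; lra.
Qed.

Lemma big_row (B : 'M[R]_2) : exists i, frob2 B <= 2 * nsq (cv2 (B i 0) (B i 1)).
Proof.
rewrite /nsq /frob2.
have [h|h] := lerP (B 0 0 ^+ 2 + B 0 1 ^+ 2) (B 1 0 ^+ 2 + B 1 1 ^+ 2).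
  by exists 1; rewrite cv2E0 cv2E1; lra.
by exists 0; rewrite cv2E0 cv2E1; lra.
Qed.

(** Before [w], a connecting word moves the first axis away from the direction
    that [Nw w] shrinks most; after [w], another one gives the image a large
    first coordinate. Both exist by [transversality], with uniform constants. *)
Lemma connect_entry : exists2 c, 0 < c & exists2 C, 1 <= C &
  forall w, exists o o', let G := Nw (cword o') *m Nw w *m Nw (cword o) in
    c * frob2 (Nw w) <= G 0 0 ^+ 2 /\ forall i j, `|G i j| <= C * `|G 0 0|.
Proof.
have [c c0 cP] := transversality irr.
have omxE (o : option ((size z).-tuple L)) :
    omx (fun v : (size z).-tuple L => Nw v) o = Nw (cword o).
  by case: o => [v|] //=; rewrite Nw_nil.
pose M := 2 + \sum_(v : (size z).-tuple L) frob2 (Nw v).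
have M2 : 2 <= M by rewrite lerDl sumr_ge0// => v _; exact: frob2_ge0.
have cM o : frob2 (Nw (cword o)) <= M.
  case: o => [v|] /=.
    rewrite /M (bigD1 v)//= addrCA lerDl addr_ge0// sumr_ge0// => i _.
    exact: frob2_ge0.
  by rewrite Nw_nil; apply: le_trans M2; rewrite /frob2 !mxE/=; lra.
exists (c ^+ 2 / 2); first by rewrite divr_gt0// exprn_gt0.
pose C := 1 + 2 * M ^+ 2 / c ^+ 2.
have C1 : 1 <= C.
  rewrite lerDl divr_ge0 ?sqr_ge0// mulr_ge0 ?sqr_ge0//.
exists C => // w.
have [i iB] := big_row (Nw w).
have [ o ho] := cP (cv2 1 0) (cv2 (Nw w i 0) (Nw w i 1)).
move: ho; rewrite omxE; set x := Nw (cword o) *m cv2 1 0.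
have -> : dot (cv2 (Nw w i 0) (Nw w i 1)) x = (Nw w *m x) i 0.
  by rewrite /dot cv2E0 cv2E1 mulmx2.
have -> : nsq (cv2 1 0) = 1 :> R by rewrite /nsq cv2E0 cv2E1; ring.
rewrite mul1r => h1.
have h2 : c * frob2 (Nw w) <= 2 * nsq (Nw w *m x).
  have : (Nw w *m x) i 0 ^+ 2 <= nsq (Nw w *m x).
    by rewrite /nsq; case: (ord2P i) => ->; rewrite (lerDl, lerDr) sqr_ge0.
  have := ler_wpM2l (ltW c0) iB; move: h1.
  move: (nsq _) (nsq _) (_ ^+ 2) (frob2 _) => a b d e; lra.
have [ o' ho'] := cP (Nw w *m x) (cv2 1 0).
move: ho'; rewrite omxE; have -> : nsq (cv2 1 0) = 1 :> R by rewrite /nsq cv2E0 cv2E1; ring.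
have -> : dot (cv2 1 0) (Nw (cword o') *m (Nw w *m x)) =
    (Nw (cword o') *m Nw w *m Nw (cword o)) 0 0.
  have e1 (P : 'M[R]_2) : (P *m cv2 1 0) 0 0 = P 0 0.
    by rewrite mulmx2 cv2E0 cv2E1; ring.
  by rewrite /dot cv2E0 cv2E1 mul1r mul0r addr0 /x !mulmxA e1.
rewrite mulr1 => h3; exists o, o'; set G := _ *m Nw (cword o) => /=.
have h4 : c ^+ 2 / 2 * frob2 (Nw w) <= G 0 0 ^+ 2.
  apply: le_trans h3; have := ler_wpM2l (ltW c0) h2.
  by move: (nsq _) (frob2 _) => a b; lra.
split=> // i' j'.
have FG : frob2 G <= M ^+ 2 * frob2 (Nw w).
  apply: le_trans (frob2_mul _ _) _.
  apply: (@le_trans _ _ (M * frob2 (Nw w) * M)); last first.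
    by rewrite le_eqVlt; apply/orP; left; apply/eqP; ring.
  apply: ler_pM; rewrite ?frob2_ge0//.
  apply: le_trans (frob2_mul _ _) _.
  by apply: ler_wpM2r; rewrite ?frob2_ge0.
have GG : G i' j' ^+ 2 <= (C * `|G 0 0|) ^+ 2.
  apply: le_trans (entry_le_frob _ _ _) _; apply: le_trans FG _.
  rewrite exprMn real_normK ?num_real//.
  apply: (@le_trans _ _ (C * G 0 0 ^+ 2)); last first.
    by rewrite ler_wpM2r ?sqr_ge0// ler_eXnr.
  apply: (@le_trans _ _ (2 * M ^+ 2 / c ^+ 2 * G 0 0 ^+ 2)); last first.
    by rewrite ler_wpM2r ?sqr_ge0// /C lerDr.
  have -> : M ^+ 2 * frob2 (Nw w) = 2 * M ^+ 2 / c ^+ 2 * (c ^+ 2 / 2 * frob2 (Nw w)).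
    by field; rewrite gt_eqF.
  apply: ler_wpM2l => //; rewrite divr_ge0 ?sqr_ge0// mulr_ge0 ?sqr_ge0//.
by rewrite -[leRHS]ger0_norm ?mulr_ge0//; [rewrite -ler_sqr ?nnegrE// !real_normK ?num_real|lra].
Qed.

(** Every word becomes, between suitable connecting words and a fixed power of
    [z], a product that sends a fixed cone into its interior up to sign: the
    connecting words keep the image of the cone away from the second eigenline,
    and the power of [z] then pushes it towards the first one. *)
Lemma block_good : exists be c k, [/\ 0 < be, 0 < c &
  forall w, exists o o', good be (Nw (Qw k w o o')) /\
    c * frob2 (Nw w) <= Nw (Qw k w o o') 0 0 ^+ 2].
Proof.
have [c c0 [C C1 cP]] := connect_entry.
have C0 : 0 < C by lra.
pose be := (2 * C)^-1.
have be0 : 0 < be by rewrite invr_gt0; lra.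
have be1 : be <= 1 by rewrite /be invf_le1; lra.
have e0 : 0 < be / (4 * C) by rewrite divr_gt0//; lra.
have [k kP] := ratio_pow_small e0.
pose a := Num.min 1 (la ^+ 2).
have la20 : 0 < la ^+ 2 by rewrite -real_normK ?num_real// exprn_gt0// la_gt0.
have a0 : 0 < a by rewrite lt_min ltr01.
exists be, (a ^+ (k + 3) * c), k; split=> //; first by rewrite mulr_gt0// exprn_gt0.
move=> w; have [ o [ o' oo']] := cP w; exists o, o'; move: oo'.
set G := _ *m Nw (cword o) => /= -[h1 h2].
set j := (k + onone o + onone o')%N.
have QE : Nw (Qw k w o o') = diag2 (la ^+ j) (mu ^+ j) *m (G *m diag2 la mu).
  by rewrite /Qw !Nw_cat Nw_zpow Nz /G !mulmxA.
have [Q00 Q01 Q10 Q11] := mul_diag2l (la ^+ j) (mu ^+ j) (G *m diag2 la mu).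
have [G00 G01 G10 G11] := mul_diag2r la mu G.
rewrite -QE G00 in Q00; rewrite -QE G01 in Q01.
rewrite -QE G10 in Q10; rewrite -QE G11 in Q11.
have g0 : 0 < `|G 0 0|.
  rewrite normr_gt0 -sqrf_eq0 gt_eqF//; apply: lt_le_trans h1.
  by rewrite mulr_gt0// frob2_gt0// Nw_unit.
have l0 := la_gt0; have lj : 0 < `|la| ^+ j by rewrite exprn_gt0.
have mj : `|mu| ^+ j < be / (4 * C) * `|la| ^+ j.
  by apply: kP; rewrite /j -addnA leq_addr.
split.
  rewrite /good Q00 Q01 Q10 Q11 !normrM !normrX; split.
  - by rewrite -normr_gt0 !normrM normrX !mulr_gt0.
  - have -> : 2 * be = C^-1 by rewrite /be; field; rewrite gt_eqF.
    rewrite mulrCA ler_wpM2l ?(ltW lj)// mulrA ler_pM//; last exact: ltW.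
      by rewrite mulr_ge0// invr_ge0 ltW.
    by rewrite ler_pdivrMl.
  - have m1 : `|mu| ^+ j * (`|G 1 0| * `|la|) <= `|mu| ^+ j * (C * `|G 0 0| * `|la|).
      by rewrite ler_wpM2l ?exprn_ge0// ler_wpM2r.
    have m2 : be * (`|mu| ^+ j * (`|G 1 1| * `|mu|)) <= `|mu| ^+ j * (C * `|G 0 0| * `|la|).
      have s1 : 0 <= `|mu| ^+ j by rewrite exprn_ge0.
      have s2 : `|G 1 1| * `|mu| <= C * `|G 0 0| * `|la| by apply: ler_pM => //; exact: ltW.
      apply: le_trans (ler_wpM2l s1 s2).
      by apply: ler_piMl => //; apply: mulr_ge0 => //; exact: mulr_ge0.
    have m3 : `|mu| ^+ j * (C * `|G 0 0| * `|la|) <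
        be / (4 * C) * `|la| ^+ j * (C * `|G 0 0| * `|la|).
      by rewrite ltr_pM2r// !mulr_gt0.
    have e : be / (4 * C) * `|la| ^+ j * (C * `|G 0 0| * `|la|) =
        be * (`|la| ^+ j * (`|G 0 0| * `|la|)) / 4.
      by field; rewrite gt_eqF.
    rewrite e in m3; move: m1 m2 m3.
    move: (`|mu| ^+ j * (`|G 1 0| * `|la|)) (be * (`|mu| ^+ j * (`|G 1 1| * `|mu|))).
    move: (`|mu| ^+ j * _) (be * _) => p q r s; lra.
rewrite Q00.
have aj : a ^+ (k + 3) <= (la ^+ j) ^+ 2 * la ^+ 2.
  rewrite -exprM mulnC exprM -exprSr.
  apply: (@le_trans _ _ (a ^+ j.+1)).
    apply: ler_wiXn2l; first exact: ltW.
      by rewrite ge_min lexx.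
    by rewrite /j -addnA -addnS leq_add2l ltnS (leq_add (onone_le o) (onone_le o')).
  apply: lerXn2r; rewrite ?nnegrE ?(ltW a0) ?(ltW la20)//.
  by rewrite ge_min lexx orbT.
have -> : (la ^+ j * (G 0 0 * la)) ^+ 2 = (la ^+ j) ^+ 2 * la ^+ 2 * G 0 0 ^+ 2 by ring.
rewrite -mulrA; apply: ler_pM => //; first by rewrite exprn_ge0// ltW.
by rewrite mulr_ge0// ?frob2_ge0// ltW.
Qed.

End Blocks.

(** * Irreducibility of iterates *)

Section Eigenbasis.
Variable R : realType.

Lemma crs0 (x y : 'cV[R]_2) : x != 0 -> crs x y = 0 -> exists c, y = c *: x.
Proof.
move=> x0 xy; have n0 := nsq_gt0 x0; exists (dot x y / nsq x).
have nx : nsq x != 0 by rewrite gt_eqF.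
move: xy; rewrite /crs => xy.
apply: eq_cv2; rewrite mxE; apply: (mulIf nx); rewrite mulrAC divfK// /nsq /dot;
  move: xy; move: (x 0 0) (x 1 0) (y 0 0) (y 1 0) => a b c d xy;
  apply/eqP; rewrite -subr_eq0; apply/eqP.
- by transitivity (- b * (a * d - b * c)); [ring | rewrite xy mulr0].
- by transitivity (a * (a * d - b * c)); [ring | rewrite xy mulr0].
Qed.

Lemma crsZ (x : 'cV[R]_2) c : crs x (c *: x) = 0.
Proof. by rewrite /crs !mxE; ring. Qed.

Lemma crs_mul (W : 'M[R]_2) x y : crs (W *m x) (W *m y) = \det W * crs x y.
Proof. by rewrite /crs !mulmx2 det2; ring. Qed.

Lemma hyperbolic_diag (H : 'M[R]_2) : H \in unitmx -> hyperbolic H ->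
  exists W a b, [/\ W \in unitmx, W *m H *m invmx W = diag2 a b, 0 < `|b| & `|b| < `|a|].
Proof.
move=> Hu [a0 [b0 [ea0 eb0 ab0]]].
have [a [b [ea eb ab]]] : exists a b, [/\ eigenvalue H a, eigenvalue H b & `|b| < `|a|].
  have [h|h|h] := ltrgtP `|a0| `|b0|; [by exists b0, a0|by exists a0, b0|].
  by rewrite h eqxx in ab0.
have /eigenvalueP[v vH v0] := ea; have /eigenvalueP[u uH u0] := eb.
have b00 : 0 < `|b|.
  rewrite normr_gt0; apply: contra_neq u0 => b00.
  by rewrite -[u]mulmx1 -(mulmxV Hu) mulmxA uH b00 scale0r mul0mx.
pose W : 'M[R]_2 := \matrix_(i, j) (if i == 0 then v 0 j else u 0 j).
have WH : W *m H = diag2 a b *m W.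
  have ve j : v 0 0 * H 0 j + v 0 1 * H 1 j = a * v 0 j.
    by rewrite -mulmx2 vH mxE.
  have ue j : u 0 0 * H 0 j + u 0 1 * H 1 j = b * u 0 j.
    by rewrite -mulmx2 uH mxE.
  by apply: eq_mx2; rewrite !mulmx2 !diag2E !mxE/= (ve, ue); ring.
have Wu : W \in unitmx.
  rewrite unitmxE unitfE det2 !mxE/=; apply/eqP => d0.
  have : crs v^T u^T = 0 by rewrite /crs !mxE; move: d0; lra.
  have vT0 : v^T != 0 by rewrite -(trmx0 R 1 2) (inj_eq trmx_inj).
  move=> /(crs0 vT0)[c] /(congr1 trmx); rewrite linearZ/= !trmxK => uc.
  have : (a - b) *: u = 0.
    rewrite scalerBl -uH uc -scalemxAl vH !scalerA [a * c]mulrC subrr//.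
  move/eqP; rewrite scaler_eq0 (negPf u0) orbF subr_eq0 => /eqP e.
  by rewrite e ltxx in ab.
by exists W, a, b; split=> //; rewrite WH mulmxK.
Qed.

Lemma normX_inj (a b : R) n : (0 < n)%N -> `|b| < `|a| -> a ^+ n != b ^+ n.
Proof.
move=> n0 ab; apply/eqP => /(congr1 Num.norm); rewrite !normrX => e.
by have := ltrXn2r n (normr_ge0 b) ab; rewrite e ltxx -lt0n n0.
Qed.

End Eigenbasis.

Section LevelIrreducibility.
Variables (R : realType) (L : finType) (A : L -> 'M[R]_2).
Hypothesis Au : forall a, A a \in unitmx.

(** The powers of a hyperbolic matrix have distinct eigenvalues, hence no
    eigenlines besides those of the matrix itself. *)
Lemma eigenline_of_power (H : 'M[R]_2) n (x : 'cV[R]_2) : (0 < n)%N -> x != 0 ->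
  H \in unitmx -> hyperbolic H -> crs x (iter n (mulmx H) x) = 0 ->
  exists2 t, t != 0 & H *m x = t *: x.
Proof.
move=> n0 x0 Hu hyp xn.
have [W [a [b [Wu WD b0 ba]]]] := hyperbolic_diag Hu hyp.
pose y := W *m x.
have WH u : W *m (H *m u) = diag2 a b *m (W *m u).
  by rewrite -WD !mulmxA mulmxKV.
have Wn m : W *m iter m (mulmx H) x = cv2 (a ^+ m * y 0 0) (b ^+ m * y 1 0).
  elim: m => [|m IH]; first by rewrite !expr0 !mul1r -cv2_eta.
  rewrite iterS WH IH; apply: eq_cv2; rewrite mulmx2 !diag2E !cv2E0 !cv2E1 !exprS; ring.
have /eqP : crs y (W *m iter n (mulmx H) x) = 0 by rewrite crs_mul xn mulr0.
rewrite Wn /crs cv2E0 cv2E1.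
have -> : y 0 0 * (b ^+ n * y 1 0) - y 1 0 * (a ^+ n * y 0 0) =
  (y 0 0 * y 1 0) * (b ^+ n - a ^+ n) by ring.
have ba0 : b ^+ n - a ^+ n != 0 by rewrite subr_eq0 eq_sym; exact: normX_inj.
rewrite mulf_eq0 (negPf ba0) orbF mulf_eq0.
have xE : x = invmx W *m y by rewrite /y mulKmx.
have Hx t : diag2 a b *m y = t *: y -> H *m x = t *: x.
  by move=> e; rewrite -[H *m x](mulKmx Wu) WH e -scalemxAr -xE.
have a0 : 0 < `|a| by exact: lt_trans ba.
case/orP => /eqP y0; [exists b|exists a]; rewrite -?normr_gt0//;
  by apply: Hx; apply: eq_cv2; rewrite mulmx2 !diag2E cv_scale y0; ring.
Qed.

(** A line fixed by all words of length [l] is an eigenline of the hyperbolic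
    letter, and then letting that letter act first shows it is fixed by every
    letter. *)
Lemma level_irreducible l : (0 < l)%N -> ~ has_invariant_line A ->
  (exists i, hyperbolic (A i)) ->
  forall x : 'cV[R]_2, x != 0 -> exists v : l.-tuple L, crs x (wprod A v *m x) != 0.
Proof.
move=> l0 irr [i0 hyp] x x0; apply: contrapT => no; apply: irr.
have fix_l (w : seq L) : size w = l -> crs x (wprod A w *m x) = 0.
  move=> wl; apply: contrapT => /eqP h; apply: no.
  by have t : size w == l by [rewrite wl]; exists (Tuple t).
have itE n : wprod A (nseq n i0) *m x = iter n (mulmx (A i0)) x.
  elim: n => [|n IH]; first by rewrite wprod_nil mul1mx.
  have -> : nseq n.+1 i0 = nseq n i0 ++ [:: i0] by rewrite -[n.+1]addn1 nseqD.
  by rewrite wprod_cat wprod_seq1 -mulmxA IH.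
have [t t0 tx] : exists2 t, t != 0 & A i0 *m x = t *: x.
  apply: (eigenline_of_power l0 x0 (Au i0) hyp).
  by rewrite -itE fix_l// size_nseq.
have itx n : iter n (mulmx (A i0)) x = t ^+ n *: x.
  elim: n => [|n IH]; first by rewrite expr0 scale1r.
  by rewrite iterS IH -scalemxAr tx scalerA exprSr.
have fix1 i : crs x (A i *m x) = 0.
  have : crs x (wprod A (nseq l.-1 i0 ++ [:: i]) *m x) = 0.
    by apply: fix_l; rewrite size_cat size_nseq addn1 prednK.
  rewrite wprod_cat wprod_seq1 -mulmxA itE itx -scalemxAr.
  rewrite (_ : crs x (t ^+ l.-1 *: (A i *m x)) = t ^+ l.-1 * crs x (A i *m x)).
    by move=> /eqP; rewrite mulf_eq0 expf_eq0 (negPf t0) andbF => /eqP.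
  by rewrite /crs !cv_scale; ring.
exists <[x]>%VS; split; first by rewrite dim_vline x0.
move=> a y /vlineP[c ->]; rewrite -scalemxAr.
have [d ->] := crs0 x0 (fix1 a).
by rewrite memvZ// memvZ// memv_line.
Qed.

(** If every word of length [l] sent each of two lines into their union, the
    images of these lines under shorter words would be permuted by the letters. *)
Lemma level_strongly_irreducible l (e f : 'cV[R]_2) : (0 < l)%N ->
  e != 0 -> f != 0 -> strongly_irreducible A ->
  exists v : l.-tuple L, exists2 u, u = e \/ u = f &
    crs e (wprod A v *m u) != 0 /\ crs f (wprod A v *m u) != 0.
Proof.
move=> l0 e0 f0 sirr; apply: contrapT => no; apply: sirr.
have fix_l (w : seq L) u : size w = l -> u \in [:: e; f] ->
    exists2 u', u' \in [:: e; f] & exists c, wprod A w *m u = c *: u'.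
  move=> wl uef; apply: contrapT => h; apply: no.
  have t : size w == l by rewrite wl.
  exists (Tuple t), u; first by move: uef; rewrite !inE => /orP[] /eqP; [left|right].
  split; apply/eqP => c0; apply: h.
    by exists e; rewrite ?inE ?eqxx//; exact: crs0.
  by exists f; rewrite ?inE ?eqxx ?orbT//; exact: crs0.
pose words : seq (seq L) :=
  flatten [seq [seq (val t : seq L) | t <- enum {: j.-tuple L}] | j <- iota 0 l].
have wordsP w : (w \in words) = (size w < l)%N.
  apply/flatten_mapP/idP => [[j]|wl].
    by rewrite mem_iota add0n => jl /mapP[t _ ->]; rewrite size_tuple.
  exists (size w); first by rewrite mem_iota add0n.
  by apply/mapP; exists (in_tuple w); rewrite ?mem_enum.
pose Vs : seq {vspace 'cV[R]_2} := [seq <[wprod A w *m u]>%VS | w <- words, u <- [:: e; f]].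
have inVs w u : (size w < l)%N -> u \in [:: e; f] -> <[wprod A w *m u]>%VS \in Vs.
  by move=> wl uef; apply/allpairsP; exists (w, u); rewrite /= wordsP.
exists Vs; split.
- apply/eqP => h; have := inVs [::] e l0; rewrite h inE eqxx => /(_ isT).
  by [].
- move=> V /allpairsP[[w u] /= [_ uef ->]]; rewrite dim_vline.
  suff -> : wprod A w *m u != 0 by [].
  have u0 : u != 0 by move: uef; rewrite !inE => /orP[] /eqP ->.
  apply: contra_neq u0 => h.
  by rewrite -[u](mulKmx (wprod_unit Au w)) h mulmx0.
- move=> a _ [x [V /allpairsP[[w u] /= [wl uef ->]] /vlineP[c ->]] <-].
  rewrite -scalemxAr mulmxA.
  have -> : A a *m wprod A w = wprod A (rcons w a).
    by rewrite -cats1 wprod_cat wprod_seq1.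
  rewrite wordsP in wl.
  have [wl'|wl'] := ltnP (size w).+1 l.
    exists <[wprod A (rcons w a) *m u]>%VS; last by rewrite memvZ// memv_line.
    by apply: inVs => //; rewrite size_rcons.
  have [u' uef' [d ->]] : exists2 u', u' \in [:: e; f] & exists c, wprod A (rcons w a) *m u = c *: u'.
    by apply: fix_l => //; rewrite size_rcons; apply/eqP; rewrite eqn_leq wl wl'.
  exists <[wprod A [::] *m u']>%VS.
    exact: inVs.
  by rewrite wprod_nil mul1mx memvZ// memvZ// memv_line.
Qed.

End LevelIrreducibility.

Section PivotWords.
Variables (R : realType) (L : finType) (A : L -> 'M[R]_2) (W : 'M[R]_2).
Variables (z : seq L) (la mu be : R).
Hypotheses (Au : forall a, A a \in unitmx) (Wu : W \in unitmx).
Hypothesis Nz : Nw A W z = diag2 la mu.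
Hypotheses (mu0 : 0 < `|mu|) (mula : `|mu| < `|la|) (be0 : 0 < be).
Hypothesis z0 : (0 < size z)%N.
Hypothesis irr : forall x : 'cV[R]_2, x != 0 ->
  exists v : (size z).-tuple L, crs x (Nw A W v *m x) != 0.

Local Notation N := (Nw A W).

Lemma Nw_cat2 p q i j : N (p ++ q) i j = N q i 0 * N p 0 j + N q i 1 * N p 1 j.
Proof. by rewrite Nw_cat// mulmx2. Qed.

Lemma sandwichE a b v : let Q := N (zpow z a ++ v ++ zpow z b) in
  [/\ Q 0 0 = la ^+ b * (N v 0 0 * la ^+ a), Q 0 1 = la ^+ b * (N v 0 1 * mu ^+ a),
      Q 1 0 = mu ^+ b * (N v 1 0 * la ^+ a) & Q 1 1 = mu ^+ b * (N v 1 1 * mu ^+ a)].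
Proof.
rewrite /= !Nw_cat// !(Nw_zpow Wu Nz) -mulmxA.
have [-> -> -> ->] := mul_diag2l (la ^+ b) (mu ^+ b) (N v *m diag2 (la ^+ a) (mu ^+ a)).
by have [-> -> -> ->] := mul_diag2r (la ^+ a) (mu ^+ a) (N v).
Qed.

Lemma la_neq0 : la != 0. Proof. by rewrite -normr_gt0; exact: lt_trans mula. Qed.
Lemma mu_neq0 : mu != 0. Proof. by rewrite -normr_gt0. Qed.

(** Multiplying by powers of [A_z] on both sides lets the pivot entry, scaled by
    the dominant eigenvalue, outgrow the three others. *)
Lemma sandwich_good v : N v 0 0 != 0 -> exists a1, forall a b,
  (a1 <= a)%N -> (a1 <= b)%N -> good be (N (zpow z a ++ v ++ zpow z b)).
Proof.
move=> v0; have v00 : 0 < `|N v 0 0| by rewrite normr_gt0.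
pose d1 := 2 * be * `|N v 0 1| + 1.
pose d2 := 2 * (`|N v 1 0| + be * `|N v 1 1|) + 1.
have d10 : 0 < d1 by rewrite ltr_wpDl// !mulr_ge0// ltW.
have d20 : 0 < d2 by rewrite ltr_wpDl// mulr_ge0// addr_ge0// mulr_ge0// ltW.
pose e := Num.min (`|N v 0 0| / d1) (be * `|N v 0 0| / d2).
have e0 : 0 < e by rewrite lt_min !divr_gt0// mulr_gt0.
have e1 : 2 * be * `|N v 0 1| * e <= `|N v 0 0|.
  have : e <= `|N v 0 0| / d1 by rewrite ge_min lexx.
  rewrite ler_pdivlMr// => h; apply: le_trans h; rewrite /d1 mulrC ler_wpM2l ?(ltW e0)//.
  by rewrite lerDl.
have e2 : 2 * (`|N v 1 0| + be * `|N v 1 1|) * e < be * `|N v 0 0|.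
  have : e <= be * `|N v 0 0| / d2 by rewrite ge_min lexx orbT.
  rewrite ler_pdivlMr// => h; apply: lt_le_trans h; rewrite /d2 mulrC ltr_pM2l//.
  by rewrite ltrDl.
have [k kP] := ratio_pow_small mu0 mula e0.
exists k => a b ka kb; have [Q00 Q01 Q10 Q11] := sandwichE a b v.
have l0 : 0 < `|la| by exact: lt_trans mula.
have la0 : 0 < `|la| ^+ a by rewrite exprn_gt0.
have lb0 : 0 < `|la| ^+ b by rewrite exprn_gt0.
have ma := ltW (kP a ka); have mb := ltW (kP b kb).
have mal : `|mu| ^+ a <= `|la| ^+ a by rewrite lerXn2r ?nnegrE// ltW.
rewrite /good Q00 Q01 Q10 Q11 !normrM !normrX.
have ma0 : 0 <= `|mu| ^+ a by rewrite exprn_ge0.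
have mb0 : 0 <= `|mu| ^+ b by rewrite exprn_ge0.
split.
- by rewrite !mulf_neq0// expf_neq0// la_neq0.
- move: v00 e1 ma la0 lb0 ma0 (normr_ge0 (N v 0 1)).
  move: (`|N v 0 0|) (`|N v 0 1|) (`|la| ^+ a) (`|la| ^+ b) (`|mu| ^+ a).
  move=> x y p q r x0 xy rp p0 q0 r0 y0.
  have h1 : y * r <= y * (e * p) by rewrite ler_wpM2l.
  have h2 : 2 * be * q * (y * r) <= 2 * be * q * (y * (e * p)).
    by rewrite ler_wpM2l// !mulr_ge0// ltW.
  have h3 : 2 * be * y * e * (p * q) <= x * (p * q) by rewrite ler_wpM2r// mulr_ge0// ltW.
  lra.
- move: v00 e2 ma mb mal la0 lb0 ma0 mb0 (normr_ge0 (N v 1 0)) (normr_ge0 (N v 1 1)).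
  move: (`|N v 0 0|) (`|N v 1 0|) (`|N v 1 1|) (`|la| ^+ a) (`|la| ^+ b).
  move: (`|mu| ^+ a) (`|mu| ^+ b).
  move=> r s x y w p q x0 xy rp sq rp' p0 q0 r0 s0 y0 w0.
  have h1 : s * p <= e * q * p by rewrite ler_wpM2r// ltW.
  have h2 : s * r <= e * q * p by apply: ler_pM.
  have h3 : 2 * (y + be * w) * e * (p * q) < be * x * (p * q) by rewrite ltr_pM2r// mulr_gt0.
  have h4 : y * (s * p) <= y * (e * q * p) by rewrite ler_wpM2l.
  have h5 : be * w * (s * r) <= be * w * (e * q * p).
    by rewrite ler_wpM2l// mulr_ge0// ltW.
  lra.
Qed.

Lemma pivot_block v : (size z %| size v)%N -> N v 0 0 != 0 -> exists m0, forall m,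
  (m0 <= m)%N -> exists q, [/\ size q = (size z * m)%N, prefix z q, good be (N q),
    N v 1 0 != 0 -> N q 1 0 != 0 & N v 0 1 != 0 -> N q 0 1 != 0].
Proof.
move=> /dvdnP[s sv] v0; have [a1 a1P] := sandwich_good v0.
exists (a1.+1 + s + a1)%N => m mm.
have [Q00 Q01 Q10 Q11] := sandwichE a1.+1 (m - a1.+1 - s) v.
exists (zpow z a1.+1 ++ v ++ zpow z (m - a1.+1 - s)); split.
- have e : m = (a1.+1 + (s + (m - a1.+1 - s)))%N by move: mm; clear; lia.
  by rewrite !size_cat !size_zpow sv [in RHS]e [RHS]mulnC !mulnDl.
- by rewrite /zpow /= -catA prefix_prefix.
- by apply: a1P => //; move: mm; clear; lia.
- by move=> h; rewrite Q10 !mulf_neq0// expf_neq0// ?la_neq0 ?mu_neq0.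
- by move=> h; rewrite Q01 !mulf_neq0// expf_neq0// ?la_neq0 ?mu_neq0.
Qed.

(** Strong irreducibility forbids the union of the two eigenlines of [A_z] from
    being invariant; a word that breaks it, combined with a word moving each
    line separately, has the nonzero entries needed below. *)
Lemma pivot_words : strongly_irreducible A -> exists v v',
  [/\ (size z %| size v)%N, N v 0 0 != 0 & N v 1 0 != 0] /\
  [/\ (size z %| size v')%N, N v' 0 0 != 0 & N v' 0 1 != 0].
Proof.
move=> sirr.
have e1n0 : cv2 1 0 != 0 :> 'cV[R]_2.
  by apply/eqP => /colP/(_ 0); rewrite !mxE/= => /eqP; rewrite oner_eq0.
have e2n0 : cv2 0 1 != 0 :> 'cV[R]_2.
  by apply/eqP => /colP/(_ 1); rewrite !mxE/= => /eqP; rewrite oner_eq0.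
have Wi (x : 'cV[R]_2) : x != 0 -> invmx W *m x != 0.
  by apply: contra_neq => h; rewrite -[x](mulKVmx Wu) h mulmx0.
have [i1 i1P] := irr e1n0; have [i2 i2P] := irr e2n0.
have c1 (y : 'cV[R]_2) : crs (cv2 1 0) y = y 1 0.
  by rewrite /crs cv2E0 cv2E1; ring.
have c2 (y : 'cV[R]_2) : crs (cv2 0 1) y = - y 0 0.
  by rewrite /crs cv2E0 cv2E1; ring.
have m1 (M : 'M[R]_2) j : (M *m cv2 1 0) j 0 = M j 0.
  by rewrite mulmx2 cv2E0 cv2E1; ring.
have m2 (M : 'M[R]_2) j : (M *m cv2 0 1) j 0 = M j 1.
  by rewrite mulmx2 cv2E0 cv2E1; ring.
rewrite c1 m1 in i1P; rewrite c2 m2 oppr_eq0 in i2P.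
have det0 v : N v 0 0 * N v 1 1 - N v 0 1 * N v 1 0 != 0.
  by rewrite -det2 -unitfE -unitmxE Nw_unit.
have [j [u uef [ju1 ju2]]] :=
  level_strongly_irreducible Au z0 (Wi _ e1n0) (Wi _ e2n0) sirr.
have cW (x y : 'cV[R]_2) : crs x y != 0 -> crs (W *m x) (W *m y) != 0.
  by move=> h; rewrite crs_mul mulf_neq0// -unitfE -unitmxE.
have {}ju1 := cW _ _ ju1; have {}ju2 := cW _ _ ju2.
rewrite mulKVmx// Nw_apply// c1 in ju1; rewrite mulKVmx// Nw_apply// c2 oppr_eq0 in ju2.
have jcol : (N j 0 0 != 0 /\ N j 1 0 != 0) \/ (N j 0 1 != 0 /\ N j 1 1 != 0).
  by case: uef ju1 ju2 => ->; rewrite mulKVmx// ?m1 ?m2; [left|right].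
have [v [lv v00 v10]] : exists v, [/\ (size z %| size v)%N, N v 0 0 != 0 & N v 1 0 != 0].
  case: jcol => [[j0 j1]|[j0 j1]]; first by exists j; rewrite size_tuple dvdnn.
  have [i0|i0] := eqVneq (N i1 0 0) 0; last by exists i1; rewrite size_tuple dvdnn.
  exists (i1 ++ j); rewrite size_cat !size_tuple dvdn_add// !Nw_cat2 i0 !mulr0 !add0r.
  by rewrite !mulf_neq0.
exists v.
suff [v' h] : exists v', [/\ (size z %| size v')%N, N v' 0 0 != 0 & N v' 0 1 != 0] by exists v'.
have [i0|i0] := eqVneq (N i2 0 0) 0; last by exists i2; rewrite size_tuple dvdnn.
have [v01|v01] := eqVneq (N v 0 1) 0; last by exists v.
have v11 : N v 1 1 != 0.
  by have := det0 v; rewrite v01 mul0r subr0 mulf_eq0 negb_or => /andP[].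
exists (v ++ i2); rewrite size_cat size_tuple dvdn_addl// !Nw_cat2 i0 !mul0r !add0r.
by rewrite !mulf_neq0.
Qed.

Definition cone_word (g : seq L) : Prop :=
  forall x, pcone be x -> pcone_int be (N g *m x).

Lemma good_cat_cone q q' : good be (N q) -> good be (N q') ->
  0 < N q 0 0 * N q' 0 0 -> cone_word (q ++ q').
Proof.
move=> gq gq' qq x px; rewrite Nw_cat// -mulmxA.
by have [] := good_pair be0 gq gq' qq px.
Qed.

Lemma line_crs (V : {vspace 'cV[R]_2}) x y : \dim V = 1%N -> x \in V -> y \in V ->
  x != 0 -> crs x y = 0.
Proof.
move=> V1 xV yV x0.
have VE : <[x]>%VS = V by apply/eqP; rewrite eqEdim -memvE xV dim_vline x0 V1.
by move: yV; rewrite -VE => /vlineP[c ->]; rewrite crsZ.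
Qed.

(** Doubled good words preserve the cone, and among them
    are the powers of [z], under which only the two eigenlines of [A_z] can have
    a finite orbit; the words from [pivot_words] move each eigenline to a line
    that is neither of the two. *)
Lemma pivot_no_lines : strongly_irreducible A -> exists m0, forall m (Vs : seq {vspace 'cV[R]_2}),
  (m0 <= m)%N -> Vs != [::] -> (forall V, V \in Vs -> \dim V = 1%N) ->
  ~ (forall g, size g = (2 * (size z * m))%N -> prefix z g -> cone_word g ->
      mulmx (wprod A g) @` line_union Vs `<=` line_union Vs).
Proof.
move=> sirr; have [v [v' [[lv v00 v10] [lv' v'00 v'01]]]] := pivot_words sirr.
have [a aP] := pivot_block lv v00; have [b bP] := pivot_block lv' v'00.
have n00 : N [::] 0 0 != 0 by rewrite Nw_nil// mxE/= oner_eq0.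
have [d dP] := sandwich_good n00.
exists (a + b + (2 * d).+1)%N => m Vs mm Vs0 Vs1 inv.
have am : (a <= m)%N by move: mm; clear; lia.
have bm : (b <= m)%N by move: mm; clear; lia.
have [q [sq pq gq q10 _]] := aP m am; have [q' [sq' pq' gq' _ q'01]] := bP m bm.
have zg : good be (N (zpow z m)).
  have -> : zpow z m = zpow z (m - d) ++ [::] ++ zpow z d.
    by rewrite cat0s -zpowD subnK//; move: mm; clear; lia.
  by apply: dP => //; move: mm; clear; lia.
pose U (x : 'cV[R]_2) := x != 0 /\ line_union Vs x.
have Uinv p x : size p = (size z * m)%N -> prefix z p -> good be (N p) ->
    U x -> U (wprod A (p ++ p) *m x).
  move=> sp pp gp [x0 xV]; split.
    by apply: contra_neq x0 => h; rewrite -[x](mulKmx (wprod_unit Au (p ++ p))) h mulmx0.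
  apply: (inv (p ++ p)).
  - by rewrite size_cat sp; clear; lia.
  - by case/prefixP: pp => s ->; rewrite -catA prefix_prefix.
  - apply: good_cat_cone => //; rewrite -expr2 lt_neqAle sqr_ge0 andbT eq_sym sqrf_eq0.
    by case: gp.
  - by exists x.
have sz : size (zpow z m) = (size z * m)%N by rewrite size_zpow mulnC.
have pz : prefix z (zpow z m).
  have : (0 < m)%N by move: mm; clear; lia.
  by case: (m) => // m' _; rewrite /zpow /= prefix_prefix.
pose g0 := zpow z m ++ zpow z m.
have Ng0 j x : W *m iter j (mulmx (wprod A g0)) x =
    cv2 ((la ^+ (m + m)) ^+ j * (W *m x) 0 0) ((mu ^+ (m + m)) ^+ j * (W *m x) 1 0).
  elim: j => [|j IH]; first by rewrite !expr0 !mul1r -cv2_eta.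
  rewrite iterS Nw_apply// IH /g0 -zpowD (Nw_zpow Wu Nz).
  by apply: eq_cv2; rewrite (mulmx2 (diag2 _ _)) !diag2E !cv2E0 !cv2E1 !exprS; ring.
(* two iterates of [x] fall on the same line, by the pigeonhole principle *)
have axis x : U x -> (W *m x) 0 0 = 0 \/ (W *m x) 1 0 = 0.
  move=> Ux.
  have Uj j : U (iter j (mulmx (wprod A g0)) x).
    by elim: j => [//|j IH]; rewrite iterS; exact: Uinv.
  have /choice[h hP] : forall j : 'I_(size Vs).+1, exists i : 'I_(size Vs),
      iter j (mulmx (wprod A g0)) x \in nth 0%VS Vs i.
    move=> j; have [_ [V VV jV]] := Uj j.
    have iV : (index V Vs < size Vs)%N by rewrite index_mem.
    by exists (Ordinal iV); rewrite /= nth_index.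
  have /injectivePn[j [j' jj' hj]] : ~~ injectiveb h.
    by apply/negP => /injectiveP/leq_card; rewrite !card_ord ltnn.
  wlog lt : j j' jj' hj / (j < j')%N.
    move=> H; have [lt|lt|e] := ltngtP j j'; first exact: (H j j').
      by apply: (H j' j) => //; rewrite eq_sym.
    by move/val_inj: e jj' => ->; rewrite eqxx.
  set V := nth 0%VS Vs (h j).
  have VV : V \in Vs by rewrite mem_nth.
  have jV : iter j (mulmx (wprod A g0)) x \in V := hP j.
  have j'V : iter j' (mulmx (wprod A g0)) x \in V by rewrite /V hj; exact: hP.
  have := line_crs (Vs1 _ VV) jV j'V (Uj j).1.
  move=> /(congr1 (fun r => \det W * r)); rewrite -crs_mul mulr0 !Ng0 /crs !cv2E0 !cv2E1.
  set p := la ^+ (m + m); set r := mu ^+ (m + m).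
  have -> : (j' : nat) = (j + (j' - j))%N by rewrite subnKC// ltnW.
  rewrite !exprD; set y0 := (W *m x) 0 0; set y1 := (W *m x) 1 0.
  have -> : p ^+ j * y0 * (r ^+ j * r ^+ (j' - j) * y1) - r ^+ j * y1 * (p ^+ j * p ^+ (j' - j) * y0)
    = (p ^+ j * r ^+ j) * (r ^+ (j' - j) - p ^+ (j' - j)) * (y0 * y1) by ring.
  have pr : `|r| < `|p|.
    by rewrite !normrX ltrXn2r// addn_eq0 negb_and; case: (m) pz => //; case: (z) z0.
  have p0 : p != 0 by rewrite expf_neq0// la_neq0.
  have r0 : r != 0 by rewrite expf_neq0// mu_neq0.
  move=> /eqP; rewrite !mulf_eq0 (negPf (expf_neq0 j p0)) (negPf (expf_neq0 j r0))/=.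
  rewrite subr_eq0 eq_sym (negPf (normX_inj _ pr)) ?subn_gt0//=.
  by case/orP => /eqP; [left|right].
have WN0 (x : 'cV[R]_2) : x != 0 -> (W *m x) 0 0 = 0 -> (W *m x) 1 0 != 0.
  move=> x0 y0; apply: contra_neq x0 => y1; rewrite -[x](mulKmx Wu).
  by rewrite (_ : W *m x = 0) ?mulmx0//; apply: eq_cv2; rewrite [RHS]mxE.
have first_axis x : U x -> (W *m x) 1 0 = 0 -> False.
  move=> Ux y1; have Ug := Uinv q x sq pq gq Ux; have := axis _ Ug.
  have y0 : (W *m x) 0 0 != 0.
    by apply/eqP => y0; have := WN0 x Ux.1 y0; rewrite y1 eqxx.
  have tr := good_trace be0 gq; have [q00 _ _] := gq.
  rewrite Nw_apply// !(mulmx2 (N _)) y1 !mulr0 !addr0 !Nw_cat2.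
  case=> /eqP; rewrite mulf_eq0 (negPf y0) orbF.
    have := (good_cat_cone gq gq); rewrite /cone_word => H.
    move=> e.
    have qq : 0 < N q 0 0 * N q 0 0 by rewrite -expr2 lt_neqAle sqr_ge0 andbT eq_sym sqrf_eq0.
    have pe : pcone be (cv2 1 0) by rewrite /pcone cv2E0 cv2E1 normr0 mulr1 (ltW be0).
    have [+ _] := H qq _ pe.
    by rewrite (mulmx2 (N _)) cv2E0 cv2E1 mulr0 addr0 mulr1 Nw_cat2 (eqP e) ltxx.
  have -> : N q 1 0 * N q 0 0 + N q 1 1 * N q 1 0 = N q 1 0 * (N q 0 0 + N q 1 1) by ring.
  by rewrite mulf_eq0 (negPf (q10 v10)) (negPf tr).
have [x Ux] : exists x, U x.
  have [V VV] : exists V, V \in Vs.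
    by case: (Vs) Vs0 => // V Vs' _; exists V; rewrite inE eqxx.
  have V1 := Vs1 V VV.
  exists (vpick V); split; last by exists V; last exact: memv_pick.
  by rewrite vpick0; apply/eqP => V0; rewrite V0 dimv0 in V1.
have y0 : (W *m x) 0 0 = 0.
  by case: (axis _ Ux) => // y1; case: (first_axis _ Ux y1).
have y1 := WN0 x Ux.1 y0.
have Ug := Uinv q' x sq' pq' gq' Ux.
have tr := good_trace be0 gq'.
case: (axis _ Ug) => [|h]; last exact: (first_axis _ Ug h).
rewrite Nw_apply// !(mulmx2 (N _)) y0 !mulr0 !add0r !Nw_cat2 => /eqP.
have -> : N q' 0 0 * N q' 0 1 + N q' 0 1 * N q' 1 1 = N q' 0 1 * (N q' 0 0 + N q' 1 1) by ring.
by rewrite !mulf_eq0 (negPf (q'01 v'01)) (negPf tr) (negPf y1).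
Qed.

End PivotWords.

(** * Block distributions *)

Section EntropyBound.
Variable R : realType.

Lemma ent_le_card (T : finType) (m : T -> R) : is_distr m -> ent m <= ln #|T|%:R.
Proof.
move=> mD; have := @ent_le_push R T unit (fun=> tt) m #|T| mD.
have -> : ent (push (fun=> tt) m) = 0.
  rewrite /ent (bigD1 tt)//= big1 ?addr0; last by case.
  have [_ m1] := mD; rewrite /push (eq_bigl predT)//.
  by rewrite m1 ln1 mulr0 oppr0.
by rewrite add0r; apply => y; exact: max_card.
Qed.

Section Coupling.
Variables (T : finType) (q : T -> R) (sg : T -> bool).
Hypothesis qD : is_distr q.

(** Two copies of a distribution, independent given that they have the same
    label. The label will be the sign of the pivot entry of a block: two blocks of
    the same sign compose to a product that preserves the cone itself, and not
    only the cone up to sign. *)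
Definition coupling (p : T * T) : R :=
  if sg p.1 == sg p.2 then q p.1 * q p.2 / push sg q (sg p.1) else 0.

Let ps := push sg q.

Lemma coupling_ge0 p : 0 <= coupling p.
Proof.
have [q0 _] := qD; have [p0 _] := push_distr sg qD.
by rewrite /coupling; case: ifP => // _; rewrite divr_ge0// mulr_ge0.
Qed.

Lemma coupling_supp p : 0 < coupling p -> sg p.1 = sg p.2.
Proof. by rewrite /coupling; case: eqP => // _; rewrite ltxx. Qed.

Lemma coupling_sum w : \sum_w' coupling (w, w') = q w.
Proof.
have [q0 _] := qD.
rewrite /coupling/= -big_mkcond/= -mulr_suml -mulr_sumr.
rewrite (eq_bigl (fun i => sg i == sg w)); last by move=> i; rewrite eq_sym.
rewrite -/(push sg q (sg w)).
have [s0|s0] := eqVneq (push sg q (sg w)) 0; last by rewrite mulfK.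
rewrite s0 mulr0 mul0r; apply/eqP; rewrite eq_le q0/= -s0.
exact: (push_ge sg w q0).
Qed.

Lemma coupling_sym w w' : coupling (w, w') = coupling (w', w).
Proof.
rewrite /coupling/= eq_sym; case: eqP => // ->.
by rewrite [q w' * _]mulrC.
Qed.

Lemma coupling_fst : push fst coupling =1 q.
Proof.
move=> w; rewrite -[RHS]coupling_sum /push.
rewrite (eq_bigl (fun p : T * T => (p.1 == w) && true)); last by move=> p; rewrite andbT.
by rewrite -(pair_big (pred1 w) predT (fun x y => coupling (x, y)))/= big_pred1_eq.
Qed.

Lemma coupling_snd : push snd coupling =1 q.
Proof.
move=> w; rewrite -[RHS]coupling_sum /push.
rewrite (eq_bigl (fun p : T * T => true && (p.2 == w)))//.
rewrite -(pair_big predT (pred1 w) (fun x y => coupling (x, y)))/=.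
by apply: eq_bigr => x _; rewrite big_pred1_eq coupling_sym.
Qed.

Lemma coupling_distr : is_distr coupling.
Proof.
have [q0 q1] := qD; split; first exact: coupling_ge0.
rewrite -q1; transitivity (\sum_x coupling x * 1).
  by apply: eq_bigr => x _; rewrite mulr1.
rewrite -(push_sum fst coupling (fun=> 1)); apply: eq_bigr => w _.
by rewrite mulr1 coupling_fst.
Qed.

Lemma coupling_mean (f : T -> R) :
  \sum_p coupling p * (f p.1 + f p.2) = 2 * \sum_w q w * f w.
Proof.
have e1 : \sum_p coupling p * f p.1 = \sum_w q w * f w.
  rewrite -(push_sum fst coupling f); apply: eq_bigr => w _.
  by rewrite coupling_fst.
have e2 : \sum_p coupling p * f p.2 = \sum_w q w * f w.
  rewrite -(push_sum snd coupling f); apply: eq_bigr => w _.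
  by rewrite coupling_snd.
rewrite mulr_natl mulr2n -{1}e1 -e2 -big_split/=.
by apply: eq_bigr => p _; rewrite mulrDr.
Qed.

Lemma coupling_ent_ge : 2 * ent q - ln 2 <= ent coupling.
Proof.
have [q0 q1] := qD; have [p0 p1] := push_distr sg qD.
have sgE : ent ps <= ln 2.
  by have := ent_le_card (push_distr sg qD); rewrite card_bool.
have -> : 2 * ent q = \sum_p coupling p * (- ln (q p.1) + - ln (q p.2)).
  rewrite (coupling_mean (fun w => - ln (q w))); congr (_ * _).
  by apply: eq_bigr => w _; rewrite mulrN.
have entE : ent ps = \sum_p coupling p * - ln (ps (sg p.1)).
  rewrite -(push_sum fst coupling (fun w => - ln (ps (sg w)))).
  rewrite ent_push; apply: eq_bigr => w _.
  by rewrite coupling_fst mulrN.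
have h : \sum_p coupling p * (- ln (q p.1) + - ln (q p.2)) - ent ps <= ent coupling.
  rewrite entE -sumrB; apply: ler_sum => p _.
  have := coupling_ge0 p; rewrite le_eqVlt => /predU1P[<-|cp].
    by rewrite !mul0r subr0 oppr0.
  have sp := coupling_supp cp.
  have cE : coupling p = q p.1 * q p.2 / ps (sg p.1).
    by rewrite /coupling sp eqxx.
  have qp1 : 0 < q p.1.
    rewrite lt_neqAle q0 andbT eq_sym; apply/eqP => q0'.
    by rewrite cE q0' !mul0r ltxx in cp.
  have qp2 : 0 < q p.2.
    rewrite lt_neqAle q0 andbT eq_sym; apply/eqP => q0'.
    by rewrite cE q0' mulr0 mul0r ltxx in cp.
  have pp : 0 < ps (sg p.1) by exact: push_gt0.
  have lE : ln (coupling p) = ln (q p.1) + ln (q p.2) - ln (ps (sg p.1)).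
    by rewrite cE ln_div ?posrE ?mulr_gt0// lnM.
  rewrite lE; move: (coupling p) (ln (q p.1)) (ln (q p.2)) (ln (ps (sg p.1))).
  by move=> a b c d; lra.
by move: h sgE; move: (\sum_p _) (ent ps) (ent coupling) (ln 2) => a b c d; lra.
Qed.

Lemma coupling_ent_le : ent coupling <= 2 * ent q.
Proof.
have := @ent_pair_le R _ _ _ fst snd coupling coupling_distr.
rewrite (eq_ent coupling_fst) (eq_ent coupling_snd) mulr_natl mulr2n; apply.
by move=> [a b] [c d] [-> ->].
Qed.

End Coupling.
End EntropyBound.

Section WordBounds.
Variables (R : realType) (L : finType) (A : L -> 'M[R]_2).
Hypothesis Au : forall a, A a \in unitmx.

Lemma lna1 : lna (1%:M : 'M[R]_2) = 0.
Proof.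
rewrite /lna alpha1E.
have f1 : frob2 (1%:M : 'M[R]_2) = 2 by rewrite /frob2 !mxE/=; ring.
have -> : top2 (1%:M : 'M[R]_2) = 1.
  rewrite /top2 /disc2 f1 det1 (_ : _ - _ = 0); last by ring.
  by rewrite sqrtr0 addr0 divff.
by rewrite sqrtr1 ln1.
Qed.

Lemma lna_size_le : exists2 K, 0 <= K & forall w, lna (wprod A w) <= K * (size w)%:R.
Proof.
exists (\sum_a `|lna (A a)|); first exact: sumr_ge0.
elim=> [|a w IH]; first by rewrite mulr0 wprod_nil lna1.
rewrite -cat1s; apply: le_trans (lna_cat Au _ _) _.
rewrite /= wprod_seq1 -natr1 mulrDr mulr1 addrC lerD//.
by apply: le_trans (ler_norm _) _; rewrite (bigD1 a)//= lerDl sumr_ge0.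
Qed.

Lemma lnd_size_le : exists2 K, 0 <= K & forall w, `|lnd (wprod A w)| <= K * (size w)%:R.
Proof.
exists (\sum_a `|lnd (A a)|); first exact: sumr_ge0.
elim=> [|a w IH]; first by rewrite mulr0 wprod_nil /lnd det1 normr1 ln1 normr0.
rewrite -cat1s lnd_cat//; apply: le_trans (ler_normD _ _) _.
rewrite /= wprod_seq1 -natr1 mulrDr mulr1 addrC lerD//.
by rewrite (bigD1 a)//= lerDl sumr_ge0.
Qed.

End WordBounds.

Section BlockLemma.
Variables (R : realType) (L : finType) (A : L -> 'M[R]_2) (z : seq L).
Hypotheses (Au : forall a, A a \in unitmx) (z0 : (0 < size z)%N).
Hypotheses (irr : ~ has_invariant_line A) (hyp1 : exists i, hyperbolic (A i)).
Hypothesis hypz : hyperbolic (wprod A z).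

Definition block_word (C0 : set 'cV[R]_2) (g : seq L) : Prop :=
  prefix z g /\ mulmx (wprod A g) @` C0 `<=` interior C0.

Definition block_law (C0 : set 'cV[R]_2) (C : R) N d (q : N.-tuple L -> R)
    (q' : (2 * (N + d)).-tuple L -> R) : Prop :=
  [/\ is_distr q',
      forall g, 0 < q' g -> block_word C0 g,
      `|ent q' - 2 * ent q| <= C,
      `|\sum_g q' g * lna (wprod A g) - 2 * \sum_w q w * lna (wprod A w)| <= C /\
      `|\sum_g q' g * lnd (wprod A g) - 2 * \sum_w q w * lnd (wprod A w)| <= C &
      forall gs : seq ((2 * (N + d)).-tuple L), (forall g, g \in gs -> 0 < q' g) ->
        \sum_(g <- gs) (lna (wprod A g) - C) - C <= lna (wprod A (flatten (map val gs)))].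

(** Stated for all block words of a given length, and not for those charged by a
    distribution: this is what makes the subsystem strongly irreducible. *)
Definition block_rigid (C0 : set 'cV[R]_2) : Prop :=
  strongly_irreducible A -> exists m0, forall m (Vs : seq {vspace 'cV[R]_2}),
  (m0 <= m)%N -> Vs != [::] -> (forall V, V \in Vs -> \dim V = 1%N) ->
  ~ (forall g, size g = (2 * (size z * m))%N -> block_word C0 g ->
      mulmx (wprod A g) @` line_union Vs `<=` line_union Vs).

(** Surround the words by connecting words as in [block_good], then couple two
    blocks of the same sign. All errors are bounded because the number of letters
    inserted does not depend on [N]. Norms of concatenated blocks multiply up to a
    bounded factor because every block stretches the cone by its norm. *)
Lemma block_lemma : exists C0 C d, [/\ cone C0, 0 <= C, (size z %| d)%N,
  block_rigid C0 &
  forall N (q : N.-tuple L -> R), is_distr q -> exists q', block_law C0 C (d := d) q q'].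
Proof.
have [W [la [mu [Wu Nz mu0 mula]]]] := hyperbolic_diag (wprod_unit Au z) hypz.
have irrN (x : 'cV[R]_2) : x != 0 -> exists v : (size z).-tuple L, crs x (Nw A W v *m x) != 0.
  move=> x0; have y0 : invmx W *m x != 0.
    by apply: contra_neq x0 => h; rewrite -[x](mulKVmx Wu) h mulmx0.
  have [v vP] := level_irreducible Au z0 irr hyp1 y0; exists v.
  rewrite -[x](mulKVmx Wu) -Nw_apply// crs_mul mulf_neq0//.
  by rewrite -unitfE -unitmxE.
have [be [c [k [be0 c0 blk]]]] := block_good Au Wu Nz mu0 mula irrN.
pose CT := option ((size z).-tuple L).
have /choice[conn connP] : forall w : seq L, exists p : CT * CT,
    good be (Nw A W (Qw k w p.1 p.2)) /\
    c * frob2 (Nw A W w) <= Nw A W (Qw k w p.1 p.2) 0 0 ^+ 2.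
  by move=> w; have [ o [ o' P]] := blk w; exists (o, o').
pose qw w := Qw k w (conn w).1 (conn w).2.
pose d := (size z * (k + 3))%N.
have sqw w : size (qw w) = (size w + d)%N by rewrite /qw size_Qw.
pose N_ := Nw A W.
pose kap := frob2 W * frob2 (invmx W).
have kap0 : 0 < kap by rewrite mulr_gt0// frob2_gt0// unitmx_inv.
have frobN w : frob2 (N_ w) <= kap * frob2 (wprod A w).
  apply: le_trans (frob2_mul _ _) _.
  apply: le_trans (ler_wpM2r (frob2_ge0 _) (frob2_mul _ _)) _.
  by rewrite /kap mulrAC.
have Nfrob w : frob2 (wprod A w) <= kap * frob2 (N_ w).
  have -> : wprod A w = invmx W *m N_ w *m W by rewrite /N_ /Nw !mulmxA mulVmx// mul1mx mulmxKV.
  apply: le_trans (frob2_mul _ _) _.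
  apply: le_trans (ler_wpM2r (frob2_ge0 _) (frob2_mul _ _)) _.
  by rewrite /kap mulrAC [frob2 W * _]mulrC.
have [K K0 KP] := lna_size_le Au; have [K' K'0 K'P] := lnd_size_le Au.
pose c1 := (ln c - ln kap) / 2.
have pivot w : lna (wprod A w) + c1 <= ln `|N_ (qw w) 0 0|.
  have [gw fw] := connP w; have [p0 _ _] := gw.
  have a0 := alpha1_gt0 (wprod_unit Au w).
  have f0 : 0 < frob2 (Nw A W w) by rewrite frob2_gt0// Nw_unit.
  have ck : 0 < c / kap by rewrite divr_gt0.
  have h1 : alpha1 (wprod A w) ^+ 2 * (c / kap) <= `|N_ (qw w) 0 0| ^+ 2.
    rewrite real_normK ?num_real//; apply: le_trans fw.
    have /andP[af _] := alpha1_frob (wprod A w).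
    apply: le_trans (ler_wpM2r (ltW ck) (le_trans af (Nfrob w))) _.
    by rewrite le_eqVlt; apply/orP; left; apply/eqP; field; rewrite gt_eqF.
  have p0' : 0 < `|N_ (qw w) 0 0| by rewrite normr_gt0.
  have a20 : 0 < alpha1 (wprod A w) ^+ 2 by rewrite exprn_gt0.
  have L0 : 0 < alpha1 (wprod A w) ^+ 2 * (c / kap) by rewrite mulr_gt0.
  have L1 : 0 < `|N_ (qw w) 0 0| ^+ 2 by rewrite exprn_gt0.
  move: h1; rewrite -(ler_ln L0 L1) (lnM a20 ck) !lnXn// (ln_div c0 kap0) /c1 /lna.
  rewrite ![ln _ *+ 2]mulr2n.
  move: (ln (alpha1 (wprod A w))) (ln `|N_ (qw w) 0 0|) (ln c) (ln kap).
  by move=> x y a b; lra.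
pose C1 := ln 4 - 2 * c1.
have grow w w' : (0 < N_ (qw w) 0 0) = (0 < N_ (qw w') 0 0) ->
    forall x, pcone be x -> pcone_int be (N_ (qw w ++ qw w') *m x) /\
    expR (lna (wprod A w) + lna (wprod A w') - C1) * x 0 0 <=
      (N_ (qw w ++ qw w') *m x) 0 0.
  move=> ss x px; have [gw _] := connP w; have [gw' _] := connP w'.
  have [p0 _ _] := gw; have [p0' _ _] := gw'.
  have pp : 0 < N_ (qw w) 0 0 * N_ (qw w') 0 0.
    have [h|h] := ltP 0 (N_ (qw w) 0 0).
      by rewrite pmulr_rgt0// -ss.
    have h' : N_ (qw w') 0 0 <= 0 by rewrite leNgt -ss ltNge h.
    by rewrite nmulr_rgt0 lt_neqAle ?h ?h' ?andbT.
  have [h1 h2] := good_pair be0 gw gw' pp px.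
  rewrite /N_ Nw_cat// -mulmxA; split=> //.
  have [x0 _] := px.
  have h3 : expR (lna (wprod A w) + lna (wprod A w') - C1) <=
      4^-1 * (N_ (qw w) 0 0 * N_ (qw w') 0 0).
    have p4 : 0 < 4^-1 * (N_ (qw w) 0 0 * N_ (qw w') 0 0) by rewrite mulr_gt0.
    rewrite -[leRHS]lnK ?posrE// ler_expR lnM ?posrE// lnV ?posrE//.
    rewrite -(gtr0_norm pp) normrM lnM ?posrE ?normr_gt0//.
    have := pivot w; have := pivot w'; rewrite /C1.
    move: (lna (wprod A w)) (lna (wprod A w')) (ln `|_|) (ln `|_|) (ln 4) (c1).
    by move=> *; lra.
  apply: le_trans (ler_wpM2r (ltW x0) h3) _.
  by rewrite -mulrA ler_pdivrMl.
pose c2 := (ln 2 + ln kap) / 2.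
have entry g : 0 < N_ g 0 0 -> ln (N_ g 0 0) <= lna (wprod A g) + c2.
  move=> p0; have a0 := alpha1_gt0 (wprod_unit Au g).
  have h1 : N_ g 0 0 ^+ 2 <= (2 * kap) * alpha1 (wprod A g) ^+ 2.
    apply: le_trans (entry_le_frob _ _ _) _; apply: le_trans (frobN g) _.
    have /andP[_ af] := alpha1_frob (wprod A g).
    apply: le_trans (ler_wpM2l (ltW kap0) af) _.
    by rewrite mulrA [kap * _]mulrC.
  have k20 : 0 < 2 * kap by rewrite mulr_gt0.
  have a20 : 0 < alpha1 (wprod A g) ^+ 2 by rewrite exprn_gt0.
  have L0 : 0 < (2 * kap) * alpha1 (wprod A g) ^+ 2 by rewrite mulr_gt0.
  have L1 : 0 < N_ g 0 0 ^+ 2 by rewrite exprn_gt0.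
  have two0 : 0 < 2 :> R by [].
  move: h1; rewrite -(ler_ln L1 L0) (lnM k20 a20) (lnM two0 kap0) !lnXn// /c2 /lna.
  rewrite ![ln _ *+ 2]mulr2n.
  move: (ln (alpha1 (wprod A g))) (ln (N_ g 0 0)) (ln 2) (ln kap).
  by move=> x y a b; lra.
have pe1 : pcone be (cv2 1 0) by rewrite /pcone cv2E0 cv2E1 normr0 mulr1 ltW.
have Ne1 g : (N_ g *m cv2 1 0) 0 0 = N_ g 0 0.
  by rewrite (mulmx2 (N_ g)) cv2E0 cv2E1; ring.
have qw_up w : lna (wprod A (qw w)) <= lna (wprod A w) + K * d%:R.
  rewrite /qw /Qw; set o1 := cword _; set o2 := cword _; set zz := zpow _ _.
  have sz : (size z + size o1 + size o2 + size zz)%N = d.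
    by have := sqw w; rewrite /qw /Qw !size_cat -/o1 -/o2 -/zz; clear; lia.
  rewrite -sz !natrD !mulrDr.
  have h1 := lna_cat Au z (o1 ++ w ++ o2 ++ zz); have h2 := lna_cat Au o1 (w ++ o2 ++ zz).
  have h3 := lna_cat Au w (o2 ++ zz); have h4 := lna_cat Au o2 zz.
  move: h1 h2 h3 h4 (KP z) (KP o1) (KP o2) (KP zz).
  move: (lna (wprod A (z ++ o1 ++ w ++ o2 ++ zz))) (lna (wprod A (o1 ++ w ++ o2 ++ zz))).
  move: (lna (wprod A (w ++ o2 ++ zz))) (lna (wprod A (o2 ++ zz))).
  move: (lna (wprod A z)) (lna (wprod A w)) (lna (wprod A o1)) (lna (wprod A o2)) (lna (wprod A zz)).
  move: (K * (size z)%:R) (K * (size o1)%:R) (K * (size o2)%:R) (K * (size zz)%:R).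
  by move=> *; lra.
have qw_det w : `|lnd (wprod A (qw w)) - lnd (wprod A w)| <= K' * d%:R.
  rewrite /qw /Qw; set o1 := cword _; set o2 := cword _; set zz := zpow _ _.
  have sz : (size z + size o1 + size o2 + size zz)%N = d.
    by have := sqw w; rewrite /qw /Qw !size_cat -/o1 -/o2 -/zz; clear; lia.
  rewrite -sz !natrD !mulrDr !lnd_cat//.
  rewrite (_ : _ - _ = lnd (wprod A z) + lnd (wprod A o1) + lnd (wprod A o2) + lnd (wprod A zz)); last by ring.
  apply: le_trans (ler_normD _ _) _; apply: lerD => //.
  apply: le_trans (ler_normD _ _) _; apply: lerD => //.
  by apply: le_trans (ler_normD _ _) _; apply: lerD.
pose same w w' := (0 < N_ (qw w) 0 0) = (0 < N_ (qw w') 0 0).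
have g_up w w' : lna (wprod A (qw w ++ qw w')) <=
    lna (wprod A w) + lna (wprod A w') + 2 * (K * d%:R).
  have := lna_cat Au (qw w) (qw w'); have := qw_up w; have := qw_up w'.
  move: (lna (wprod A (qw w ++ qw w'))) (lna (wprod A (qw w))) (lna (wprod A (qw w'))).
  move: (lna (wprod A w)) (lna (wprod A w')) (K * d%:R) => *; lra.
pose C4 := 2 * (K * d%:R) + C1.
have grow' w w' : same w w' -> forall x, pcone be x ->
    pcone_int be (N_ (qw w ++ qw w') *m x) /\
    expR (lna (wprod A (qw w ++ qw w')) - C4) * x 0 0 <= (N_ (qw w ++ qw w') *m x) 0 0.
  move=> ss x px; have [h1 h2] := grow w w' ss x px; split=> //.
  apply: le_trans h2; have [x0 _] := px; rewrite ler_pM2r// ler_expR /C4.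
  have := g_up w w'.
  move: (lna (wprod A (qw w ++ qw w'))) (lna (wprod A w)) (lna (wprod A w')) (K * d%:R).
  by move=> *; lra.
have g_low w w' : same w w' ->
    lna (wprod A w) + lna (wprod A w') - C1 - c2 <= lna (wprod A (qw w ++ qw w')).
  move=> ss; have [_] := grow w w' ss _ pe1; rewrite Ne1 cv2E0 mulr1 => h.
  have p0 := lt_le_trans (expR_gt0 _) h.
  have := entry _ p0; have := h; rewrite -[X in _ <= X]lnK ?posrE// ler_expR.
  move: (lna (wprod A (qw w ++ qw w'))) (lna (wprod A w)) (lna (wprod A w')) (ln (N_ (qw w ++ qw w') 0 0)).
  by move=> *; lra.
pose C := ln 2 + ln 16 + 2 * (K * d%:R) + `|C1| + `|c2| + 2 * (K' * d%:R).
have l2 : 0 <= ln 2 :> R by apply: ln_ge0; rewrite ler1n.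
have l16 : 0 <= ln 16 :> R by apply: ln_ge0; rewrite ler1n.
have Kd0 : 0 <= K * d%:R by rewrite mulr_ge0.
have Kd0' : 0 <= K' * d%:R by rewrite mulr_ge0.
have nC1 := normr_ge0 C1; have nc2 := normr_ge0 c2.
have aC1 := ler_norm C1; have ac2 := ler_norm c2.
have C0 : 0 <= C by rewrite /C; lra.
exists (coneW W be), C, d; split=> //.
- exact: coneW_cone.
- exact: dvdn_mulr.
- move=> sirr; have [m0 m0P] := pivot_no_lines Au Wu Nz mu0 mula be0 z0 irrN sirr.
  exists m0 => m Vs mm Vs0 Vs1 inv; apply: (m0P m Vs mm Vs0 Vs1) => g sg pg cg.
  apply: inv => //; split=> // _ [x xC <-]; apply: coneW_interior.
  by rewrite Nw_apply//; exact: cg.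
move=> N q qD.
pose sg (w : N.-tuple L) := 0 < N_ (qw w) 0 0.
have gs p : size (qw (p : N.-tuple L * N.-tuple L).1 ++ qw p.2) == (2 * (N + d))%N.
  by rewrite size_cat !sqw !size_tuple mul2n -addnn.
pose gt p : (2 * (N + d)).-tuple L := Tuple (gs p).
pose m := coupling q sg.
have mD : is_distr m := coupling_distr sg qD.
have m0 p : 0 <= m p by case: mD.
exists (push gt m); have supp g : 0 < push gt m g -> exists w w',
    same w w' /\ val g = qw w ++ qw w'.
  by move=> /push_supp[p <- /coupling_supp pp]; exists p.1, p.2.
split.
- exact: push_distr.
- move=> g /supp[w [w' [ss ->]]]; split.
    by rewrite /qw /Qw -catA prefix_prefix.
  move=> _ [x xC <-]; apply: coneW_interior; rewrite Nw_apply//.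
  by have [] := grow w w' ss _ xC.
- have h1 : ent (push gt m) <= ent m by exact: ent_push_le.
  have h2 : ent m <= 2 * ent q by exact: coupling_ent_le.
  have h3 : 2 * ent q - ln 2 <= ent m by exact: coupling_ent_ge.
  (* a block determines its core once it is known which connecting words are
     empty: sixteen cases for a pair of blocks *)
  pose F (p : N.-tuple L * N.-tuple L) :=
    ((isSome (conn p.1).1, isSome (conn p.1).2), (isSome (conn p.2).1, isSome (conn p.2).2)).
  have h4 : ent m <= ent (push gt m) + ent (push F m).
    apply: ent_pair_le => // -[w1 w2] [v1 v2] /= [].
    have core (w v : N.-tuple L) : isSome (conn w).1 = isSome (conn v).1 -> qw w = qw v -> w = v.
      move=> e; rewrite /qw /Qw => /eqP; rewrite eqseq_cat// => /andP[_].
      rewrite eqseq_cat; last first.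
        by move: e; case: (conn w).1 => [?|]; case: (conn v).1 => [?|]//=; rewrite !size_tuple.
      move=> /andP[_]; rewrite eqseq_cat ?size_tuple// => /andP[/eqP wv _].
      exact: val_inj.
    move=> /eqP; rewrite eqseq_cat; last by rewrite !sqw !size_tuple.
    by move=> /andP[/eqP e1 /eqP e2] f1 _ f3 _; rewrite (core _ _ f1 e1) (core _ _ f3 e2).
  have h5 : ent (push F m) <= ln 16.
    have := ent_le_card (push_distr F mD).
    by rewrite !card_prod !card_bool.
  move: h1 h2 h3 h4 h5; rewrite /C ler_norml.
  move: (ent (push gt m)) (ent m) (ent q) (ent (push F m)) => a b e f *.
  by apply/andP; split; lra.
- have mean (f : seq L -> R) B : 
      (forall w w', same w w' -> `|f (qw w ++ qw w') - (f w + f w')| <= B) ->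
      `|\sum_g push gt m g * f g - 2 * \sum_w q w * f w| <= B.
    move=> fB; rewrite (push_sum gt m (fun g => f g)) -(coupling_mean sg qD (fun w => f w)).
    rewrite -sumrB; apply: (le_trans (ler_norm_sum _ _ _)).
    have -> : B = \sum_p m p * B by rewrite -mulr_suml; case: mD => _ ->; rewrite mul1r.
    apply: ler_sum => p _; rewrite -mulrBr normrM ger0_norm//.
    have := m0 p; rewrite le_eqVlt => /predU1P[<-|mp]; first by rewrite !mul0r.
    by rewrite ler_pM2l//; apply: fB; exact: coupling_supp mp.
  split; [apply: (mean (fun g => lna (wprod A g))) |
    apply: (mean (fun g => lnd (wprod A g)))] => w w' ss.
    have := g_up w w'; have := g_low w w' ss; rewrite ler_norml /C.
    move: (lna (wprod A (qw w ++ qw w'))) (lna (wprod A w)) (lna (wprod A w')) => *.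
    by apply/andP; split; lra.
  rewrite lnd_cat//; have := qw_det w; have := qw_det w'; rewrite !ler_norml /C.
  move: (lnd (wprod A (qw w))) (lnd (wprod A (qw w'))) (lnd (wprod A w)) (lnd (wprod A w')).
  by move=> a b e f /andP[? ?] /andP[? ?]; apply/andP; split; lra.
- move=> ws wsP.
  have grows x : pcone be x -> pcone be (N_ (flatten (map val ws)) *m x) /\
      expR (\sum_(g <- ws) (lna (wprod A g) - C)) * x 0 0 <= (N_ (flatten (map val ws)) *m x) 0 0.
    elim: ws wsP x => [|g ws IH] wsP x px.
      by rewrite big_nil expR0 mul1r /N_ Nw_nil// mul1mx.
    have [w [w' [ss gE]]] := supp g (wsP g (mem_head _ _)).
    have [[y0 y1] y2] := grow' w w' ss x px.
    rewrite /= big_cons gE /N_ Nw_cat// -mulmxA -/(N_ _) -/(N_ _).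
    have py : pcone be (N_ (qw w ++ qw w') *m x) by split=> //; exact: ltW.
    have wsP' g' : g' \in ws -> 0 < push gt m g' by move=> ?; apply: wsP; rewrite inE orbC; apply/orP; left.
    have [h1 h2] := IH wsP' _ py; split=> //; apply: le_trans h2.
    rewrite [_ - C + _]addrC expRD -mulrA ler_pM2l ?expR_gt0//; apply: le_trans y2.
    have [x0 _] := px; rewrite ler_pM2r// ler_expR lerD2l lerN2 /C4 /C; lra.
  have [_] := grows _ pe1; rewrite Ne1 cv2E0 mulr1 => h.
  have p0 := lt_le_trans (expR_gt0 _) h.
  move: h; rewrite -[X in _ <= X]lnK ?posrE// ler_expR => h.
  rewrite lerBlDr; apply: le_trans h _; apply: le_trans (entry _ p0) _.
  by rewrite lerD2l /C; lra.
Qed.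

End BlockLemma.

(** * Exponents of Bernoulli measures *)

Section BernoulliExponents.
Variables (R : realType) (T : finType) (t0 : T) (p : T -> R).
Hypothesis pD : is_distr p.
Variable nu : probability (seqspace t0) R.
Hypothesis nuP : forall n, law nu (pref n) =1 prodlaw p (n := n).
Variable B : T -> 'M[R]_2.
Hypothesis Bu : forall t, B t \in unitmx.

Lemma prodlaw_mean n (g : T -> R) :
  \sum_(w : n.-tuple T) prodlaw p w * \sum_(t <- w) g t = n%:R * \sum_t p t * g t.
Proof.
transitivity (\sum_(w : n.-tuple T) \sum_(i < n) prodlaw p w * g (tnth w i)).
  by apply: eq_bigr => w _; rewrite big_tuple mulr_sumr.
rewrite exchange_big/=.
rewrite (eq_bigr (fun=> \sum_t p t * g t)); last by move=> i _; exact: prodlaw_coord.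
by rewrite sumr_const card_ord mulr_natl.
Qed.

Lemma prodlaw_supp n (w : n.-tuple T) : 0 < prodlaw p w -> forall t, t \in tval w -> 0 < p t.
Proof.
have [p0 _] := pD; move=> pw t /tnthP[i ->]; rewrite lt_neqAle p0 andbT eq_sym.
by apply/eqP => pi; move: pw; rewrite /prodlaw (bigD1 i)//= pi mul0r ltxx.
Qed.

(** Bounds the exponents of a product measure from below once norms multiply up to
    a bounded factor on the words that it charges. *)
Lemma prodlaw_mean_ge n (f : n.-tuple T -> R) (g : T -> R) c :
  (forall w : n.-tuple T, (forall t, t \in tval w -> 0 < p t) ->
    \sum_(t <- w) g t - c <= f w) ->
  n%:R * (\sum_t p t * g t) - c <= \sum_w prodlaw p w * f w.
Proof.
move=> fg; have [w0 w1] := prodlaw_distr pD n.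
rewrite -(prodlaw_mean n g).
have -> : c = \sum_(w : n.-tuple T) prodlaw p w * c by rewrite -mulr_suml w1 mul1r.
rewrite -sumrB; apply: ler_sum => w _; rewrite -mulrBr.
have := w0 w; rewrite le_eqVlt => /predU1P[<-|pw]; first by rewrite !mul0r.
by rewrite ler_pM2l//; apply: fg; exact: prodlaw_supp.
Qed.

Lemma bernoulli_Ex n f : Ex nu n f = \sum_(w : n.-tuple T) prodlaw p w * f w.
Proof. by apply: eq_bigr => w _; rewrite nuP. Qed.

Lemma bernoulli_Ex1 (f : seq T -> R) : Ex nu 1 f = \sum_t p t * f [:: t].
Proof.
rewrite bernoulli_Ex.
rewrite -[RHS]mul1r -(prodlaw_mean 1 (fun t => f [:: t])).
apply: eq_bigr => w _; congr (_ * _).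
by case: w => -[|a [|b w]]//= sw; rewrite big_seq1.
Qed.

Lemma bernoulli_lnd_mean : lnd_mean nu B = \sum_t p t * lnd (B t).
Proof. by rewrite /lnd_mean bernoulli_Ex1; apply: eq_bigr => t _; rewrite wprod_seq1. Qed.

Lemma bernoulli_lambda1_le : lambda1 nu B <= \sum_t p t * lna (B t).
Proof.
have [_ /(_ 1%N isT)] := lambda1P (bernoulli_invariant pD nuP) Bu.
rewrite invr1 mul1r bernoulli_Ex1 => /le_trans; apply.
by apply: ler_sum => t _; rewrite wprod_seq1.
Qed.

Lemma bernoulli_lambda1_ge C :
  (forall w : seq T, (forall t, t \in w -> 0 < p t) ->
    \sum_(t <- w) (lna (B t) - C) - C <= lna (wprod B w)) ->
  \sum_t p t * lna (B t) - C <= lambda1 nu B.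
Proof.
move=> H; have [lc _] := lambda1P (bernoulli_invariant pD nuP) Bu.
apply: (cvg_le_div (C := C) (cvg_cst _) lc) => n n0.
have nR : 0 < n%:R :> R by rewrite ltr0n.
rewrite -mulrDr ler_pdivlMl// bernoulli_Ex -lerBlDr.
have [_ p1] := pD.
have -> : \sum_t p t * lna (B t) - C = \sum_t p t * (lna (B t) - C).
  have {1}-> : C = \sum_t p t * C by rewrite -mulr_suml p1 mul1r.
  by rewrite -sumrB; apply: eq_bigr => t _; rewrite mulrBr.
apply: (prodlaw_mean_ge (g := fun t => lna (B t) - C)
  (f := fun w : n.-tuple T => lna (wprod B w))) => w wp.
exact: (H (tval w) wp).
Qed.

End BernoulliExponents.

Section Functional.
Variables (R : realType) (L : finType) (a0 : L).
Variable rho : probability (seqspace a0) R.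
Hypothesis rho_inv : shift_invariant rho.
Variable A : L -> 'M[R]_2.
Hypothesis Au : forall a, A a \in unitmx.

(** The singular value function is submultiplicative, so on an invariant measure
    the infimum is the limit; the limit splits because [lnd] is additive. *)
Lemma kaenmaki_functionalE s : 0 < s < 2 ->
  kaenmaki_functional A s rho =
  entropy rho + (svt s * lambda1 rho A + svu s * lnd_mean rho A).
Proof.
move=> s02; have [lc lb] := lambda1P rho_inv Au; have t0 := svt_gt0 s02.
rewrite /kaenmaki_functional; congr (_ + _).
have E n : (0 < n)%N -> n%:R^-1 * \int[rho]_x ln (svf s (cocycle A x n)) =
    svt s * (n%:R^-1 * Ex rho n (fun w => lna (wprod A w))) + svu s * lnd_mean rho A.
  move=> n0; rewrite (integral_cocycle rho A (fun B => ln (svf s B))).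
  have nR : n%:R != 0 :> R by rewrite pnatr_eq0 -lt0n.
  rewrite (eq_Ex rho n (f := fun w => ln (svf s (wprod A w)))
    (g := fun w => svt s * lna (wprod A w) + svu s * lnd (wprod A w))); last first.
    by move=> w; rewrite svfE ?wprod_unit// expRK.
  rewrite ExD !ExZ Ex_lnd// mulrDr; congr (_ + _); first by rewrite mulrCA.
  by rewrite mulrCA mulKf.
set l := _ + _; set S := [set _ | _ in _].
have Slb : lbound S l.
  by move=> _ [n /= n0 <-]; rewrite E// lerD2r ler_pM2l// lb.
apply/eqP; rewrite eq_le; apply/andP; split; last first.
  by apply: lb_le_inf => //; exists (1%:R^-1 * \int[rho]_x ln (svf s (cocycle A x 1))); exists 1%N.
have lc' : (fun n => svt s * (n%:R^-1 * Ex rho n (fun w => lna (wprod A w))) + svu s * lnd_mean rho A)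
    @ \oo --> l.
  by apply: cvgD; [exact: cvgMl_tmp | exact: cvg_cst].
apply: (cvg_le_div (C := 0) (cvg_cst (inf S)) lc') => n n0.
rewrite mulr0 addr0 -E//; apply: ge_inf; first by exists l.
by exists n.
Qed.

End Functional.

(** * Invariant measures from block distributions *)

Lemma sum_rot (V : nmodType) (F : nat -> V) n : (0 < n)%N -> F n = F 0%N ->
  \sum_(j < n) F j.+1 = \sum_(j < n) F j.
Proof. by case: n => // n _ e; rewrite big_ord_recr/= e big_ord_recl addrC. Qed.

(** Along the multiples of [n] the bounded defect [c] becomes negligible. *)
Lemma subseq_lower (R : realType) (n : nat) (b : nat -> R) (l G c : R) : (0 < n)%N ->
  b @ \oo --> l -> (forall J, (0 < J)%N -> J%:R * G - c <= (J * n)%:R * b (J * n)%N) ->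
  n%:R^-1 * G <= l.
Proof.
move=> n0 bl H.
have bl' : (fun J => b (J * n)%N) @ \oo --> l.
  move=> P /bl[N _ NP]; exists N => // J /= NJ; apply: NP => /=.
  by apply: leq_trans NJ _; rewrite leq_pmulr.
have nR : 0 < n%:R :> R by rewrite ltr0n.
apply: (cvg_le_div (C := n%:R^-1 * c) (cvg_cst _) bl') => J J0.
have JR : 0 < J%:R :> R by rewrite ltr0n.
rewrite -(ler_pM2l (mulr_gt0 JR nR)) -natrM mulrDr.
have -> : (J * n)%:R * (n%:R^-1 * G) = J%:R * G by rewrite natrM; field; rewrite gt_eqF.
have -> : (J * n)%:R * (J%:R^-1 * (n%:R^-1 * c)) = c by rewrite natrM; field; rewrite !gt_eqF.
by rewrite -lerBlDr; exact: H.
Qed.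

Lemma nth_flatten_const (L : Type) (a : L) n (us : seq (seq L)) k : (0 < n)%N ->
  (forall u, List.In u us -> size u = n) -> (k < size us * n)%N ->
  nth a (flatten us) k = nth a (nth [::] us (k %/ n)) (k %% n).
Proof.
move=> n0; elim: us k => [|u us IH] k us_n; first by rewrite mul0n.
rewrite /= mulSn nth_cat (us_n u); last by left.
move=> kl; have [kn|nk] := ltnP k n; first by rewrite divn_small// modn_small.
rewrite IH; [|by move=> v vus; apply: us_n; right | by rewrite ltn_subLR].
by rewrite -{3 4}(subnKC nk) divnDl// divnn n0 add1n modnDl.
Qed.

Section Suspension.
Variables (R : realType) (L : finType) (a0 : L) (n : nat).
Hypothesis n0 : (0 < n)%N.
Local Notation T := (n.-tuple L).
Variables (t0 : T) (q : T -> R).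
Hypothesis qD : is_distr q.
Variable nu : probability (seqspace t0) R.
Hypothesis nuP : forall m, law nu (pref m) =1 prodlaw q (n := m).

Definition susp (j : nat) (x : seqspace t0) : seqspace a0 :=
  fun i => nth a0 (x ((j + i) %/ n)%N) ((j + i) %% n)%N.

Lemma measurable_susp j : measurable_fun setT (susp j).
Proof.
apply: measurable_to_seq => i a.
have mk : mfin (fun x : seqspace t0 => x ((j + i) %/ n)%N).
  by move=> t; exact: measurable_coord.
exact: (mfin_comp (fun t : T => nth a0 t ((j + i) %% n)%N) mk).
Qed.

Lemma susp_shift j x : @seq_shift L a0 (susp j x) = susp j.+1 x.
Proof. by apply/funext => i; rewrite /seq_shift /susp addnS addSn. Qed.

Lemma susp_period x : susp n x = susp 0 (@seq_shift T t0 x).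
Proof.
apply/funext => i; rewrite /susp /seq_shift divnDl// divnn n0 add1n add0n.
by rewrite modnDl.
Qed.

Definition suspf j : {mfun seqspace t0 >-> seqspace a0} :=
  HB.pack (susp j) (isMeasurableFun.Build _ _ _ _ _ (measurable_susp j)).

Definition susp_sum : {measure set (seqspace a0) -> \bar R} :=
  msum (fun j => distribution nu (suspf j) : {measure set (seqspace a0) -> \bar R}) n.

(** Independent blocks written one after the other, read from a uniformly chosen
    position of the first block: averaging over this position gives invariance. *)
Definition susp_prob : probability (seqspace a0) R :=
  mnormalize susp_sum (distribution nu (suspf 0)).

Lemma susp_sumE E : susp_sum E = (\sum_(j < n) nu (susp j @^-1` E))%E.
Proof. by []. Qed.

Lemma susp_probE E : measurable E ->
  susp_prob E = ((n%:R^-1)%:E * \sum_(j < n) nu (susp j @^-1` E))%E.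
Proof.
move=> mE.
have sT : susp_sum setT = (n%:R)%:E.
  rewrite susp_sumE (eq_bigr (fun=> 1%E)); last first.
    by move=> j _; rewrite preimage_setT; exact: probability_setT.
  by rewrite sumEFin sumr_const card_ord.
rewrite /susp_prob /= /mnormalize sT /=.
rewrite eqe pnatr_eq0 -leqn0 leqNgt n0/=.
by rewrite muleC.
Qed.

Lemma susp_invariant : shift_invariant susp_prob.
Proof.
move=> E mE.
have mE' : measurable (@seq_shift L a0 @^-1` E).
  by have := @measurable_shift L a0 measurableT E mE; rewrite setTI.
rewrite !susp_probE//; congr (_ * _)%E.
have pj j : susp j @^-1` (@seq_shift L a0 @^-1` E) = susp j.+1 @^-1` E.
  by apply/seteqP; split=> x /=; rewrite susp_shift.
under eq_bigr do rewrite pj.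
apply: (@sum_rot _ (fun j => nu (susp j @^-1` E))) => //.
have mS : measurable (susp 0 @^-1` E).
  by have := measurable_susp 0 measurableT mE; rewrite setTI.
rewrite -(bernoulli_invariant qD nuP mS); congr (nu _).
by apply/seteqP; split=> x /=; rewrite susp_period.
Qed.

Lemma mfin_susp_pref j m : mfin (pref m \o susp j).
Proof.
move=> w; have := measurable_susp j measurableT (@mfin_pref L a0 m w).
by rewrite setTI.
Qed.

Lemma law_susp m w : law susp_prob (pref m) w =
  n%:R^-1 * \sum_(j < n) law nu (pref m \o susp j) w.
Proof.
apply: EFin_inj; rewrite -lawE; last exact: mfin_pref.
rewrite susp_probE; last exact: mfin_pref.
rewrite EFinM -sumEFin; congr (_ * _)%E; apply: eq_bigr => j _.
by rewrite -lawE//; exact: mfin_susp_pref.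
Qed.

Definition flat J (u : J.-tuple T) : seq L := flatten (map val u).

Lemma size_flat J (u : J.-tuple T) : size (flat u) = (J * n)%N.
Proof.
rewrite /flat -{2}(size_tuple u); elim: (tval u) => //= t s IH.
by rewrite size_cat IH size_tuple mulSn.
Qed.

Lemma nth_flat J (u : J.-tuple T) k : (k < J * n)%N ->
  nth a0 (flat u) k = nth a0 (nth t0 u (k %/ n)) (k %% n).
Proof.
move=> kJ; rewrite /flat (@nth_flatten_const _ _ n)//; first last.
- by rewrite size_map size_tuple.
- move=> v /List.in_map_iff[t [<- _]]; exact: size_tuple.
congr (nth _ _ _); rewrite (nth_map t0)// size_tuple ltn_divLR//.
Qed.

Definition win J j (u : J.+1.-tuple T) : (J * n).-tuple L :=
  [tuple nth a0 (flat u) (j + i) | i < J * n].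

Lemma val_win J j (u : J.+1.-tuple T) : (j <= n)%N ->
  val (win j u) = take (J * n) (drop j (flat u)).
Proof.
move=> jn; have sz : size (take (J * n) (drop j (flat u))) = (J * n)%N.
  rewrite size_takel// size_drop size_flat mulSn addnC.
  by rewrite -addnBA// leq_addr.
apply: (@eq_from_nth _ a0); first by rewrite size_tuple.
move=> i; rewrite size_tuple => iJ; rewrite nth_take// nth_drop.
have := tnth_mktuple (fun i : 'I_(J * n) => nth a0 (flat u) (j + i)) (Ordinal iJ).
by rewrite (tnth_nth a0).
Qed.

Lemma pref_susp J j (x : seqspace t0) : (j <= n)%N ->
  pref (J * n) (susp j x) = win j (pref J.+1 x).
Proof.
move=> jn; apply: eq_from_tnth => i; rewrite !tnth_mktuple /susp.
have ji : (j + i < J.+1 * n)%N by rewrite mulSn -addnS; apply: leq_add => //; exact: ltn_ord.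
rewrite nth_flat//; congr (nth _ _ _).
have := val_pref J.+1 x => /= ->; rewrite nth_mkseq//.
by rewrite ltn_divLR.
Qed.

Lemma law_susp_win J j w : (j <= n)%N ->
  law nu (pref (J * n) \o susp j) w = push (@win J j) (prodlaw q (n := J.+1)) w.
Proof.
move=> jn; have -> : pref (J * n) \o susp j = @win J j \o pref J.+1.
  by apply/funext => x; rewrite /= pref_susp.
rewrite law_comp; last exact: mfin_pref.
by apply: eq_bigr => u _; rewrite nuP.
Qed.

Lemma flat_split J j (u : J.+1.-tuple T) :
  (j <= n)%N -> exists v w, flat u = v ++ tval (win j u) ++ w /\ (size v + size w)%N = n.
Proof.
move=> jn; exists (take j (flat u)), (drop (J * n) (drop j (flat u))).
rewrite (val_win u jn : tval _ = _) !cat_take_drop; split=> //.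
have jf : (j <= size (flat u))%N by rewrite size_flat mulSn; apply: leq_trans jn _; exact: leq_addr.
rewrite size_takel// !size_drop size_flat mulSn; move: jn; move: (J * n)%N; clear.
by move=> t; lia.
Qed.

Lemma susp_Ex_ge J (f : seq L -> R) (g : T -> R) c :
  (forall (u : J.+1.-tuple T) j, (j < n)%N -> (forall t, t \in tval u -> 0 < q t) ->
    \sum_(t <- u) g t - c <= f (win j u)) ->
  J.+1%:R * (\sum_t q t * g t) - c <= Ex susp_prob (J * n) f.
Proof.
move=> fg; have nR : 0 < n%:R :> R by rewrite ltr0n.
have -> : Ex susp_prob (J * n) f =
    n%:R^-1 * \sum_(j < n) \sum_u prodlaw q u * f (@win J j u).
  rewrite /Ex; under eq_bigr => w _ do rewrite law_susp -mulrA mulr_suml.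
  rewrite -mulr_sumr exchange_big/=; congr (_ * _); apply: eq_bigr => j _.
  rewrite -(push_sum (@win J j) _ (fun w => f w)); apply: eq_bigr => w _.
  by rewrite law_susp_win// ltnW.
rewrite ler_pdivlMl//.
have -> : n%:R * (J.+1%:R * (\sum_t q t * g t) - c) =
    \sum_(j < n) (J.+1%:R * (\sum_t q t * g t) - c).
  by rewrite sumr_const card_ord mulr_natl.
apply: ler_sum => j _.
by apply: (prodlaw_mean_ge qD (f := fun u => f (win j u))) => u uq; exact: fg.
Qed.

(** A window of [J] blocks together with its offset and its two extreme blocks
    determines the [J + 1] blocks it comes from. *)
Lemma susp_ent_ge J : (0 < J)%N ->
  J.+1%:R * ent q - ln #|{: 'I_n * (T * T)}|%:R <= ent (law susp_prob (pref (J * n))).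
Proof.
move=> J0; have nR : 0 < n%:R :> R by rewrite ltr0n.
have [w0 w1] := prodlaw_distr qD J.+1.
pose mu (s : 'I_n * J.+1.-tuple T) := n%:R^-1 * prodlaw q s.2.
have mu_sum (F : 'I_n * J.+1.-tuple T -> R) : \sum_s F s = \sum_(j < n) \sum_u F (j, u).
  by rewrite pair_big/=; apply: eq_bigr => -[].
have muD : is_distr mu.
  split; first by move=> s; rewrite mulr_ge0 ?invr_ge0.
  rewrite mu_sum /mu/=; under eq_bigr do rewrite -mulr_sumr w1 mulr1.
  by rewrite sumr_const card_ord -[LHS]mulr_natl mulfV// gt_eqF.
pose wn (s : 'I_n * J.+1.-tuple T) := win s.1 s.2.
have lawE : law susp_prob (pref (J * n)) =1 push wn mu.
  move=> w; rewrite law_susp /push [RHS]big_mkcond mu_sum mulr_sumr; apply: eq_bigr => j _.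
  rewrite law_susp_win; last exact: ltnW.
  by rewrite /push -big_mkcond mulr_sumr.
pose ex (s : 'I_n * J.+1.-tuple T) := (s.1, (tnth s.2 ord0, tnth s.2 ord_max)).
have inj : injective (fun s => (wn s, ex s)).
  move=> [j u] [j' u'] /= e.
  have wE : wn (j, u) = wn (j', u') := congr1 fst e.
  have xE : ex (j, u) = ex (j', u') := congr1 snd e.
  have jE : j = j' := congr1 fst xE; subst j'.
  have u0 : tnth u ord0 = tnth u' ord0 := congr1 (fun p => p.2.1) xE.
  have u1 : tnth u ord_max = tnth u' ord_max := congr1 (fun p => p.2.2) xE.
  congr (_, _); apply: eq_from_tnth => b.
  have [b0|b0] := eqVneq b ord0; first by rewrite b0.
  have [b1|b1] := eqVneq b ord_max; first by rewrite b1.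
  apply: eq_from_tnth => i.
  have bp : (0 < b)%N by rewrite lt0n; apply: contra_neq b0 => h; exact: val_inj.
  have bJ : (b < J)%N.
    by rewrite ltn_neqAle -ltnS ltn_ord andbT; apply: contra_neq b1 => h; exact: val_inj.
  have flatE (v : J.+1.-tuple T) : tnth (tnth v b) i = nth a0 (flat v) (b * n + i).
    rewrite nth_flat; last first.
      have := ltn_ord i; have bJ1 : (b < J.+1)%N by [].
      by move=> ?; apply: (@leq_trans (b.+1 * n)); rewrite ?leq_mul2r ?bJ1 ?orbT// mulSn addnC ltn_add2r.
    rewrite divnMDl// divn_small// addn0 modnMDl modn_small//.
    by rewrite -!tnth_nth.
  have jb : (j <= b * n + i)%N.
    by apply: leq_trans (ltnW (ltn_ord j)) _; apply: leq_trans (leq_addr _ _); rewrite leq_pmull.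
  have kJ : (b * n + i - j < J * n)%N.
    apply: leq_ltn_trans (leq_subr _ _) _; apply: (@leq_trans (b.+1 * n)); last by rewrite leq_mul2r bJ orbT.
    by rewrite mulSn addnC ltn_add2r.
  rewrite !flatE -(subnKC jb).
  have := congr1 (fun w => tnth w (Ordinal kJ)) wE.
  by rewrite !tnth_mktuple.
rewrite (eq_ent lawE) lerBlDr.
have := ent_pair_le muD inj.
have := ent_le_card (push_distr ex muD).
have : J.+1%:R * ent q <= ent mu.
  rewrite -(prodlaw_ent qD J.+1) -(eq_ent (m := push snd mu)).
    exact: ent_push_le.
  move=> u; rewrite /push [LHS]big_mkcond mu_sum /mu/=.
  transitivity (\sum_(j < n) n%:R^-1 * prodlaw q u).
    by apply: eq_bigr => j _; rewrite -big_mkcond/= (big_pred1 u).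
  by rewrite sumr_const card_ord -[LHS]mulr_natl mulVKf// gt_eqF.
move: (ent mu) (ent (push wn mu)) (ent (push ex mu)) (ln _) (J.+1%:R * ent q).
by move=> a b d e h *; lra.
Qed.

Lemma susp_entropy : n%:R^-1 * ent q <= entropy susp_prob.
Proof.
have [ecvg _] := entropyP susp_invariant.
apply: (subseq_lower (c := ln #|{: 'I_n * (T * T)}|%:R) n0 ecvg) => J J0.
have JnR : (J * n)%:R != 0 :> R by rewrite pnatr_eq0 muln_eq0 negb_or -!lt0n J0.
rewrite mulVKf//; apply: le_trans (susp_ent_ge J0).
by rewrite lerD2r ler_wpM2r ?ent_ge0// ler_nat.
Qed.

Variable A : L -> 'M[R]_2.
Hypothesis Au : forall a, A a \in unitmx.

Lemma susp_lnd : n%:R^-1 * (\sum_t q t * lnd (wprod A t)) <= lnd_mean susp_prob A.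
Proof.
have [K K0 KP] := lnd_size_le Au; set G := \sum_t _.
apply: (@subseq_lower _ _ (fun=> lnd_mean susp_prob A) _ _ (`|G| + K * n%:R) n0 (cvg_cst _)).
move=> J J0; rewrite -(Ex_lnd susp_invariant Au).
apply: le_trans (susp_Ex_ge (J := J) (g := fun t => lnd (wprod A t)) (c := K * n%:R) _).
  rewrite -/G -[J.+1%:R]natr1 mulrDl mul1r.
  have := ler_norm (- G); rewrite normrN.
  by move: (J%:R * G) (K * n%:R) (`|G|) => *; lra.
move=> u j jn _; have [v [w [fE vw]]] := flat_split u (ltnW jn).
have : lnd (wprod A (flat u)) = \sum_(t <- u) lnd (wprod A t).
  rewrite /flat; elim: (tval u) => [|t ts IH].
    by rewrite big_nil wprod_nil /lnd det1 normr1 ln1.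
  by rewrite /= lnd_cat// IH big_cons.
have -> : K * n%:R = K * (size v)%:R + K * (size w)%:R by rewrite -vw natrD mulrDr.
rewrite fE !lnd_cat// => <-.
have := KP v; have := KP w; rewrite !ler_norml.
move: (lnd (wprod A v)) (lnd (wprod A w)) (lnd (wprod A (win j u))).
move: (K * (size v)%:R) (K * (size w)%:R) => a b c d e.
by move=> /andP[? ?] /andP[? ?]; lra.
Qed.

Lemma susp_lna C :
  (forall gs : seq T, (forall t, t \in gs -> 0 < q t) ->
    \sum_(t <- gs) (lna (wprod A t) - C) - C <= lna (wprod A (flatten (map val gs)))) ->
  n%:R^-1 * (\sum_t q t * lna (wprod A t) - C) <= lambda1 susp_prob A.
Proof.
move=> H; have [K K0 KP] := lna_size_le Au; set G := _ - C.
have [lcvg _] := lambda1P susp_invariant Au.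
have [_ q1] := qD.
have GE : \sum_t q t * (lna (wprod A t) - C) = G.
  under eq_bigr => t _ do rewrite mulrBr.
  by rewrite sumrB -mulr_suml q1 mul1r.
apply: (subseq_lower (c := `|G| + (C + K * n%:R)) n0 lcvg) => J J0.
have JnR : (J * n)%:R != 0 :> R by rewrite pnatr_eq0 muln_eq0 negb_or -!lt0n J0.
rewrite mulVKf//.
apply: le_trans (susp_Ex_ge (J := J) (g := fun t => lna (wprod A t) - C) (c := C + K * n%:R) _).
  rewrite GE -[J.+1%:R]natr1 mulrDl mul1r.
  have := ler_norm (- G); rewrite normrN.
  by move: (J%:R * G) (K * n%:R) (`|G|) => *; lra.
move=> u j jn uq; have [v [w [fE vw]]] := flat_split u (ltnW jn).
have := H (tval u) uq; rewrite -/(flat u) fE.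
have := lna_cat Au v (tval (win j u) ++ w); have := lna_cat Au (win j u) w.
have -> : K * n%:R = K * (size v)%:R + K * (size w)%:R by rewrite -vw natrD mulrDr.
have := KP v; have := KP w.
move: (lna (wprod A (v ++ _))) (lna (wprod A (_ ++ w))) (lna (wprod A v)) (lna (wprod A w)).
move: (K * (size v)%:R) (K * (size w)%:R) (lna _) (\sum_(_ <- _) _) => a b c d *.
lra.
Qed.

End Suspension.

(** * The variational functional at zero pressure *)

Lemma sum_tuple_cat (V : nmodType) (L : finType) m n (F : (m + n).-tuple L -> V) :
  \sum_w F w = \sum_(u : m.-tuple L) \sum_(v : n.-tuple L) F [tuple of u ++ v].
Proof.
rewrite pair_bigA/= (reindex (fun p : m.-tuple L * n.-tuple L => [tuple of p.1 ++ p.2]))//=.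
apply: onW_bij.
exists (fun w => ([tuple tnth w (lshift n i) | i < m], [tuple tnth w (rshift m i) | i < n])).
  move=> [u v] /=; congr (_, _); apply: eq_from_tnth => i; rewrite tnth_mktuple.
    by rewrite tnth_lshift.
  by rewrite tnth_rshift.
move=> w; apply: eq_from_tnth => k.
case: (split_ordP k) => i ->; first by rewrite tnth_lshift tnth_mktuple.
by rewrite tnth_rshift tnth_mktuple.
Qed.

Section Pressure.
Variables (R : realType) (L : finType) (a0 : L) (A : L -> 'M[R]_2) (s : R).
Hypothesis Au : forall a, A a \in unitmx.
Hypothesis s02 : 0 < s < 2.

Definition partition_sum n : R := \sum_(w : n.-tuple L) expR (lnphi s (wprod A w)).

Lemma partition_sum_gt0 n : 0 < partition_sum n.
Proof.
rewrite /partition_sum (bigD1 (nseq_tuple n a0))//=.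
by rewrite ltr_pwDl ?expR_gt0// sumr_ge0// => w _; exact: expR_ge0.
Qed.

Lemma partition_sum_sub m n :
  partition_sum (m + n) <= partition_sum m * partition_sum n.
Proof.
rewrite /partition_sum sum_tuple_cat mulr_suml; apply: ler_sum => u _.
rewrite mulr_sumr; apply: ler_sum => v _.
by rewrite -expRD ler_expR/= wprod_cat addrC lnphi_mul ?wprod_unit.
Qed.

Lemma pressureE :
  pressure s A = limn (fun n => n%:R^-1 * ln (partition_sum n)).
Proof.
rewrite /pressure; congr (limn _); apply/funext => n; congr (_ * ln _).
rewrite /partition_sum (reindex_inj (h := fun w : n.-tuple L => [tuple of rev w])).
  by apply: eq_bigr => w _; rewrite -svfE ?wprod_unit// /wprod.
by move=> u v /(congr1 val)/= /(congr1 rev); rewrite !revK => /val_inj.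
Qed.

Lemma pressureP : (fun n => n%:R^-1 * ln (partition_sum n)) @ \oo --> pressure s A.
Proof.
have [K K0 KP] := lnd_size_le Au.
have t0 := svt_gt0 s02; have u0 := svu_ge0 s.
have [||l [lc _]] := @fekete R (fun n => ln (partition_sum n)) (svt s * (K / 2) + svu s * K).
- move=> m n; rewrite -lnM ?posrE ?partition_sum_gt0//.
  by rewrite ler_ln ?posrE ?mulr_gt0 ?partition_sum_gt0// partition_sum_sub.
- move=> n; rewrite -[leLHS]expRK ler_ln ?posrE ?expR_gt0 ?partition_sum_gt0//.
  rewrite /partition_sum (bigD1 (nseq_tuple n a0))//=.
  apply: (@le_trans _ _ (expR (lnphi s (wprod A (nseq_tuple n a0))))); last first.
    by rewrite lerDl sumr_ge0// => w _; exact: expR_ge0.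
  rewrite ler_expR /lnphi.
  have := lnd_le (wprod_unit Au (nseq_tuple n a0)).
  have := KP (nseq_tuple n a0); rewrite size_tuple ler_norml => /andP[h1 _] h2.
  have := ler_wpM2l u0 h1.
  have : - (K / 2 * n%:R) <= lna (wprod A (nseq_tuple n a0)).
    by move: h1 h2; move: (lna _) (lnd _) n%:R => a b x; lra.
  move/(ler_wpM2l (ltW t0)).
  by move: (svt s) (svu s) (lna _) (lnd _) n%:R => t u a b x; lra.
by rewrite pressureE (cvg_lim _ lc).
Qed.

(** The Gibbs weights realise equality in the variational principle on words of
    a given length. *)
Lemma gibbs_weights N : exists2 q : N.-tuple L -> R, is_distr q &
  ln (partition_sum N) = ent q + (svt s * (\sum_w q w * lna (wprod A w)) +
    svu s * (\sum_w q w * lnd (wprod A w))).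
Proof.
pose Z := partition_sum N; have Z0 : 0 < Z by exact: partition_sum_gt0.
pose q (w : N.-tuple L) := expR (lnphi s (wprod A w)) / Z.
have q1 : \sum_w q w = 1 by rewrite -mulr_suml mulfV// gt_eqF.
exists q; first by split=> // w; rewrite divr_ge0 ?expR_ge0// ltW.
have -> : ln (partition_sum N) = \sum_w q w * ln Z by rewrite -mulr_suml q1 mul1r.
rewrite !mulr_sumr -!big_split/=; apply: eq_bigr => w _.
have -> : ln (q w) = lnphi s (wprod A w) - ln Z.
  by rewrite ln_div ?posrE ?expR_gt0// expRK.
by rewrite /lnphi; ring.
Qed.

End Pressure.

(** The value of the variational functional at a Kaenmaki measure is nonnegative:
    the Gibbs weights on long words, made multiplicative by inserting bounded
    connecting words, give invariant measures at which the functional is almost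
    as large as the pressure. *)
Lemma kaenmaki_functional_ge0 (R : realType) (L : finType) (a0 : L)
    (A : L -> 'M[R]_2) (mu : probability (seqspace a0) R) :
  (forall a, A a \in unitmx) -> 0 < dim_AFF A < 2 -> ~ has_invariant_line A ->
  (exists i, hyperbolic (A i)) -> kaenmaki_measure A mu ->
  0 <= entropy mu + (svt (dim_AFF A) * lambda1 mu A + svu (dim_AFF A) * lnd_mean mu A).
Proof.
move=> Au; set s := dim_AFF A => s02 irr hyp [mu_inv mu_max].
have P0 : pressure s A = 0.
  have : s != 0 by rewrite gt_eqF//; case/andP: s02.
  by rewrite /s /dim_AFF; case: xgetP => [_ -> [_ ->]//|_]; rewrite eqxx.
have Pc := pressureP a0 Au s02; rewrite P0 in Pc.
have [i0 hi0] := hyp.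
have hz : hyperbolic (wprod A [:: i0]) by rewrite wprod_seq1.
have [C0 [C [d [coneC C0' _ _ blk]]]] := block_lemma Au (isT : (0 < size [:: i0])%N) irr hyp hz.
have t0 := svt_gt0 s02; have u0 := svu_ge0 s.
set F := _ + _.
pose C1 := C + svt s * (C + C) + svu s * C.
apply: (cvg_le_div (C := F * d%:R + C1 / 2) Pc (cvg_cst F)) => N N0.
have NR : 0 < N%:R :> R by rewrite ltr0n.
rewrite -(ler_pM2l NR) mulrDr !mulVKf ?gt_eqF//.
have [q qD ->] := gibbs_weights a0 A s N.
have [q' [q'D _ qe [qa qd] qm]] := blk N q qD.
set n := (2 * (N + d))%N in q' q'D qe qa qd qm.
have n0 : (0 < n)%N by rewrite muln_gt0 addn_gt0 N0.
have [nu nuP] := bernoulli_exists (nseq_tuple n a0) q'D.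
have rho_inv := susp_invariant (a0 := a0) n0 q'D nuP.
have := mu_max _ rho_inv.
rewrite !kaenmaki_functionalE//.
have := susp_entropy a0 n0 q'D nuP.
have /(ler_wpM2l u0) := susp_lnd a0 n0 q'D nuP Au.
have /(ler_wpM2l (ltW t0)) := susp_lna a0 n0 q'D nuP Au qm.
rewrite -/F; move=> ha hd he hF.
have nR : 0 < n%:R :> R by rewrite ltr0n.
have h : n%:R^-1 * (ent q' + svt s * (\sum_t q' t * lna (wprod A t) - C) +
    svu s * \sum_t q' t * lnd (wprod A t)) <= F.
  apply: le_trans hF; move: ha hd he.
  move: (entropy _) (lambda1 _ _) (lnd_mean _ _) (ent q') n%:R^-1 (svt s) (svu s).
  by move: (\sum_t _) (\sum_t _) => a b e l m e' k t u; lra.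
move: h; rewrite ler_pdivrMl// natrM natrD.
move: qe qa qd; rewrite !ler_norml => /andP[h1 _] /andP[/(ler_wpM2l (ltW t0)) h2 _].
move=> /andP[/(ler_wpM2l u0) h3 _]; move: h1 h2 h3; rewrite /C1.
move: (ent q') (ent q) (\sum_t q' t * lna _) (\sum_t q' t * lnd _).
move: (\sum_w q w * lna _) (\sum_w q w * lnd _) (svt s) (svu s) => x y t u.
move: N%:R d%:R (F : R) => N1 d1 F1 e e' x' y'.
by clear => *; lra.
Qed.

(** * Dominated approximation of invariant measures *)

Section LyapunovDimension.
Variable R : realType.
Implicit Types h l s : R.

Definition lyapunov_dimension h l1 l2 : R :=
  if h < - l1 then h / - l1
  else if h < - l1 - l2 then 1 + (h + l1) / - l2
  else 2 * h / (- l1 - l2).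

(** The Lyapunov dimension is the inverse of a piecewise linear function of the
    entropy whose slopes are at least [- l1]. *)
Lemma lyapunov_dimension_ge s h l1 l2 (e K : R) : 0 < s < 2 -> 0 <= e -> 0 < K ->
  l1 <= - K -> l2 <= l1 -> - (e * K) <= h + (svt s * l1 + svu s * (l1 + l2)) ->
  s - e <= lyapunov_dimension h l1 l2.
Proof.
move=> /andP[s0 s2] e0 K0 l1K l21 H; rewrite /lyapunov_dimension.
have eK1 : e * K <= e * - l1 by rewrite ler_wpM2l//; lra.
have eK2 : e * K <= e * - l2 by rewrite ler_wpM2l//; lra.
move: H; rewrite /svt /svu; case: (ltP s 1) => s1 H; case: (ltP h (- l1)) => h1.
- by rewrite ler_pdivlMr; [nra|lra].
- case: ltP => h2; last by rewrite ler_pdivlMr; [nra|lra].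
  rewrite -lerBlDl ler_pdivlMr; last lra.
  have : 0 <= (1 - s + e) * - l2 by rewrite mulr_ge0; lra.
  by lra.
- rewrite ler_pdivlMr; last lra.
  have : 0 <= (s - 1) * (l1 - l2) by rewrite mulr_ge0; lra.
  by lra.
case: ltP => h2; first by rewrite -lerBlDl ler_pdivlMr; lra.
rewrite ler_pdivlMr; last lra.
have : 0 <= (2 - s) * (- l1 - l2) by rewrite mulr_ge0; lra.
have : 0 <= e * (- l1 - l2) by rewrite mulr_ge0; lra.
by lra.
Qed.

(** Transfers closeness per letter from words of length [N] to the blocks of length
    [2 * (N + d)] made from them. *)
Lemma scaled_close (X E0 C x N d del : R) : 0 < N -> 0 <= d -> 0 <= C -> 0 <= del ->
  `|X - 2 * E0| <= 2 * C -> `|x - N^-1 * E0| <= del / 2 ->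
  2 * C + 2 * (d * `|x|) <= del * N ->
  `|X - (2 * (N + d)) * x| <= (2 * (N + d)) * del.
Proof.
move=> N0 d0 C0 del0 h1 h2 h3.
have h4 : `|2 * E0 - 2 * N * x| <= N * del.
  have -> : 2 * E0 - 2 * N * x = - (2 * N) * (x - N^-1 * E0) by field; rewrite gt_eqF.
  rewrite normrM normrN (@gtr0_norm _ (2 * N)); last lra.
  have : 0 <= 2 * N by lra.
  by move=> /ler_wpM2l/(_ _ _ h2); lra.
have -> : X - 2 * (N + d) * x = (X - 2 * E0) + ((2 * E0 - 2 * N * x) - 2 * (d * x)) by ring.
apply: le_trans (ler_normD _ _) _; apply: le_trans (lerD h1 (ler_normB _ _)) _.
rewrite [`|2 * (_ * _)|]normrM [`|d * x|]normrM (ger0_norm d0) (ger0_norm (ler0n _ 2)).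
have : 0 <= d * del by rewrite mulr_ge0.
by move: h4 h3; move: (`|x|) (`|2 * E0 - _|) => a b; lra.
Qed.

Lemma sum_sig (T : finType) (P : {set T}) (F : T -> R) :
  (forall x, x \notin P -> F x = 0) -> \sum_(w : {w | w \in P}) F (val w) = \sum_x F x.
Proof.
move=> F0; rewrite [RHS](bigID (mem P))/= [X in _ + X]big1 ?addr0//.
rewrite (@reindex_omap _ _ _ _ {w | w \in P} val insub)/=; last by move=> x xP; rewrite insubT.
by apply: eq_bigl => w; rewrite (valP w) valK eqxx.
Qed.

End LyapunovDimension.

Lemma wprod_flatten (R : realType) (L : finType) (A : L -> 'M[R]_2) n
    (Gamma : {set n.-tuple L}) (w : seq {w | w \in Gamma}) :
  wprod (sub_matrices A (Gamma := Gamma)) w = wprod A (flatten (map val (map val w))).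
Proof.
elim: w => [|g w IH]; first by rewrite !wprod_nil.
by rewrite wprod_cons IH [RHS]wprod_cat.
Qed.

Lemma lna_contracting (R : realType) (L : finType) (a0 : L) (A : L -> 'M[R]_2) :
  (forall a, A a \in unitmx) -> (forall a, opnorm (A a) < 1) ->
  exists2 th, 0 < th & forall w, lna (wprod A w) <= - (th * (size w)%:R).
Proof.
move=> Au A1; have [b _ bP] := @arg_maxP _ R L a0 predT (fun a => lna (A a)) isT.
have b0 : lna (A b) < 0.
  by rewrite /lna ln_lt0// alpha1_gt0//= (le_lt_trans (alpha1_opnorm _)).
exists (- lna (A b)); first by rewrite oppr_gt0.
elim=> [|a w IH]; first by rewrite mulr0 oppr0 wprod_nil lna1.
have := bP a isT; have := lna_cat Au [:: a] w; rewrite wprod_seq1 /=.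
by rewrite -[(size w).+1%:R]natr1; move: IH; move: (lna _) (lna _) (lna _) (lna _) (size w)%:R => *; lra.
Qed.

(** Take for [nu] the product measure built by [block_lemma] from the weights that
    [mu] gives to the words of a large length [N]: per letter, its entropy and
    exponents differ from those of [mu] by an amount of order [1 / N], plus the
    error of approximating the limits that define those of [mu]. The set [Gamma]
    consists of all block words, some possibly of weight zero, so that
    [block_rigid] applies. Prescribing the prefix [z] serves the separation
    condition. *)
Lemma dominated_approximation_exists (R : realType) (L : finType) (a0 : L) (A : L -> 'M[R]_2)
    (mu : probability (seqspace a0) R) (z : seq L) :
  (forall a, A a \in unitmx) -> (forall a, opnorm (A a) < 1) ->
  0 < dim_AFF A < 2 -> ~ has_invariant_line A -> (exists i, hyperbolic (A i)) ->
  shift_invariant mu ->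
  0 <= entropy mu + (svt (dim_AFF A) * lambda1 mu A + svu (dim_AFF A) * lnd_mean mu A) ->
  (0 < size z)%N -> hyperbolic (wprod A z) ->
  forall eps : R, 0 < eps ->
  exists (n : nat) (Gamma : {set n.-tuple L}) (w0 : {w : n.-tuple L | w \in Gamma})
    (nu : probability (seqspace w0) R),
    [/\ (0 < n)%N, bernoulli_measure nu, dominated_approximation A mu eps nu &
        forall w : n.-tuple L, w \in Gamma -> prefix z w].
Proof.
move=> Au A1; set s := dim_AFF A => s02 irr hyp mu_inv F0 z0 hz eps eps0.
have [C0 [C [d [coneC C0' zd rigid blk]]]] := block_lemma Au z0 irr hyp hz.
have [th th0 thP] := lna_contracting a0 Au A1.
pose h := entropy mu; pose a := lambda1 mu A; pose D := lnd_mean mu A.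
pose del := Num.min (eps / 2) (eps * th / 3).
have del0 : 0 < del by rewrite lt_min !divr_gt0// mulr_gt0.
have [del1 del2] : del <= eps / 2 /\ del <= eps * th / 3.
  by rewrite /del; split; rewrite ge_min lexx ?orbT.
have del02 : 0 < del / 2 by rewrite divr_gt0.
have [ecvg _] := entropyP mu_inv; have [acvg _] := lambda1P mu_inv Au.
have /cvgrPdist_le/(_ _ del02)[N1 _ hN] := ecvg.
have /cvgrPdist_le/(_ _ del02)[N2 _ aN] := acvg.
pose E := (2 * C + 2 * (d%:R * `|h|)) + (2 * (d%:R * `|a|) + 2 * (d%:R * `|D|)).
have dR : 0 <= d%:R :> R by rewrite ler0n.
have [dh da dD] : [/\ 0 <= d%:R * `|h|, 0 <= d%:R * `|a| & 0 <= d%:R * `|D|] by rewrite !mulr_ge0.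
have [N3 EN3] : exists N3, E <= del * N3%:R.
  exists (Num.bound (E / del)); rewrite -ler_pdivrMl// mulrC.
  apply/ltW/archi_boundP/divr_ge0; last exact: ltW.
  by rewrite /E; lra.
have [m0 m0P] : exists m0, strongly_irreducible A -> forall m (Vs : seq {vspace 'cV[R]_2}),
    (m0 <= m)%N -> Vs != [::] -> (forall V, V \in Vs -> \dim V = 1%N) ->
    ~ (forall g, size g = (2 * (size z * m))%N -> block_word A z C0 g ->
        mulmx (wprod A g) @` line_union Vs `<=` line_union Vs).
  have [/rigid[m0 m0P]|nsi] := pselect (strongly_irreducible A); first by exists m0 => _.
  by exists 0%N => /nsi.
(* [N] is a multiple of [size z] so that the block length has the form required
   by [block_rigid] *)
pose N' := (N1 + N2 + N3 + m0).+1; pose N := (size z * N')%N.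
have NN' : (N' <= N)%N by rewrite leq_pmull.
have N0 : (0 < N)%N by exact: leq_trans NN'.
have NR : 0 < N%:R :> R by rewrite ltr0n.
have [le1 le2 le3] : [/\ (N1 <= N)%N, (N2 <= N)%N & (N3 <= N)%N].
  by split; apply: leq_trans NN'; rewrite /N'; clear; lia.
have EN : E <= del * N%:R by apply: le_trans EN3 _; apply: (ler_wpM2l (ltW del0)); rewrite ler_nat.
have qD := law_distr mu (@mfin_pref L a0 N).
have [q' [q'D q'G qe [qa qd] qm]] := blk N _ qD.
set n := (2 * (N + d))%N in q' q'D q'G qe qa qd qm.
have nE : n%:R = 2 * (N%:R + d%:R) :> R by rewrite natrM natrD.
have n0 : (0 < n)%N by rewrite muln_gt0 addn_gt0 N0.
have nR : 0 < n%:R :> R by rewrite ltr0n.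
pose Gamma : {set n.-tuple L} := [set g : n.-tuple L | `[< block_word A z C0 g >]]%SET.
have GP (g : n.-tuple L) : g \in Gamma <-> block_word A z C0 g.
  by rewrite /Gamma finset.inE; split=> /asboolP.
have [q'0 q'1] := q'D.
have q'out g : g \notin Gamma -> q' g = 0.
  move=> gG; apply/eqP; rewrite eq_le q'0 andbT leNgt; apply: contra gG => /q'G.
  by move/GP.
have [g0 g0G] : exists g, g \in Gamma.
  apply: contrapT => noG; have /eqP : \sum_g q' g = 0.
    by rewrite big1// => g _; apply: q'out; apply/negP => gG; apply: noG; exists g.
  by rewrite q'1 oner_eq0.
pose T := {w : n.-tuple L | w \in Gamma}; pose w0 : T := exist _ g0 g0G.
pose p (w : T) := q' (val w).
have pD : is_distr p.
  by split=> [w|]; [exact: q'0 | rewrite (sum_sig (F := q'))].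
have [nu nuP] := bernoulli_exists w0 pD.
pose B : T -> 'M[R]_2 := sub_matrices A (Gamma := Gamma).
have Bu (w : T) : B w \in unitmx by exact: wprod_unit.
have nu_inv := bernoulli_invariant pD nuP.
have hE : entropy nu = ent q'.
  rewrite (bernoulli_entropy pD nuP) /ent.
  by rewrite (sum_sig (F := fun g => - (q' g * ln (q' g))))// => g /q'out ->; rewrite mul0r oppr0.
have DE : lnd_mean nu B = \sum_g q' g * lnd (wprod A g).
  rewrite (bernoulli_lnd_mean pD nuP B).
  by rewrite (sum_sig (F := fun g : n.-tuple L => q' g * lnd (wprod A g)))// => g /q'out ->; rewrite mul0r.
have aE : \sum_w p w * lna (B w) = \sum_g q' g * lna (wprod A g).
  by rewrite (sum_sig (F := fun g : n.-tuple L => q' g * lna (wprod A g)))// => g /q'out ->; rewrite mul0r.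
have a_le := bernoulli_lambda1_le pD nuP Bu; rewrite aE in a_le.
have a_ge : \sum_g q' g * lna (wprod A g) - C <= lambda1 nu B.
  rewrite -aE; apply: (bernoulli_lambda1_ge pD nuP Bu) => w wp.
  rewrite wprod_flatten; have := qm (map val w); rewrite big_map; apply.
  by move=> _ /mapP[t tw ->]; exact: wp.
have cl_h : `|entropy nu - n%:R * h| <= n%:R * del.
  rewrite nE hE; apply: (scaled_close NR dR C0' (ltW del0) _ (hN N le1)).
    by apply: le_trans qe _; move: C0'; clear; lra.
  by apply: le_trans EN; move: dh da dD C0'; rewrite /E; clear; lra.
have cl_a : `|lambda1 nu B - n%:R * a| <= n%:R * del.
  rewrite nE; apply: (scaled_close NR dR C0' (ltW del0) _ (aN N le2)).
    move: qa a_le a_ge C0'; rewrite /Ex.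
    move: (\sum_g _) (\sum_w _) (lambda1 _ _) (C : R); clear => x y l c.
    by rewrite !ler_norml => /andP[? ?] ? ? ?; apply/andP; split; lra.
  by apply: le_trans EN; move: dh da dD C0'; rewrite /E; clear; lra.
have cl_D : `|lnd_mean nu B - n%:R * D| <= n%:R * del.
  rewrite nE DE; apply: (scaled_close (E0 := N%:R * D) NR dR C0' (ltW del0)).
  - rewrite -(Ex_lnd mu_inv Au); apply: le_trans qd _; move: C0'; clear; lra.
  - by rewrite mulKf ?gt_eqF// subrr normr0 ltW.
  - by apply: le_trans EN; move: dh da dD C0'; rewrite /E; clear; lra.
have l2E : lambda2 nu B = lnd_mean nu B - lambda1 nu B := lambda2E nu_inv Bu.
have m2E : lambda2 mu A = D - a := lambda2E mu_inv Au.
have cl (x y : R) : `|x - n%:R * y| <= n%:R * del -> `|n%:R^-1 * x - y| <= del.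
  move=> xy; rewrite -(ler_pM2l nR) -[X in X * `|_|](gtr0_norm nR) -normrM mulrBr.
  by rewrite mulVKf// gt_eqF.
exists n, Gamma, w0, nu; split=> //.
- exact: (bernoulli_measureP pD nuP).
- split.
  + have K0 : 0 < n%:R * th by rewrite mulr_gt0.
    rewrite [dim_LY _ _]/(lyapunov_dimension (entropy nu) (lambda1 nu B) (lambda2 nu B)).
    apply: (lyapunov_dimension_ge s02 (ltW eps0) K0).
    * apply: (lambda1_lna_bound nu_inv Bu) => w.
      by have := thP (val w); rewrite size_tuple mulrC.
    * exact: (lambda21_le nu_inv Bu).
    rewrite -/B l2E; move: cl_h cl_a cl_D F0; rewrite -/h -/a -/D.
    have t1 : 0 < svt s := svt_gt0 s02; have u0 := svu_ge0 s.
    have [t2 u2] : svt s <= 1 /\ svu s <= 1.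
      by move: s02; rewrite /svt /svu; clear => /andP[? ?]; case: (ltP s 1) => ?; split; lra.
    rewrite !ler_norml => /andP[ch _] /andP[ca _] /andP[cD _] F0.
    have kap0 : 0 <= n%:R * del by rewrite mulr_ge0// ltW.
    have /(ler_wpM2l (ltW nR)) F0n := F0; rewrite mulr0 in F0n.
    have := ler_wpM2l (ltW t1) ca; have := ler_wpM2l u0 cD.
    have := ler_wpM2r kap0 t2; have := ler_wpM2r kap0 u2.
    have := ler_wpM2l (ltW nR) del2.
    move: F0n ch kap0; move: (entropy nu) (lambda1 nu B) (lnd_mean nu B) (svt s) (svu s) n%:R.
    move: (h : R) (a : R) (D : R) (del : R) (th : R); clear => *; lra.
  + split.
    * apply: le_trans (cl _ _ cl_a) (le_trans del1 _); move: eps0; clear; lra.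
    * rewrite -/B l2E m2E.
      have := cl _ _ cl_a; have := cl _ _ cl_D; move: del1.
      move: (lnd_mean nu B) (lambda1 nu B) n%:R^-1 (D : R) (a : R) (del : R); clear => v y k D a del.
      rewrite !ler_norml => ? /andP[? ?] /andP[? ?].
      by apply/andP; split; lra.
    * by apply: le_trans (cl _ _ cl_h) (le_trans del1 _); move: eps0; clear; lra.
  + by exists C0 => // -[w wG]; have [] := (GP w).1 wG.
  + move=> si [Vs [Vs0 Vs1 inv]].
    have [k kE] := dvdnP zd.
    have mE : n = (2 * (size z * (N' + k)))%N by rewrite /n /N kE [(k * _)%N]mulnC -mulnDr.
    apply: (m0P si (N' + k)%N Vs _ Vs0 Vs1).
      by rewrite /N'; clear; lia.
    move=> g; rewrite -mE => gn gb; have gn' : size g == n by apply/eqP.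
    exact: (inv (exist _ (Tuple gn') ((GP (Tuple gn')).2 gb))).
- by move=> w /GP[].
Qed.

(** * Separation *)

Section Euclidean.
Variable R : realType.
Implicit Types x y : 'cV[R]_2.

Lemma enorm_ge0 x : 0 <= enorm x. Proof. by rewrite enormE sqrtr_ge0. Qed.

Lemma enorm_sqr x : enorm x ^+ 2 = nsq x.
Proof. by rewrite enormE sqr_sqrtr ?nsq_ge0. Qed.

Lemma enormD x y : enorm (x + y) <= enorm x + enorm y.
Proof.
have [x0 y0] := (enorm_ge0 x, enorm_ge0 y).
rewrite -ler_sqr ?nnegrE ?addr_ge0 ?enorm_ge0// enorm_sqr.
have -> : nsq (x + y) = nsq x + nsq y + 2 * dot x y by rewrite /nsq /dot !mxE; ring.
have h : dot x y <= enorm x * enorm y.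
  apply: le_trans (ler_norm _) _.
  rewrite -ler_sqr ?nnegrE ?mulr_ge0// real_normK ?num_real// exprMn !enorm_sqr.
  rewrite -subr_ge0; have -> : nsq x * nsq y - dot x y ^+ 2 = crs x y ^+ 2.
    by rewrite /nsq /dot /crs; ring.
  exact: sqr_ge0.
by rewrite sqrrD !enorm_sqr; move: h; move: (dot x y) (enorm x * enorm y) => a b; lra.
Qed.

Lemma enorm_mul (B : 'M[R]_2) x : enorm (B *m x) <= alpha1 B * enorm x.
Proof.
rewrite -ler_sqr ?nnegrE ?mulr_ge0 ?enorm_ge0 ?alpha1_ge0//.
by rewrite exprMn !enorm_sqr nsq_mul_le.
Qed.

Lemma enorm_nbhs (U : set 'cV[R]_2) x : open U -> U x ->
  exists2 e, 0 < e & forall y, enorm (y - x) < e -> U y.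
Proof.
move=> oU Ux; have /nbhs_ballP[e /= e0 eU] := open_nbhs_nbhs (conj oU Ux).
exists e => // y ye; apply: eU; split=> // i j; rewrite (ord1 j).
rewrite /ball /=; apply: le_lt_trans ye; rewrite distrC.
rewrite -ler_sqr ?nnegrE ?enorm_ge0// real_normK ?num_real// enorm_sqr /nsq.
have := sqr_ge0 ((y - x) 0 0); have := sqr_ge0 ((y - x) 1 0).
by case: (ord2P i) => ->; rewrite !mxE; move: (_ ^+ 2) (_ ^+ 2) => *; lra.
Qed.

Lemma compact_enorm_bounded (K : set 'cV[R]_2) : compact K ->
  exists2 M, 0 <= M & forall x, K x -> enorm x <= M.
Proof.
move=> /compact_bounded[M0 [_ KM0]]; pose M := M0 + 1.
have KM x : K x -> `|x| <= M by apply: KM0; rewrite ltrDl.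
exists (2 * `|M|); first by rewrite mulr_ge0.
move=> x Kx; have xM : `|x| <= `|M| by apply: le_trans (ler_norm _); exact: KM.
have xi i : `|x i 0| <= `|M|.
  apply: le_trans xM; rewrite /Num.norm/= mx_normrE.
  exact: (le_bigmax _ (fun k : 'I_2 * 'I_1 => `|x k.1 k.2|) (i, 0)).
rewrite -ler_sqr ?nnegrE ?mulr_ge0 ?enorm_ge0// enorm_sqr /nsq.
have := xi 0; have := xi 1; rewrite -![_ <= `|M|]ler_sqr ?nnegrE//.
rewrite ![`|x _ _| ^+ 2]real_normK ?num_real// exprMn.
by have := sqr_ge0 (`|M|); move: (_ ^+ 2) (_ ^+ 2) (_ ^+ 2) => *; lra.
Qed.

(** The discriminant is positive, so there are two real eigenvalues; their sum and
    their difference are nonzero, so their moduli differ. *)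
Lemma hyperbolic_trace (B : 'M[R]_2) : B 0 0 + B 1 1 != 0 ->
  4 * \det B < (B 0 0 + B 1 1) ^+ 2 -> hyperbolic B.
Proof.
set t := _ + _ => t0 D0.
pose r := Num.sqrt (t ^+ 2 - 4 * \det B).
have r0 : 0 < r by rewrite sqrtr_gt0 subr_gt0.
have r2 : r ^+ 2 = t ^+ 2 - 4 * \det B by rewrite sqr_sqrtr// subr_ge0 ltW.
have ev l : (2 * l - t) ^+ 2 = r ^+ 2 -> eigenvalue B l.
  move=> h; rewrite /eigenvalue /eigenspace kermx_eq0 row_free_unit unitmxE unitfE negbK.
  have : 4 * \det (B - l%:M) = (2 * l - t) ^+ 2 - r ^+ 2.
    by rewrite r2 !det2 !mxE/= mulr1n mulr0n /t; ring.
  by rewrite h subrr => /eqP; rewrite mulf_eq0 pnatr_eq0.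
exists ((t + r) / 2), ((t - r) / 2); split.
- by apply: ev; congr (_ ^+ 2); lra.
- by apply: ev; rewrite -[RHS]sqrrN; congr (_ ^+ 2); lra.
apply/eqP => e; move/eqP: t0; apply.
have : ((t + r) / 2) ^+ 2 = ((t - r) / 2) ^+ 2.
  by rewrite -[LHS]real_normK ?num_real// e real_normK ?num_real.
move=> h; have : t * r = 0 by move: h; clear => h; lra.
by move/eqP; rewrite mulf_eq0 (gt_eqF r0) orbF => /eqP.
Qed.

End Euclidean.

Section HyperbolicExtension.
Variables (R : realType) (L : finType) (A : L -> 'M[R]_2).
Hypothesis Au : forall a, A a \in unitmx.
Hypothesis irr : ~ has_invariant_line A.
Hypothesis hyp : exists i, hyperbolic (A i).

(** Every word is a prefix of one with a hyperbolic product: follow it by a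
    high power of a hyperbolic letter, after a letter that makes the dominant
    entry nonzero. *)
Lemma hyperbolic_extension w : exists2 z, (0 < size z)%N & hyperbolic (wprod A (w ++ z)).
Proof.
have [i0 hi0] := hyp.
have [W [la [mu [Wu WD mu0 mula]]]] := hyperbolic_diag (Au i0) hi0.
have Ni : Nw A W [:: i0] = diag2 la mu by rewrite /Nw wprod_seq1.
have [u G0] : exists u, Nw A W (w ++ u) 0 0 != 0.
  have [N00|N00] := eqVneq (Nw A W w 0 0) 0; last by exists [::]; rewrite cats0.
  pose x := invmx W *m cv2 0 1.
  have Wx : W *m x = cv2 0 1 by rewrite mulKVmx.
  have x0 : x != 0.
    apply/eqP => x0; move: Wx; rewrite x0 mulmx0 => /(congr1 (fun y : 'cV[R]_2 => y 1 0)) /eqP.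
    by rewrite cv2E1 mxE eq_sym oner_eq0.
  have [v vP] := level_irreducible Au (isT : (0 < 1)%N) irr hyp x0.
  exists v; have : crs (W *m x) (W *m (wprod A v *m x)) != 0.
    by rewrite crs_mul mulf_neq0// -unitfE -unitmxE.
  rewrite Nw_apply// Wx /crs !(mulmx2 (Nw A W v)) !cv2E0 !cv2E1 => v01.
  have N10 : Nw A W w 1 0 != 0.
    have : \det (Nw A W w) != 0 by rewrite -unitfE -unitmxE Nw_unit.
    by apply: contra_neq => N10; rewrite det2 N00 N10; ring.
  rewrite Nw_cat// (mulmx2 (Nw A W v)) N00 mulr0 add0r mulf_neq0//.
  by apply: contra_neq v01 => ->; ring.
set G := Nw A W (w ++ u) in G0.
have g0 : 0 < `|G 0 0| by rewrite normr_gt0.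
pose e := Num.min (`|G 0 0| / (2 * (`|G 1 1| + 1))) (`|G 0 0| ^+ 2 / (16 * (`|\det G| + 1))).
have p1 : 0 < 2 * (`|G 1 1| + 1) by rewrite mulr_gt0// ltr_wpDl.
have p2 : 0 < 16 * (`|\det G| + 1) by rewrite mulr_gt0// ltr_wpDl.
have e0 : 0 < e by rewrite lt_min !divr_gt0// exprn_gt0.
have [e1 e2] : e * (2 * (`|G 1 1| + 1)) <= `|G 0 0| /\
    e * (16 * (`|\det G| + 1)) <= `|G 0 0| ^+ 2.
  by rewrite -!ler_pdivlMr//; split; rewrite ge_min lexx ?orbT.
have [k kP] := ratio_pow_small mu0 mula e0.
have := kP k.+1 (leqnSn k); set a := k.+1 => small.
have l0 : 0 < `|la| ^+ a by rewrite exprn_gt0// (lt_trans mu0).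
exists (u ++ zpow [:: i0] a); first by rewrite size_cat size_zpow addn_gt0 orbT.
set B := wprod A _.
have NB : W *m B *m invmx W = diag2 (la ^+ a) (mu ^+ a) *m G.
  by rewrite -/(Nw A W _) catA Nw_cat// (Nw_zpow Wu Ni).
have [m00 _ _ m11] := mul_diag2l (la ^+ a) (mu ^+ a) G.
have trB : B 0 0 + B 1 1 = la ^+ a * G 0 0 + mu ^+ a * G 1 1.
  have tr2 (M : 'M[R]_2) : \tr M = M 0 0 + M 1 1 by rewrite /mxtrace sum_ord2.
  rewrite -m00 -m11 -!tr2 -NB mxtrace_mulC mulmxA mulVmx// mul1mx//.
have detB : \det B = la ^+ a * mu ^+ a * \det G.
  have : \det (W *m B *m invmx W) = \det B.
    rewrite !det_mulmx det_inv mulrAC mulfV ?mul1r//.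
    by rewrite -unitfE -unitmxE.
  by rewrite NB det_mulmx => <-; congr (_ * _); rewrite det2 !diag2E; ring.
have tB : `|la| ^+ a * `|G 0 0| < 2 * `|B 0 0 + B 1 1|.
  have := ler_normB (la ^+ a * G 0 0 + mu ^+ a * G 1 1) (mu ^+ a * G 1 1).
  rewrite addrK trB ![`|_ * G _ _|]normrM !normrX.
  have := ler_wpM2r (normr_ge0 (G 1 1)) (ltW small).
  have := ler_wpM2l (ltW l0) e1.
  have : 0 < e * `|la| ^+ a by rewrite mulr_gt0.
  move: (`|la| ^+ a) (`|mu| ^+ a) (`|G 0 0|) (`|G 1 1|) (`|_ + _|) (e : R).
  by clear => *; lra.
apply: hyperbolic_trace.
  by rewrite -normr_gt0; have : 0 < `|la| ^+ a * `|G 0 0| by [exact: mulr_gt0]; lra.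
rewrite -(real_normK (num_real (B 0 0 + B 1 1))).
have dB : 4 * \det B <= 4 * (`|la| ^+ a * `|mu| ^+ a * `|\det G|).
  by rewrite ler_pM2l// detB; apply: le_trans (ler_norm _) _; rewrite !normrM !normrX.
have sq : (`|la| ^+ a * `|G 0 0|) ^+ 2 < (2 * `|B 0 0 + B 1 1|) ^+ 2.
  by rewrite ltr_sqr ?nnegrE// ?mulr_ge0// ltW.
apply: le_lt_trans dB _.
have s1 : `|la| ^+ a * (`|mu| ^+ a * `|\det G|) <= `|la| ^+ a * (e * `|la| ^+ a * `|\det G|).
  by rewrite ler_pM2l// ler_wpM2r// ltW.
have s2 := ler_wpM2l (sqr_ge0 (`|la| ^+ a)) e2.
have s3 : 0 < e * `|la| ^+ a ^+ 2 by rewrite mulr_gt0// exprn_gt0.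
move: sq s1 s2 s3; move: (`|la| ^+ a) (`|mu| ^+ a) (`|G 0 0|) (`|\det G|) (`|_ + _|) (e : R).
by clear => *; lra.
Qed.

End HyperbolicExtension.

Section Separation.
Variables (R : realType) (L : finType) (a0 : L) (A : L -> 'M[R]_2) (v : L -> 'cV[R]_2).
Hypothesis Au : forall a, A a \in unitmx.
Hypothesis A1 : forall a, opnorm (A a) < 1.
Local Notation T := (affine_map A v).

Lemma wcomp_cat w w' x : wcomp T (w ++ w') x = wcomp T w' (wcomp T w x).
Proof. exact: foldl_cat. Qed.

Lemma wcomp_rcons w a x : wcomp T (rcons w a) x = T a (wcomp T w x).
Proof. by rewrite /wcomp foldl_rcons. Qed.

Lemma wcompB w x y : wcomp T w x - wcomp T w y = wprod A w *m (x - y).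
Proof.
elim: w x y => [|a w IH] x y; first by rewrite wprod_nil mul1mx.
rewrite wprod_cons -mulmxA -[LHS]/(wcomp T w (T a x) - wcomp T w (T a y)) IH.
by congr (_ *m _); rewrite /affine_map mulmxBr opprD addrACA subrr addr0.
Qed.

(** If [c] bounds the norms and [V] the translations, [r] is the fixed point of
    [t |-> c * t + V], and the excess of [enorm x] over [r] is contracted. *)
Lemma absorbing_disc : exists c r, [/\ 0 < c, c < 1, 0 <= r,
  (forall w, alpha1 (wprod A w) <= c ^+ size w) &
  forall w m x, 0 <= m -> enorm x <= r + m -> enorm (wcomp T w x) <= r + c ^+ size w * m].
Proof.
have [th th0 thP] := lna_contracting a0 Au A1.
pose c := expR (- th); have c0 : 0 < c by exact: expR_gt0.
have c1 : c < 1 by rewrite expR_lt1 oppr_lt0.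
have cw w : alpha1 (wprod A w) <= c ^+ size w.
  rewrite -(lnK (alpha1_gt0 (wprod_unit Au w))) -expRM_natr ler_expR mulNr.
  exact: thP.
pose V := \sum_a enorm (v a).
have V0 a : enorm (v a) <= V by rewrite /V (bigD1 a)//= lerDl sumr_ge0// => b _; exact: enorm_ge0.
have c1' : 0 < 1 - c by rewrite subr_gt0.
have VE : V = (1 - c) * (V / (1 - c)) by rewrite mulrC divfK ?gt_eqF.
have r0 : 0 <= V / (1 - c).
  exact: divr_ge0 (le_trans (enorm_ge0 (v a0)) (V0 a0)) (ltW c1').
exists c, (V / (1 - c)); split=> // w.
elim: w => [|a w IH] m x m0 xm; first by rewrite expr0 mul1r.
have cm : 0 <= c * m by rewrite mulr_ge0// ltW.
rewrite /= exprSr -mulrA; apply: (IH _ (T a x) cm).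
apply: le_trans (enormD _ _) _; apply: le_trans (lerD (enorm_mul _ _) (V0 a)) _.
have := cw [:: a]; rewrite wprod_seq1 expr1 => /(ler_wpM2r (enorm_ge0 x)).
have := ler_wpM2l (ltW c0) xm; move: VE.
move: (V / (1 - c)) (alpha1 (A a) * enorm x) (enorm x) (V : R) => r b e V'; clear => *; lra.
Qed.

Lemma wcomp_sub (U : set 'cV[R]_2) : (forall a, T a @` U `<=` U) ->
  forall w x, U x -> U (wcomp T w x).
Proof.
move=> TU; elim/last_ind => // w a IH x Ux; rewrite wcomp_rcons; apply: (TU a).
by exists (wcomp T w x) => //; exact: IH.
Qed.

(** Compare the words from the last letter, whose map is applied last: equal
    letters cancel because the maps are injective, and different letters would
    have disjoint images. *)
Lemma wcomp_disjoint (U : set 'cV[R]_2) : (forall a, T a @` U `<=` U) ->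
  (forall a b, a != b -> T a @` U `&` T b @` U = set0) ->
  forall w w' x y, U x -> U y -> size w = size w' -> wcomp T w x = wcomp T w' y -> w = w'.
Proof.
move=> TU Tdis.
have wU := wcomp_sub TU.
elim/last_ind => [|w a IH] w' x y Ux Uy.
  by move=> /esym/eqP; rewrite size_eq0 => /eqP ->.
case/lastP: w' => [|w' b]; first by rewrite size_rcons.
rewrite !size_rcons !wcomp_rcons => -[sw] e.
have [ab|ab] := eqVneq a b; last first.
  have : (T a @` U `&` T b @` U) (T a (wcomp T w x)).
    by split; [exists (wcomp T w x) => //; exact: wU | exists (wcomp T w' y) => //; exact: wU].
  by rewrite Tdis.
subst b; congr rcons; apply: (IH w' x y) => //.
have /addIr := e; exact: (can_inj (mulKmx (Au a))).
Qed.

(** A point of the attractor in [U] has arbitrarily long words leading to it, and a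
    long one sends the whole absorbing disc into [U]. If all words of [Gamma] start
    with such a word, the attractor of the subsystem is mapped into [U] by their
    common prefix, and the remaining letters separate its images. *)
Lemma separating_word : strong_open_set_condition T ->
  exists z0, forall z n (Gamma : {set n.-tuple L}), prefix z0 z -> (0 < size z)%N ->
    (forall w : n.-tuple L, w \in Gamma -> prefix z w) ->
    strong_separation (sub_maps (Gamma := Gamma) T).
Proof.
move=> [U [[U0 Ub Uo] [UE TU Tdis]]].
have [c [r [c0 c1 r0 cw dsc]]] := absorbing_disc.
have cpow M e : 0 < e -> exists k, c ^+ k * M < e.
  move=> e0; have ca : `|c| < 1 by rewrite gtr0_norm.
  have M1 : 0 < `|M| + 1 by rewrite ltr_wpDl.
  have := cvg_expr ca => /cvgrPdist_lt/(_ _ (divr_gt0 e0 M1))[k _ kP].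
  exists k; have := kP k (leqnn k); rewrite /= sub0r normrN gtr0_norm ?exprn_gt0// ltr_pdivlMr//.
  apply: le_lt_trans; rewrite ler_pM2l ?exprn_gt0//.
  by rewrite (le_trans (ler_norm _))// lerDl.
have wU := wcomp_sub TU.
have [x0 [Ux0 Ex0]] := UE.
have [cE EE] : compact (attractor T) /\ attractor T = \bigcup_a (T a @` attractor T).
  by move: Ex0; rewrite /attractor; case: xgetP => // E -> [].
have [ME ME0 MEP] := compact_enorm_bounded cE.
have back k x : attractor T x -> exists w p, [/\ size w = k, attractor T p & x = wcomp T w p].
  elim: k x => [|k IH] x Ex; first by exists [::], x.
  have := Ex; rewrite {1}EE => -[a _ [y Ey <-]].
  have [w [p [wk Ep ->]]] := IH y Ey.
  by exists (rcons w a), p; rewrite size_rcons wk wcomp_rcons.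
have [e e0 eU] := enorm_nbhs Uo Ux0.
have [k kP] := cpow (r + ME) e e0.
have [z0 [p [z0k Ep x0E]]] := back k x0 Ex0.
have z0U x : enorm x <= r -> U (wcomp T z0 x).
  move=> xr; apply: eU; rewrite x0E wcompB; apply: le_lt_trans kP.
  apply: le_trans (enorm_mul _ _) _; rewrite -z0k.
  apply: ler_pM; rewrite ?alpha1_ge0 ?enorm_ge0//.
  apply: le_trans (enormD _ _) _; apply: lerD => //.
  by rewrite -scaleN1r enormE nsqZ sqrrN expr1n mul1r -enormE; exact: MEP.
exists z0 => z' n Gamma /prefixP[z1 ->] z_0 Gz g h gh.
have zU x : enorm x <= r -> U (wcomp T (z0 ++ z1) x).
  by move=> xr; rewrite wcomp_cat; apply: wU; exact: z0U.
set z := z0 ++ z1 in z_0 Gz zU.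
have gS (g' : {w : n.-tuple L | w \in Gamma}) : exists2 u, tval (val g') = z ++ u & (size z + size u)%N = n.
  have /prefixP[u gE] := Gz _ (valP g'); exists u => //.
  by rewrite -size_cat -gE size_tuple.
pose S := sub_maps T (Gamma := Gamma).
have SE g' x : S g' x = wcomp T (val g') x by [].
have [ne|ne] := pselect (exists K, [/\ K !=set0, compact K & K = \bigcup_a (S a @` K)]); last first.
  rewrite /attractor; case: xgetP => [K _ HK|_]; first by case: ne; exists K.
  by rewrite !image_set0 setI0.
have [cK KE] : compact (attractor S) /\ attractor S = \bigcup_a (S a @` attractor S).
  have [K HK] := ne; rewrite /attractor.
  by case: xgetP => [K' _ []//|/(_ K) nK]; case: nK.
have [M M0 MP] := compact_enorm_bounded cK.
have Kk j x : attractor S x -> enorm x <= r + c ^+ j * M.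
  elim: j x => [|j IH] x Kx.
    by rewrite expr0 mul1r; apply: le_trans (MP x Kx) _; rewrite lerDr.
  have := Kx; rewrite {1}KE => -[g' _ [y Ky <-]]; rewrite SE.
  have cM : 0 <= c ^+ j * M by rewrite mulr_ge0// exprn_ge0// ltW.
  have := dsc (val g') _ _ cM (IH y Ky).
  move/le_trans; apply; rewrite lerD2l exprS -mulrA ler_wpM2r//.
  have [u _ nE] := gS g'; rewrite size_tuple -nE -[leRHS]expr1.
  rewrite ler_wiXn2l ?(ltW c0) ?(ltW c1)//.
  by apply: leq_trans z_0 _; exact: leq_addr.
have KB x : attractor S x -> enorm x <= r.
  move=> Kx; apply/ler_addgt0Pr => d d0; have [j jP] := cpow M d d0.
  by apply: le_trans (Kk j x Kx) _; rewrite lerD2l ltW.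
rewrite -subset0 => _ [[x Kx <-] [y Ky]].
rewrite -/(S h y) -/(S g x) !SE.
have [u gE nu] := gS g; have [u' hE nu'] := gS h.
rewrite gE hE (wcomp_cat z u) (wcomp_cat z u') => e'.
have uu : u = u'.
  apply: esym; apply: (wcomp_disjoint TU Tdis (zU y (KB y Ky)) (zU x (KB x Kx)) _ e').
  by move: nu nu'; clear; lia.
move/negP: gh; apply; apply/eqP; apply: val_inj; apply: val_inj.
by rewrite /= gE hE uu.
Qed.

End Separation.

Unset Implicit Arguments.

Theorem theorem1p1 (R : realType) (M : nat) (A : 'I_M.+1 -> 'M[R]_2)
    (mu : probability (seqspace (ord0 : 'I_M.+1)) R) :
  (forall i, A i \in unitmx) ->
  (forall i, opnorm (A i) < 1) ->
  0 < dim_AFF A < 2 ->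
  ~ has_invariant_line A ->
  (exists i, hyperbolic (A i)) ->
  kaenmaki_measure A mu ->
  forall eps : R, 0 < eps ->
  (exists (n : nat) (Gamma : {set n.-tuple 'I_M.+1})
      (w0 : {w : n.-tuple 'I_M.+1 | w \in Gamma})
      (nu : probability (seqspace w0) R),
    [/\ (0 < n)%N, bernoulli_measure nu &
        dominated_approximation A mu eps nu]) /\
  (forall v : 'I_M.+1 -> 'cV[R]_2,
    strong_open_set_condition (affine_map A v) ->
    exists (n : nat) (Gamma : {set n.-tuple 'I_M.+1})
        (w0 : {w : n.-tuple 'I_M.+1 | w \in Gamma})
        (nu : probability (seqspace w0) R),
      [/\ (0 < n)%N, bernoulli_measure nu,
          dominated_approximation A mu eps nu &
          strong_separation (sub_maps (Gamma := Gamma) (affine_map A v))]).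
Proof.
move=> Au A1 s02 irr hyp kmu eps eps0; have [mu_inv _] := kmu.
have F0 := kaenmaki_functional_ge0 Au s02 irr hyp kmu.
have approx z : (0 < size z)%N -> hyperbolic (wprod A z) -> _ :=
  fun z0 hz => dominated_approximation_exists Au A1 s02 irr hyp mu_inv F0 z0 hz eps0.
split=> [|v sosc].
  have [z z0 hz] := hyperbolic_extension Au irr hyp [::].
  have [n [Gamma [w0 [nu [n0 nuB nuA _]]]]] := approx z z0 hz.
  by exists n, Gamma, w0, nu.
have [w wP] := separating_word ord0 Au A1 sosc.
have [z' z0 hz] := hyperbolic_extension Au irr hyp w.
have wz : (0 < size (w ++ z'))%N by rewrite size_cat addn_gt0 z0 orbT.
have [n [Gamma [w0 [nu [n0 nuB nuA Gz]]]]] := approx _ wz hz.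
exists n, Gamma, w0, nu; split=> //.
exact: (wP (w ++ z') n Gamma (prefix_prefix w z') wz Gz).
Qed.
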